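(* Let $a\in\{p,s\}$ and $j\in\{1,2\}$. If $\mathbf{y}=(y_1,y_2)\in\mathbb{R}^2_+\cup\mathbb{R}^2_-$ and $\mathbf{x}=r\hat{\mathbf{x}}=r(\cos\theta_x,\sin\theta_x)\in\mathbb{R}^2_+$ with $\theta_x\in(0,\pi)$, then as $r\to\infty$ $$U_{a,j}(\mathbf{x},\mathbf{y})=\frac{e^{ik_{a,+}r}}{\sqrt{r}}U_{a,j}^\infty(\hat{\mathbf{x}},\mathbf{y})+O(r^{-3/4}),\qquad \nabla_{\mathbf{y}}U_{a,j}(\mathbf{x},\mathbf{y})=\frac{e^{ik_{a,+}r}}{\sqrt{r}}\nabla_{\mathbf{y}}U_{a,j}^\infty(\hat{\mathbf{x}},\mathbf{y})+O(r^{-3/4}),$$ where $$U_{a,j}^\infty(\hat{\mathbf{x}},\mathbf{y}):=e^{-i\pi/4}\sqrt{\frac{k_{a,+}}{2\pi}}\begin{cases}\sin\theta_x\,A_{a,j}(k_{a,+}\cos\theta_x,y_2)\,e^{-ik_{a,+}y_1\cos\theta_x}, & \mathbf{y}\in\mathbb{R}^2_+,\\ \sin\theta_x\,B_{a,j}(k_{a,+}\cos\theta_x,y_2)\,e^{-ik_{a,+}y_1\cos\theta_x}, & \mathbf{y}\in\mathbb{R}^2_-.\end{cases}$$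
   Context: $\mathbb{R}^2_\pm=\{x\in\mathbb{R}^2:x_2\gtrless0\}$. Constants: $\mu>0$, $2\lambda+2\mu>0$, $\rho_\pm>0$, $\rho_+\neq\rho_-$, $\omega>0$, $k_{p,\pm}=\omega\sqrt{\rho_\pm/(2\mu+\lambda)}$, $k_{s,\pm}=\omega\sqrt{\rho_\pm/\mu}$. For real $\xi$ and $a=p,s$: $\beta_{a,\pm}=\sqrt{\xi^2-k_{a,\pm}^2}$ if $|\xi|\ge k_{a,\pm}$ and $\beta_{a,\pm}=-i\sqrt{k_{a,\pm}^2-\xi^2}$ if $|\xi|<k_{a,\pm}$. Abbreviations: $\Lambda_a:=k_{a,+}^{-2}\beta_{a,+}+k_{a,-}^{-2}\beta_{a,-}$, $\delta_a:=k_{a,+}^{-2}-k_{a,-}^{-2}$, $C_0:=\frac{1}{\rho_+\omega^2}-\frac{1}{\rho_-\omega^2}$, $D:=-\Lambda_p\Lambda_s+\delta_p\delta_s\xi^2$. As functions of $(\xi,y_2)$, for $y_2>0$: $$A_{p,1}=\tfrac{C_0\xi}{D}i\big[k_{s,+}^{-2}\beta_{s,+}e^{-\beta_{s,+}y_2}-\tfrac{\delta_sk_{p,+}^{-2}\xi^2}{\Lambda_p}e^{-\beta_{p,+}y_2}\big],\quad A_{s,1}=\tfrac{C_0\xi}{D}\big[-\tfrac{\delta_pk_{s,+}^{-2}\beta_{s,+}\xi}{\Lambda_s}e^{-\beta_{s,+}y_2}+k_{p,+}^{-2}\xi e^{-\beta_{p,+}y_2}\big],$$ $$A_{p,2}=\tfrac{C_0\xi}{D}\big[k_{s,+}^{-2}\xi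 e^{-\beta_{s,+}y_2}-\tfrac{\delta_sk_{p,+}^{-2}\beta_{p,+}\xi}{\Lambda_p}e^{-\beta_{p,+}y_2}\big],\quad A_{s,2}=\tfrac{C_0\xi}{D}i\big[\tfrac{\delta_pk_{s,+}^{-2}\xi^2}{\Lambda_s}e^{-\beta_{s,+}y_2}-k_{p,+}^{-2}\beta_{p,+}e^{-\beta_{p,+}y_2}\big],$$ and for $y_2<0$: $$B_{p,1}=\tfrac{C_0\xi}{D}i\big[-k_{s,-}^{-2}\beta_{s,-}e^{\beta_{s,-}y_2}-\tfrac{\delta_sk_{p,-}^{-2}\xi^2}{\Lambda_p}e^{\beta_{p,-}y_2}\big],\quad B_{s,1}=\tfrac{C_0\xi}{D}\big[\tfrac{\delta_pk_{s,-}^{-2}\beta_{s,-}\xi}{\Lambda_s}e^{\beta_{s,-}y_2}+k_{p,-}^{-2}\xi e^{\beta_{p,-}y_2}\big],$$ $$B_{p,2}=\tfrac{C_0\xi}{D}\big[k_{s,-}^{-2}\xi e^{\beta_{s,-}y_2}+\tfrac{\delta_sk_{p,-}^{-2}\beta_{p,-}\xi}{\Lambda_p}e^{\beta_{p,-}y_2}\big],\quad B_{s,2}=\tfrac{C_0\xi}{D}i\big[\tfrac{\delta_pk_{s,-}^{-2}\xi^2}{\Lambda_s}e^{\beta_{s,-}y_2}+k_{p,-}^{-2}\beta_{p,-}e^{\beta_{p,-}y_2}\big].$$ The function $U_{a,j}$ is $$U_{a,j}(\mathbf{x},\mathbf{y})=\frac{1}{2\pi}\int_{-\infty}^{+\infty}\hat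 U_{a,j}(\xi,x_2,y_2)e^{i(x_1-y_1)\xi}d\xi,\qquad \hat U_{a,j}=\begin{cases}A_{a,j}e^{-\beta_{a,+}x_2}, & x_2>0,\ y_2>0,\\ A_{a,j}e^{\beta_{a,-}x_2}, & x_2<0,\ y_2>0,\\ B_{a,j}e^{-\beta_{a,+}x_2}, & x_2>0,\ y_2<0,\\ B_{a,j}e^{\beta_{a,-}x_2}, & x_2<0,\ y_2<0.\end{cases}$$ *)

(* Defs.v *)
From Stdlib Require Import Reals.
From Coquelicot Require Import Coquelicot.

Local Open Scope R_scope.

Inductive side := Plus | Minus.
Inductive wave := Wp | Ws.
Inductive axis := One | Two.

Definition point : Type := (R * R)%type.

Definition half_plane (s : side) (y : point) : Prop :=
  match s with Plus => 0 < snd y | Minus => snd y < 0 end.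

Definition Cexp (z : C) : C := (exp (Re z) * cos (Im z), exp (Re z) * sin (Im z)).

Record medium := Medium
  { mu : R; lambda : R; rho : side -> R; omega : R }.

Section Medium_functions.
Context (m : medium).

Definition modulus (a : wave) : R :=
  match a with Wp => 2 * mu m + lambda m | Ws => mu m end.

Definition k (a : wave) (s : side) : R := omega m * sqrt (rho m s / modulus a).

Definition ik2 (a : wave) (s : side) : R := / (k a s ^ 2).

Definition beta (a : wave) (s : side) (xi : R) : C :=
  if Rle_dec (k a s) (Rabs xi)
  then RtoC (sqrt (xi ^ 2 - k a s ^ 2))
  else (- Ci * sqrt (k a s ^ 2 - xi ^ 2)%R)%C.

Definition Lam (a : wave) (xi : R) : C :=
  (ik2 a Plus * beta a Plus xi + ik2 a Minus * beta a Minus xi)%C.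

Definition delta (a : wave) : R := ik2 a Plus - ik2 a Minus.

Definition C0 : R :=
  1 / (rho m Plus * omega m ^ 2) - 1 / (rho m Minus * omega m ^ 2).

Definition D (xi : R) : C :=
  (- (Lam Wp xi * Lam Ws xi) + RtoC (delta Wp * delta Ws * xi ^ 2)%R)%C.

Definition coefA (a : wave) (j : axis) (xi y2 : R) : C :=
  let bp := beta Wp Plus xi in
  let bs := beta Ws Plus xi in
  let kp2 := RtoC (ik2 Wp Plus) in
  let ks2 := RtoC (ik2 Ws Plus) in
  let dp := RtoC (delta Wp) in
  let ds := RtoC (delta Ws) in
  let ep := Cexp (- bp * y2)%C in
  let es := Cexp (- bs * y2)%C in
  let q := (C0 * xi / D xi)%C in
  match a, j with
  | Wp, One => (q * Ci * (ks2 * bs * es - ds * kp2 * RtoC (xi ^ 2)%R / Lam Wp xi * ep))%C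
  | Ws, One => (q * (- (dp * ks2 * bs * xi / Lam Ws xi * es) + kp2 * xi * ep))%C
  | Wp, Two => (q * (ks2 * xi * es - ds * kp2 * bp * xi / Lam Wp xi * ep))%C
  | Ws, Two => (q * Ci * (dp * ks2 * RtoC (xi ^ 2)%R / Lam Ws xi * es - kp2 * bp * ep))%C
  end.

Definition coefB (a : wave) (j : axis) (xi y2 : R) : C :=
  let bp := beta Wp Minus xi in
  let bs := beta Ws Minus xi in
  let kp2 := RtoC (ik2 Wp Minus) in
  let ks2 := RtoC (ik2 Ws Minus) in
  let dp := RtoC (delta Wp) in
  let ds := RtoC (delta Ws) in
  let ep := Cexp (bp * y2)%C in
  let es := Cexp (bs * y2)%C in
  let q := (C0 * xi / D xi)%C in
  match a, j with
  | Wp, One => (q * Ci * (- (ks2 * bs * es) - ds * kp2 * RtoC (xi ^ 2)%R / Lam Wp xi * ep))%C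
  | Ws, One => (q * (dp * ks2 * bs * xi / Lam Ws xi * es + kp2 * xi * ep))%C
  | Wp, Two => (q * (ks2 * xi * es + ds * kp2 * bp * xi / Lam Wp xi * ep))%C
  | Ws, Two => (q * Ci * (dp * ks2 * RtoC (xi ^ 2)%R / Lam Ws xi * es + kp2 * bp * ep))%C
  end.

(* The values on the interface lines x2 = 0 and y2 = 0 are immaterial. *)
Definition hatU (a : wave) (j : axis) (xi x2 y2 : R) : C :=
  ((if Rlt_dec 0 y2 then coefA a j xi y2 else coefB a j xi y2) *
   (if Rlt_dec 0 x2 then Cexp (- beta a Plus xi * x2)
    else Cexp (beta a Minus xi * x2)))%C.

Definition integrand (a : wave) (j : axis) (x y : point) (xi : R) : C :=
  (hatU a j xi (snd x) (snd y) * Cexp (Ci * RtoC ((fst x - fst y) * xi)%R))%C.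

Definition U (a : wave) (j : axis) (x y : point) : C :=
  (RtoC (1 / (2 * PI))%R *
   RInt_gen (V := C_R_CompleteNormedModule) (integrand a j x y)
     (Rbar_locally m_infty) (Rbar_locally p_infty))%C.

Definition Uinf (a : wave) (j : axis) (theta : R) (y : point) : C :=
  let kc := k a Plus * cos theta in
  (Cexp (- Ci * RtoC (PI / 4)%R) * RtoC (sqrt (k a Plus / (2 * PI))) *
   (sin theta *
    (if Rlt_dec 0 (snd y) then coefA a j kc (snd y) else coefB a j kc (snd y)) *
    Cexp (- Ci * RtoC (k a Plus * fst y * cos theta)%R)))%C.

End Medium_functions.

Definition polar (r theta : R) : point := (r * cos theta, r * sin theta).

Definition coord (i : axis) (y : point) : R :=
  match i with One => fst y | Two => snd y end.

Definition set_coord (i : axis) (y : point) (t : R) : point :=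
  match i with One => (t, snd y) | Two => (fst y, t) end.

Definition has_grad (F : point -> C) (y : point) : Prop :=
  forall i : axis,
    ex_derive (K := R_AbsRing) (V := C_R_NormedModule)
      (fun t : R => F (set_coord i y t)) (coord i y).

(* Meaningful only where [has_grad F y] holds, since [Derive] is total. *)
Definition grad (F : point -> C) (y : point) (i : axis) : C :=
  (Derive (fun t => Re (F (set_coord i y t))) (coord i y),
   Derive (fun t => Im (F (set_coord i y t))) (coord i y)).

Definition bigO_infty (f : R -> C) (g : R -> R) : Prop :=
  exists M : R, Rbar_locally p_infty (fun r => Cmod (f r) <= M * Rabs (g r)).

(* Main.v *)
From Stdlib Require Import Reals Lra Lia Psatz FunctionalExtensionality.
From Coquelicot Require Import Coquelicot.
Require Import Defs.

Local Open Scope R_scope.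

(** The field is the integral of an amplitude, which carries the source point,
    against the plane wave [exp (- beta x2 + i x1 xi)].

    For [|xi| > k] the wave is evanescent and contributes [O (1 / r^2)] as soon
    as the amplitude is bounded ([plane_wave_integral]).  For [|xi| < k] the
    substitution [xi = k cos phi] turns the exponent into
    [i k r cos (phi - theta)], whose only stationary point on [0, PI] is
    [phi = theta] ([propagating_integral]).  There, comparison with the multiple
    of [cos (s / 2)], [s = phi - theta], having the same value isolates an
    incomplete Fresnel integral, since [2 sin (s / 2)] makes the phase exactly
    quadratic ([circle_fresnel], [fresnel_asymptotic]).

    What is left vanishes at the stationary point, but it is not smooth: each of
    the four wave numbers is a square root branch point of the amplitude, and one
    of them may coincide with the stationary point, which is what limits the
    error to [r^(- 3/4)].  So the regularity in use is [tame]: increments are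
    dominated by those of a monotone 1/2-Hoelder function.  It survives algebra
    and monotone substitutions, hence holds for all coefficients, and it suffices
    for a bound: the Hoelder property is used within [(k r)^(- 1/2)] of the
    stationary point, and beyond it bounded variation together with a second mean
    value theorem ([abel_bound], [stationary_vanishing]).

    The coefficients are bounded by polynomials because [Lam] and [D] stay away
    from zero ([Lam_lower_bound], [D_lower_bound]); away from the interface the
    source factor [exp (- beta |y2|)] makes every amplitude bounded
    ([coef_symbols], [exponential_family]).  The same decay gives difference
    quotients in the source point a remainder that is quadratic uniformly in
    [xi].  Radiated field and far field are both bounded linear functionals of the
    amplitude, so differentiation passes through either of them
    ([bounded_functional_derive]), and the expansion of the gradient is the
    expansion of the field for the differentiated amplitude. *)

(** * Calculus of complex valued functions of a real variable *)

Notation Ccont f x := (@continuous R_UniformSpace C_UniformSpace f x).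
Notation is_Cder f x l := (@is_derive R_AbsRing C_R_NormedModule f x l).
Notation is_CInt f a b l := (@is_RInt C_R_NormedModule f a b l).
Notation ex_CInt f a b := (@ex_RInt C_R_NormedModule f a b).
Definition CInt (f : R -> C) (a b : R) : C := @RInt C_R_CompleteNormedModule f a b.

Lemma Ccont_pair (f : R -> C) (x : R) :
  continuous (fun t => Re (f t)) x -> continuous (fun t => Im (f t)) x ->
  Ccont f x.
Proof.
intros H1 H2.
apply continuous_ext with (fun t => (Re (f t), Im (f t))).
{ intros t; symmetry; apply surjective_pairing. }
apply filterlim_locally; intros eps.
assert (A1 := proj1 (filterlim_locally _ _) H1 eps).
assert (A2 := proj1 (filterlim_locally _ _) H2 eps).
generalize (filter_and _ _ A1 A2); apply filter_imp.
intros t [B1 B2]; split; assumption.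
Qed.

Lemma Ccont_Re (f : R -> C) (x : R) : Ccont f x -> continuous (fun t => Re (f t)) x.
Proof. intros H; apply (continuous_comp f (fun z : C => fst z)); [exact H|apply continuous_fst]. Qed.

Lemma Ccont_Im (f : R -> C) (x : R) : Ccont f x -> continuous (fun t => Im (f t)) x.
Proof. intros H; apply (continuous_comp f (fun z : C => snd z)); [exact H|apply continuous_snd]. Qed.

Lemma Ccont_plus (f g : R -> C) (x : R) :
  Ccont f x -> Ccont g x -> Ccont (fun t => f t + g t)%C x.
Proof. intros; apply (continuous_plus (V := C_R_NormedModule) f g); assumption. Qed.

Lemma Ccont_opp (f : R -> C) (x : R) :
  Ccont f x -> Ccont (fun t => - f t)%C x.
Proof. intros; apply (continuous_opp (V := C_R_NormedModule) f); assumption. Qed.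

Lemma Ccont_minus (f g : R -> C) (x : R) :
  Ccont f x -> Ccont g x -> Ccont (fun t => f t - g t)%C x.
Proof. intros; apply Ccont_plus; [|apply Ccont_opp]; assumption. Qed.

Lemma Ccont_mult (f g : R -> C) (x : R) :
  Ccont f x -> Ccont g x -> Ccont (fun t => f t * g t)%C x.
Proof.
intros Hf Hg; apply Ccont_pair; simpl.
- apply (continuous_minus (fun t => Re (f t) * Re (g t)) (fun t => Im (f t) * Im (g t)));
  apply @continuous_mult; auto using Ccont_Re, Ccont_Im.
- apply (continuous_plus (fun t => Re (f t) * Im (g t)) (fun t => Im (f t) * Re (g t)));
  apply @continuous_mult; auto using Ccont_Re, Ccont_Im.
Qed.

Lemma Ccont_RtoC (f : R -> R) (x : R) : continuous f x -> Ccont (fun t => RtoC (f t)) x.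
Proof. intros H; apply Ccont_pair; [exact H|apply continuous_const]. Qed.

Lemma Ccont_Cexp (f : R -> C) (x : R) : Ccont f x -> Ccont (fun t => Cexp (f t)) x.
Proof.
intros Hf; apply Ccont_pair; simpl; apply @continuous_mult.
- apply (continuous_comp (fun t => Re (f t)) exp); [now apply Ccont_Re|].
  apply continuity_pt_filterlim, derivable_continuous_pt, derivable_pt_exp.
- apply (continuous_comp (fun t => Im (f t)) cos); [now apply Ccont_Im|apply continuous_cos].
- apply (continuous_comp (fun t => Re (f t)) exp); [now apply Ccont_Re|].
  apply continuity_pt_filterlim, derivable_continuous_pt, derivable_pt_exp.
- apply (continuous_comp (fun t => Im (f t)) sin); [now apply Ccont_Im|apply continuous_sin].
Qed.

Lemma Ccont_Cmod (f : R -> C) (x : R) : Ccont f x -> continuous (fun t => Cmod (f t)) x.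
Proof.
intros H; apply continuous_ext with (fun t => norm (f t : C_R_NormedModule)).
{ intros t; symmetry; apply Cmod_norm. }
apply (continuous_comp f (fun z : C_R_NormedModule => norm z)); [exact H|].
exact (@filterlim_norm R_AbsRing C_R_NormedModule (f x)).
Qed.

Lemma continuous_of_derivable (f : R -> R) (x l : R) : is_derive f x l -> continuous f x.
Proof. intros H; apply (ex_derive_continuous (V := R_NormedModule)); now exists l. Qed.

Lemma continuity_pt_of_derivable (f : R -> R) (x l : R) : is_derive f x l -> continuity_pt f x.
Proof. intros H; apply continuity_pt_filterlim; exact (continuous_of_derivable f x l H). Qed.

Lemma is_Cder_cont (f : R -> C) (x : R) (l : C) : is_Cder f x l -> Ccont f x.
Proof. intros H; apply (ex_derive_continuous (V := C_R_NormedModule)); now exists l. Qed.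

Lemma is_Cder_pair (f : R -> C) (x : R) (l : C) :
  is_derive (fun t => Re (f t)) x (Re l) -> is_derive (fun t => Im (f t)) x (Im l) ->
  is_Cder f x l.
Proof.
intros [_ H1] [_ H2]; split; [apply (is_linear_scal_l (V := C_R_NormedModule))|].
intros y Hy eps.
assert (Hx := is_filter_lim_locally_unique _ _ Hy); subst y.
set (eps2 := mkposreal (eps / 2) (is_pos_div_2 eps)).
specialize (H1 x Hy eps2); specialize (H2 x Hy eps2).
generalize (filter_and _ _ H1 H2); apply filter_imp; intros t [B1 B2].
rewrite <- Cmod_norm.
match goal with |- Cmod ?z <= _ => replace z with
  ((RtoC (Re (f t) - Re (f x) - (t - x) * Re l))
   + Ci * RtoC (Im (f t) - Im (f x) - (t - x) * Im l))%C end.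
2:{ apply injective_projections; cbv -[Rplus Rmult Ropp]; ring. }
eapply Rle_trans; [apply Cmod_triangle|].
rewrite Cmod_mult, !Cmod_R.
assert (E : Cmod Ci = 1).
{ unfold Cmod; simpl; replace (0 * (0 * 1) + 1 * (1 * 1)) with 1 by ring; apply sqrt_1. }
rewrite E.
change (Rabs (Re (f t) - Re (f x) - (t - x) * Re l) <= eps / 2 * Rabs (t - x)) in B1.
change (Rabs (Im (f t) - Im (f x) - (t - x) * Im l) <= eps / 2 * Rabs (t - x)) in B2.
change (norm (minus t x)) with (Rabs (t - x)); lra.
Qed.

Lemma is_Cder_Re (f : R -> C) (x : R) (l : C) :
  is_Cder f x l -> is_derive (fun t => Re (f t)) x (Re l).
Proof.
intros H.
apply (filterdiff_comp f (fun z : C_R_NormedModule => fst z) (fun y => scal y l) (fun z => fst z)); [exact H|].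
apply filterdiff_linear, is_linear_fst.
Qed.

Lemma is_Cder_Im (f : R -> C) (x : R) (l : C) :
  is_Cder f x l -> is_derive (fun t => Im (f t)) x (Im l).
Proof.
intros H.
apply (filterdiff_comp f (fun z : C_R_NormedModule => snd z) (fun y => scal y l) (fun z => snd z)); [exact H|].
apply filterdiff_linear, is_linear_snd.
Qed.

Lemma is_Cder_mult (f g : R -> C) (x : R) (lf lg : C) :
  is_Cder f x lf -> is_Cder g x lg ->
  is_Cder (fun t => f t * g t)%C x (lf * g x + f x * lg)%C.
Proof.
intros Hf Hg.
assert (F1 := is_Cder_Re _ _ _ Hf); assert (F2 := is_Cder_Im _ _ _ Hf).
assert (G1 := is_Cder_Re _ _ _ Hg); assert (G2 := is_Cder_Im _ _ _ Hg).
assert (A : forall (u v w z : R -> R) (du dv dw dz : R),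
  is_derive u x du -> is_derive v x dv -> is_derive w x dw -> is_derive z x dz ->
  is_derive (fun t => u t * v t + w t * z t) x (du * v x + u x * dv + (dw * z x + w x * dz))).
{ intros u v w z du dv dw dz Hu Hv Hw Hz; auto_derive.
  - repeat split; eapply ex_intro; eassumption.
  - change (fun x0 : R => u x0) with u; change (fun x0 : R => v x0) with v;
    change (fun x0 : R => w x0) with w; change (fun x0 : R => z x0) with z.
    rewrite (is_derive_unique _ _ _ Hu), (is_derive_unique _ _ _ Hv),
      (is_derive_unique _ _ _ Hw), (is_derive_unique _ _ _ Hz); ring. }
apply is_Cder_pair.
- apply is_derive_ext with (fun t => Re (f t) * Re (g t) + (- Im (f t)) * Im (g t)).
  { intros t; unfold Re, Im; simpl; unfold Re, Im; ring. }
  evar_last; [refine (A (fun t => Re (f t)) (fun t => Re (g t)) (fun t => - Im (f t)) (fun t => Im (g t)) _ _ _ _ F1 G1 _ G2)|].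
  + apply (is_derive_opp (V := R_NormedModule) (fun t => Im (f t))); exact F2.
  + unfold opp; unfold Re, Im; simpl; unfold Re, Im; ring.
- evar_last; [refine (A (fun t => Re (f t)) (fun t => Im (g t)) (fun t => Im (f t)) (fun t => Re (g t)) _ _ _ _ F1 G2 F2 G1)|].
  unfold Re, Im; simpl; unfold Re, Im; ring.
Qed.

Lemma is_Cder_Cexp (f : R -> C) (x : R) (l : C) :
  is_Cder f x l -> is_Cder (fun t => Cexp (f t)) x (l * Cexp (f x))%C.
Proof.
intros Hf.
assert (F1 := is_Cder_Re _ _ _ Hf); assert (F2 := is_Cder_Im _ _ _ Hf).
assert (A : forall (u v : R -> R) (du dv : R), is_derive u x du -> is_derive v x dv ->
  is_derive (fun t => exp (u t) * cos (v t)) x (du * (exp (u x) * cos (v x)) - dv * (exp (u x) * sin (v x))) /\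
  is_derive (fun t => exp (u t) * sin (v t)) x (du * (exp (u x) * sin (v x)) + dv * (exp (u x) * cos (v x)))).
{ intros u v du dv Hu Hv; split; auto_derive.
  1,3: repeat split; eapply ex_intro; eassumption.
  all: change (fun x0 : R => u x0) with u; change (fun x0 : R => v x0) with v;
    rewrite (is_derive_unique _ _ _ Hu), (is_derive_unique _ _ _ Hv); ring. }
destruct (A _ _ _ _ F1 F2) as [A1 A2].
apply is_Cder_pair; simpl; [exact A1|].
evar_last; [exact A2|]; unfold Re, Im; ring.
Qed.

Lemma is_Cder_RtoC (f : R -> R) (x l : R) :
  is_derive f x l -> is_Cder (fun t => RtoC (f t)) x (RtoC l).
Proof. intros H; apply is_Cder_pair; simpl; [exact H|apply @is_derive_const]. Qed.

Lemma is_Cder_const (c : C) (x : R) : is_Cder (fun _ => c) x (RtoC 0).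
Proof. apply (is_derive_const (V := C_R_NormedModule)). Qed.

Lemma Cexp_plus (z w : C) : Cexp (z + w)%C = (Cexp z * Cexp w)%C.
Proof.
unfold Cexp; apply injective_projections; simpl; rewrite exp_plus, ?cos_plus, ?sin_plus;
unfold Re, Im; ring.
Qed.

Lemma Cexp_0 : Cexp (RtoC 0) = RtoC 1.
Proof. unfold Cexp; simpl; rewrite exp_0, cos_0, sin_0; unfold RtoC; f_equal; ring. Qed.

Lemma Cmod_Cexp (z : C) : Cmod (Cexp z) = exp (Re z).
Proof.
unfold Cmod, Cexp; simpl.
replace (_ + _) with (Rsqr (exp (Re z)) * (Rsqr (sin (Im z)) + Rsqr (cos (Im z)))) by (unfold Rsqr; ring).
rewrite sin2_cos2, Rmult_1_r; apply sqrt_Rsqr, Rlt_le, exp_pos.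
Qed.

Lemma Cmod_Ci : Cmod Ci = 1.
Proof. unfold Cmod; simpl; replace (0 * (0 * 1) + 1 * (1 * 1)) with 1 by ring; apply sqrt_1. Qed.

Lemma Cmod_Cexp_i (t : R) : Cmod (Cexp (Ci * RtoC t)%C) = 1.
Proof. rewrite Cmod_Cexp; simpl; replace (_ - _) with 0 by ring; apply exp_0. Qed.

Lemma Cmod_sub_triangle (a b c : C) : Cmod (a - c)%C <= Cmod (a - b)%C + Cmod (b - c)%C.
Proof. replace (a - c)%C with ((a - b) + (b - c))%C by ring; apply Cmod_triangle. Qed.

Lemma ex_CInt_cont (f : R -> C) (a b : R) :
  (forall x, Rmin a b <= x <= Rmax a b -> Ccont f x) -> ex_CInt f a b.
Proof. apply (@ex_RInt_continuous C_R_CompleteNormedModule). Qed.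

Lemma CInt_correct (f : R -> C) (a b : R) :
  ex_CInt f a b -> is_CInt f a b (CInt f a b).
Proof. apply (@RInt_correct C_R_CompleteNormedModule). Qed.

Lemma is_CInt_unique (f : R -> C) (a b : R) (l : C) : is_CInt f a b l -> CInt f a b = l.
Proof. apply (@is_RInt_unique C_R_CompleteNormedModule). Qed.

Lemma is_CInt_Cmult (f : R -> C) (a b : R) (l c : C) :
  is_CInt f a b l -> is_CInt (fun t => c * f t)%C a b (c * l)%C.
Proof.
intros H.
assert (H1 : is_RInt (fun t => Re (f t)) a b (Re l)).
{ exact (is_RInt_fct_extend_fst (U := R_NormedModule) (V := R_NormedModule) f a b l H). }
assert (H2 : is_RInt (fun t => Im (f t)) a b (Im l)).
{ exact (is_RInt_fct_extend_snd (U := R_NormedModule) (V := R_NormedModule) f a b l H). }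
apply (is_RInt_fct_extend_pair (U := R_NormedModule) (V := R_NormedModule)); simpl.
- apply (is_RInt_minus (V := R_NormedModule) (fun t => Re c * Re (f t)) (fun t => Im c * Im (f t)));
  apply (is_RInt_scal (V := R_NormedModule)); assumption.
- apply (is_RInt_plus (V := R_NormedModule) (fun t => Re c * Im (f t)) (fun t => Im c * Re (f t)));
  apply (is_RInt_scal (V := R_NormedModule)); assumption.
Qed.

Lemma is_CInt_plus (f g : R -> C) (a b : R) (lf lg : C) :
  is_CInt f a b lf -> is_CInt g a b lg -> is_CInt (fun t => f t + g t)%C a b (lf + lg)%C.
Proof. apply (@is_RInt_plus C_R_NormedModule). Qed.

Lemma is_CInt_minus (f g : R -> C) (a b : R) (lf lg : C) :
  is_CInt f a b lf -> is_CInt g a b lg -> is_CInt (fun t => f t - g t)%C a b (lf - lg)%C.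
Proof. apply (@is_RInt_minus C_R_NormedModule). Qed.

Lemma is_CInt_ext (f g : R -> C) (a b : R) (l : C) : a <= b ->
  (forall x, a < x < b -> f x = g x) -> is_CInt f a b l -> is_CInt g a b l.
Proof.
intros Hab H; apply (@is_RInt_ext C_R_NormedModule).
rewrite Rmin_left, Rmax_right; assumption.
Qed.

Lemma CInt_Chasles (f : R -> C) (a b c : R) :
  ex_CInt f a b -> ex_CInt f b c -> CInt f a c = (CInt f a b + CInt f b c)%C.
Proof. intros; symmetry; now apply (@RInt_Chasles C_R_CompleteNormedModule). Qed.

Lemma CInt_swap (f : R -> C) (a b : R) : ex_CInt f a b -> CInt f b a = (- CInt f a b)%C.
Proof. intros H; symmetry; now apply (opp_RInt_swap (V := C_R_CompleteNormedModule)). Qed.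

Lemma is_CInt_der (f df : R -> C) (a b : R) : a <= b ->
  (forall x, a <= x <= b -> is_Cder f x (df x)) ->
  (forall x, a <= x <= b -> Ccont df x) ->
  is_CInt df a b (f b - f a)%C.
Proof.
intros Hab H1 H2; apply (is_RInt_derive (V := C_R_CompleteNormedModule));
rewrite Rmin_left, Rmax_right; assumption.
Qed.

Lemma is_CInt_norm (f : R -> C) (g : R -> R) (a b : R) (l : C) (lg : R) :
  a <= b -> (forall x, a <= x <= b -> Cmod (f x) <= g x) ->
  is_CInt f a b l -> is_RInt g a b lg -> Cmod l <= lg.
Proof.
intros Hab H1 H2 H3; rewrite Cmod_norm.
apply (norm_RInt_le (V := C_R_NormedModule) f g a b l lg Hab); [|exact H2|exact H3].
intros x Hx; rewrite <- Cmod_norm; auto.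
Qed.

Lemma is_CInt_norm_const (f : R -> C) (a b : R) (l : C) (M : R) :
  a <= b -> (forall x, a <= x <= b -> Cmod (f x) <= M) ->
  is_CInt f a b l -> Cmod l <= M * (b - a).
Proof.
intros Hab H1 H2; apply (is_CInt_norm f (fun _ => M) a b l _ Hab H1 H2).
rewrite Rmult_comm; apply (is_RInt_const (V := R_NormedModule)).
Qed.

(** The segment from [w] to [z] stays in the half plane where the exponential
    is bounded by [exp M], hence so does the integral of its derivative. *)
Lemma Cexp_lipschitz (z w : C) (M : R) : Re z <= M -> Re w <= M ->
  Cmod (Cexp z - Cexp w)%C <= exp M * Cmod (z - w)%C.
Proof.
intros Hz Hw.
set (p := fun s : R => (w + RtoC s * (z - w))%C).
assert (Hp : forall s, is_Cder p s (z - w)%C).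
{ intros s; apply is_Cder_pair; simpl; auto_derive; trivial; unfold Re, Im; simpl; ring. }
assert (I : is_CInt (fun s => (z - w) * Cexp (p s))%C 0 1 (Cexp (p 1) - Cexp (p 0))%C).
{ apply (is_CInt_der (fun s => Cexp (p s))); [lra| |].
  - intros x _; apply is_Cder_Cexp, Hp.
  - intros x _; apply Ccont_mult; [apply continuous_const|].
    apply Ccont_Cexp; eapply is_Cder_cont, Hp. }
replace (p 1) with z in I by (unfold p; ring).
replace (p 0) with w in I by (unfold p; ring).
replace (exp M * Cmod (z - w)%C) with ((exp M * Cmod (z - w)%C) * (1 - 0)) by ring.
revert I; apply is_CInt_norm_const; [lra|].
intros s Hs; rewrite Cmod_mult, Cmod_Cexp, Rmult_comm.
apply Rmult_le_compat_r; [apply Cmod_ge_0|].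
assert (E : Re (p s) <= M) by (unfold p, Re in *; simpl; nra).
destruct E as [E|E]; [left; now apply exp_increasing|right; now rewrite E].
Qed.

Lemma exp_le (x y : R) : x <= y -> exp x <= exp y.
Proof. intros [E|E]; [left; now apply exp_increasing|right; now rewrite E]. Qed.

Lemma Cexp_remainder (w : C) :
  Cmod (Cexp w - 1 - w)%C <= Cmod w ^ 2 * exp (Cmod w).
Proof.
assert (Hp : forall s : R, is_Cder (fun s : R => RtoC s * w)%C s w).
{ intros s; apply is_Cder_pair; simpl; auto_derive; trivial; unfold Re, Im; simpl; ring. }
assert (I : is_CInt (fun s => w * Cexp (RtoC s * w) - w)%C 0 1
   ((Cexp (RtoC 1 * w) - RtoC 1 * w) - (Cexp (RtoC 0 * w) - RtoC 0 * w))%C).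
{ apply (is_CInt_der (fun s => Cexp (RtoC s * w) - RtoC s * w)%C); [lra| |].
  - intros x _; apply (is_derive_minus (V := C_R_NormedModule) (fun s : R => Cexp (RtoC s * w))); [|apply Hp].
    apply (is_Cder_Cexp (fun s : R => RtoC s * w)%C), Hp.
  - intros x _; apply Ccont_minus; [|apply continuous_const].
    apply Ccont_mult; [apply continuous_const|].
    apply Ccont_Cexp; eapply is_Cder_cont, Hp. }
replace ((Cexp (RtoC 1 * w) - RtoC 1 * w) - (Cexp (RtoC 0 * w) - RtoC 0 * w))%C
  with (Cexp w - 1 - w)%C in I.
2:{ replace (RtoC 1 * w)%C with w by ring; replace (RtoC 0 * w)%C with (RtoC 0) by ring.
    rewrite Cexp_0; ring. }
replace (Cmod w ^ 2 * exp (Cmod w)) with ((Cmod w ^ 2 * exp (Cmod w)) * (1 - 0)) by ring.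
revert I; apply is_CInt_norm_const; [lra|].
intros s Hs.
replace (w * Cexp (RtoC s * w) - w)%C with (w * (Cexp (RtoC s * w) - Cexp (RtoC 0)))%C
  by (rewrite Cexp_0; ring).
rewrite Cmod_mult.
assert (B : Cmod (Cexp (RtoC s * w) - Cexp (RtoC 0))%C <= exp (Cmod w) * Cmod (RtoC s * w - RtoC 0)%C).
{ assert (H0 := Cmod_ge_0 w).
  apply Cexp_lipschitz.
  - apply Rle_trans with (Cmod (RtoC s * w)%C).
    + eapply Rle_trans; [apply Rle_abs|apply re_le_Cmod].
    + rewrite Cmod_mult, Cmod_R, Rabs_pos_eq by lra. nra.
  - simpl; lra. }
replace (RtoC s * w - RtoC 0)%C with (RtoC s * w)%C in B by ring.
rewrite Cmod_mult, Cmod_R, Rabs_pos_eq in B by lra.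
assert (H0 := Cmod_ge_0 w); assert (H1 := exp_pos (Cmod w)).
replace (Cmod w ^ 2 * exp (Cmod w)) with (Cmod w * (exp (Cmod w) * (1 * Cmod w))) by ring.
apply Rmult_le_compat_l; [assumption|].
eapply Rle_trans; [exact B|]. apply Rmult_le_compat_l; [lra|].
apply Rmult_le_compat_r; lra.
Qed.

(** * Abel summation *)

(** On a short interval [G] is almost constant, so freezing it at the left end
    costs at most the mesh times the increment of [V]. *)
Lemma abel_local (G g P : R -> C) (V : R -> R) (x y M N : R) :
  x <= y ->
  (forall t, x <= t <= y -> Cmod (G t - G x)%C <= V y - V x) ->
  (forall t, x <= t <= y -> is_Cder P t (g t)) ->
  (forall t, x <= t <= y -> Ccont g t) ->
  (forall t, x <= t <= y -> Ccont G t) ->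
  Cmod (P y) <= M ->
  (forall t, x <= t <= y -> Cmod (g t) <= N) ->
  Cmod (CInt (fun t => G t * g t)%C x y - (G y * P y - G x * P x))%C
    <= (M + N * (y - x)) * (V y - V x).
Proof.
intros Hxy HG HP Hg HGc HM HN.
assert (HV : 0 <= V y - V x).
{ eapply Rle_trans; [apply Cmod_ge_0|apply (HG y); lra]. }
assert (I1 : is_CInt (fun t => G t * g t)%C x y (CInt (fun t => G t * g t)%C x y)).
{ apply CInt_correct, ex_CInt_cont; rewrite Rmin_left, Rmax_right by lra.
  intros; apply Ccont_mult; auto. }
assert (I2 : is_CInt g x y (P y - P x)%C) by (apply is_CInt_der; auto).
assert (I3 := is_CInt_minus _ _ _ _ _ _ I1 (is_CInt_Cmult _ _ _ _ (G x) I2)).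
assert (B : Cmod (CInt (fun t => G t * g t)%C x y - G x * (P y - P x))%C
            <= (N * (V y - V x)) * (y - x)).
{ revert I3; apply is_CInt_norm_const; [lra|]; intros t Ht.
  replace (G t * g t - G x * g t)%C with (g t * (G t - G x))%C by ring.
  rewrite Cmod_mult; apply Rmult_le_compat; auto using Cmod_ge_0. }
match goal with |- Cmod ?z <= _ => replace z with
  ((CInt (fun t => G t * g t)%C x y - G x * (P y - P x)) + - ((G y - G x) * P y))%C by ring end.
eapply Rle_trans; [apply Cmod_triangle|].
rewrite Cmod_opp, Cmod_mult.
assert (B2 : Cmod (G y - G x)%C * Cmod (P y) <= (V y - V x) * M).
{ apply Rmult_le_compat; auto using Cmod_ge_0; apply HG; lra. }
lra.
Qed.

(** A second mean value theorem for an amplitude [G] whose variation is dominated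
    by [V]: the local estimates add up, and the mesh may be sent to zero. *)
Lemma abel_bound (G g P : R -> C) (V : R -> R) (a b M N : R) :
  a <= b ->
  (forall x y, a <= x -> x <= y -> y <= b -> Cmod (G y - G x)%C <= V y - V x) ->
  (forall t, a <= t <= b -> is_Cder P t (g t)) ->
  (forall t, a <= t <= b -> Ccont g t) ->
  (forall t, a <= t <= b -> Ccont G t) ->
  (forall t, a <= t <= b -> Cmod (P t) <= M) ->
  (forall t, a <= t <= b -> Cmod (g t) <= N) ->
  Cmod (CInt (fun t => G t * g t)%C a b) <= M * (Cmod (G a) + Cmod (G b) + (V b - V a)).
Proof.
intros Hab HG HP Hg HGc HM HN.
assert (HVm : forall x y, a <= x -> x <= y -> y <= b -> V x <= V y).
{ intros x y H1 H2 H3; assert (A := HG x y H1 H2 H3).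
  assert (B := Cmod_ge_0 (G y - G x)%C); lra. }
assert (HM0 : 0 <= M) by (eapply Rle_trans; [apply Cmod_ge_0|apply (HM a); lra]).
assert (HN0 : 0 <= N) by (eapply Rle_trans; [apply Cmod_ge_0|apply (HN a); lra]).
assert (Hex : forall x y, a <= x -> x <= y -> y <= b -> ex_CInt (fun t => G t * g t)%C x y).
{ intros x y H1 H2 H3; apply ex_CInt_cont; rewrite Rmin_left, Rmax_right by lra.
  intros; apply Ccont_mult; [apply HGc|apply Hg]; lra. }
assert (L : forall x y h, a <= x -> x <= y -> y <= b -> y - x <= h ->
  Cmod (CInt (fun t => G t * g t)%C x y - (G y * P y - G x * P x))%C
    <= (M + N * h) * (V y - V x)).
{ intros x y h H1 H2 H3 Hh.
  apply Rle_trans with ((M + N * (y - x)) * (V y - V x)).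
  - apply abel_local; auto; intros; try (apply HP || apply Hg || apply HGc || apply HM || apply HN); try lra.
    apply Rle_trans with (V t - V x); [apply HG; lra|].
    assert (V t <= V y) by (apply HVm; lra). lra.
  - apply Rmult_le_compat_r; [assert (A := HVm x y H1 H2 H3); lra|].
    apply Rplus_le_compat_l, Rmult_le_compat_l; lra. }
assert (S : forall h, 0 < h -> forall n x y, a <= x -> x <= y -> y <= b -> y - x <= INR n * h ->
  Cmod (CInt (fun t => G t * g t)%C x y - (G y * P y - G x * P x))%C
    <= (M + N * h) * (V y - V x)).
{ intros h Hh n; induction n as [|n IH]; intros x y H1 H2 H3 H4.
  - simpl in H4; apply L; lra.
  - destruct (Rle_dec (y - x) h) as [E|E]; [now apply L|].
    rewrite S_INR in H4.
    destruct (ex_intro (fun z => z = x + h) _ eq_refl) as [z Hz].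
    assert (A1 : Cmod (CInt (fun t => G t * g t)%C x z - (G z * P z - G x * P x))%C
      <= (M + N * h) * (V z - V x)) by (apply L; lra).
    assert (A2 : Cmod (CInt (fun t => G t * g t)%C z y - (G y * P y - G z * P z))%C
      <= (M + N * h) * (V y - V z)) by (apply IH; lra).
    rewrite (CInt_Chasles _ x z y) by (apply Hex; lra).
    match goal with |- Cmod ?e <= _ => replace e with
      ((CInt (fun t => G t * g t) x z - (G z * P z - G x * P x)) +
       (CInt (fun t => G t * g t) z y - (G y * P y - G z * P z)))%C by ring end.
    eapply Rle_trans; [apply Cmod_triangle|]; lra. }
assert (T : Cmod (CInt (fun t => G t * g t)%C a b - (G b * P b - G a * P a))%C <= M * (V b - V a)).
{ assert (HV0 := HVm a b ltac:(lra) Hab ltac:(lra)).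
  apply Rnot_lt_le; intros Hlt.
  set (X := Cmod (CInt (fun t => G t * g t)%C a b - (G b * P b - G a * P a))%C) in *.
  assert (Hden : 0 < 1 + N * (V b - V a)) by (assert (0 <= N * (V b - V a)) by (apply Rmult_le_pos; lra); lra).
  set (h := (X - M * (V b - V a)) / (1 + N * (V b - V a))).
  assert (Hh : 0 < h) by (apply Rdiv_lt_0_compat; lra).
  destruct (nfloor_ex (Rmax 0 ((b - a) / h))) as [n [_ Hn]]; [apply Rmax_l|].
  assert (A : X <= (M + N * h) * (V b - V a)).
  { apply (S h Hh (n + 1)%nat); try lra.
    rewrite plus_INR; simpl.
    assert (E : (b - a) / h <= INR n + 1) by (assert (Q := Rmax_r 0 ((b - a) / h)); lra).
    replace (b - a) with ((b - a) / h * h) by (field; lra).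
    apply Rmult_le_compat_r; lra. }
  assert (E : h * (1 + N * (V b - V a)) = X - M * (V b - V a)) by (unfold h; field; lra).
  lra. }
replace (CInt (fun t => G t * g t)%C a b) with
  ((CInt (fun t => G t * g t)%C a b - (G b * P b - G a * P a)) + (G b * P b + - (G a * P a)))%C by ring.
eapply Rle_trans; [apply Cmod_triangle|].
assert (T2 := Cmod_triangle (G b * P b)%C (- (G a * P a))%C).
rewrite Cmod_opp, !Cmod_mult in T2.
assert (Q1 : Cmod (G b) * Cmod (P b) <= Cmod (G b) * M) by (apply Rmult_le_compat_l; [apply Cmod_ge_0|apply HM; lra]).
assert (Q2 : Cmod (G a) * Cmod (P a) <= Cmod (G a) * M) by (apply Rmult_le_compat_l; [apply Cmod_ge_0|apply HM; lra]).
lra.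
Qed.

(** * The Fresnel integral *)

Lemma Ccont_const (c : C) (x : R) : Ccont (fun _ => c) x.
Proof. apply continuous_const. Qed.

Lemma continuous_poly_sq (x : R) : continuous (fun t : R => t ^ 2) x.
Proof. apply (continuous_of_derivable _ x (2 * x)); auto_derive; trivial; ring. Qed.

Definition fresnel_density (t : R) : C := Cexp (- (Ci * RtoC (t ^ 2)))%C.
Definition fresnel (x : R) : C := CInt fresnel_density 0 x.
(** The value of [fresnel] at infinity, by [fresnel_asymptotic]. *)
Definition fresnel_limit : C := (RtoC (sqrt PI / 2) * Cexp (- Ci * RtoC (PI / 4)%R))%C.

Lemma fresnel_density_parts (t : R) : fresnel_density t = (cos (t ^ 2), - sin (t ^ 2)).
Proof.
unfold fresnel_density, Cexp; simpl.
match goal with |- (exp ?a * cos ?b, exp ?a * sin ?b) = _ =>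
  replace a with 0 by ring; replace b with (- (t * (t * 1))) by ring end.
rewrite exp_0, cos_neg, sin_neg; f_equal; ring.
Qed.

Lemma Cmod_Cexp_opp_i (t : R) : Cmod (Cexp (- (Ci * RtoC t))%C) = 1.
Proof.
rewrite Cmod_Cexp; simpl.
match goal with |- exp ?a = _ => replace a with 0 by ring end; apply exp_0.
Qed.

Lemma Cmod_fresnel_density (t : R) : Cmod (fresnel_density t) = 1.
Proof.
apply Cmod_Cexp_opp_i.
Qed.

Lemma Ccont_fresnel_density (t : R) : Ccont fresnel_density t.
Proof.
unfold fresnel_density; apply Ccont_Cexp, Ccont_opp, Ccont_mult; [apply Ccont_const|].
apply Ccont_RtoC, continuous_poly_sq.
Qed.

Lemma ex_CInt_fresnel (a b : R) : ex_CInt fresnel_density a b.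
Proof. apply ex_CInt_cont; intros; apply Ccont_fresnel_density. Qed.

Lemma is_Cder_fresnel (x : R) : is_Cder fresnel x (fresnel_density x).
Proof.
unfold fresnel.
apply (is_derive_RInt (V := C_R_NormedModule) fresnel_density _ 0).
- apply filter_forall; intros y; apply CInt_correct, ex_CInt_fresnel.
- apply Ccont_fresnel_density.
Qed.

Lemma fresnel_0 : fresnel 0 = RtoC 0.
Proof. unfold fresnel; apply (@RInt_point C_R_CompleteNormedModule). Qed.

Lemma fresnel_small (x : R) : 0 <= x -> Cmod (fresnel x) <= x.
Proof.
intros Hx; replace x with (1 * (x - 0)) at 2 by ring.
apply (is_CInt_norm_const fresnel_density 0 x); [lra| |].
- intros t _; rewrite Cmod_fresnel_density; lra.
- apply CInt_correct, ex_CInt_fresnel.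
Qed.

(** Beyond [1], writing the density as [(2 t exp (- i t^2)) / (2 t)] makes the
    bounded primitive of the first factor available to Abel summation. *)
Lemma fresnel_tail (x : R) : 1 <= x -> Cmod (fresnel x - fresnel 1)%C <= 1.
Proof.
intros Hx.
set (G := fun t : R => RtoC (/ (2 * t))).
set (g := fun t : R => (RtoC (2 * t) * fresnel_density t)%C).
set (P := fun t : R => (Ci * fresnel_density t)%C).
assert (A : Cmod (CInt (fun t => G t * g t)%C 1 x) <=
  1 * (Cmod (G 1) + Cmod (G x) + ((fun t => - / (2 * t)) x - (fun t => - / (2 * t)) 1))).
{ apply (abel_bound G g P (fun t => - / (2 * t)) 1 x 1 (2 * x) Hx).
  - intros s t H1 H2 H3; unfold G.
    rewrite <- RtoC_minus, Cmod_R, Rabs_left1; [lra|].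
    assert (/ (2 * t) <= / (2 * s)) by (apply Rinv_le_contravar; lra); lra.
  - intros t _; unfold P, g.
    replace (RtoC (2 * t) * fresnel_density t)%C with
      (RtoC 0 * fresnel_density t + Ci * (- (Ci * RtoC (2 * t)) * fresnel_density t))%C.
    2:{ replace (Ci * (- (Ci * RtoC (2 * t)) * fresnel_density t))%C
         with (- (Ci * Ci) * (RtoC (2 * t) * fresnel_density t))%C by ring.
        replace (Ci * Ci)%C with (- (1))%C by (apply injective_projections; simpl; ring).
        ring. }
    apply is_Cder_mult; [apply is_Cder_const|].
    apply is_Cder_Cexp.
    apply is_Cder_pair; simpl.
    + apply is_derive_ext with (fun _ => 0); [intros; simpl; ring|].
      replace (- (0 * (2 * t) - 1 * 0)) with 0 by ring; apply @is_derive_const.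
    + auto_derive; trivial; ring.
  - intros t _; apply Ccont_mult; [|apply Ccont_fresnel_density].
    apply Ccont_RtoC, (continuous_of_derivable _ t 2); auto_derive; trivial; ring.
  - intros t Ht; apply Ccont_RtoC, (continuous_of_derivable _ t (- / (2 * t ^ 2))).
    auto_derive; [lra|field; lra].
  - intros t _; unfold P; rewrite Cmod_mult, Cmod_Ci, Cmod_fresnel_density; lra.
  - intros t Ht; unfold g; rewrite Cmod_mult, Cmod_R, Cmod_fresnel_density, Rabs_pos_eq by lra; lra. }
unfold G in A at 2 3; rewrite !Cmod_R, !Rabs_pos_eq in A by (left; apply Rinv_0_lt_compat; lra).
unfold fresnel; rewrite (CInt_Chasles _ 0 1 x) by apply ex_CInt_fresnel.
replace (CInt fresnel_density 0 1 + CInt fresnel_density 1 x - CInt fresnel_density 0 1)%C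
  with (CInt fresnel_density 1 x : C) by (apply injective_projections; simpl; ring).
replace (CInt fresnel_density 1 x) with (CInt (fun t => G t * g t)%C 1 x); [lra|].
apply is_CInt_unique, (is_CInt_ext fresnel_density); [exact Hx| |apply CInt_correct, ex_CInt_fresnel].
intros t Ht; unfold G, g; rewrite Cmult_assoc, <- RtoC_mult.
replace (/ (2 * t) * (2 * t)) with 1 by (field; lra); ring.
Qed.

Lemma fresnel_bounded (x : R) : 0 <= x -> Cmod (fresnel x) <= 2.
Proof.
intros Hx; assert (A := fresnel_small 1 ltac:(lra)).
destruct (Rle_dec 1 x) as [H|H].
- assert (B := fresnel_tail x H).
  replace (fresnel x) with ((fresnel x - fresnel 1) + fresnel 1)%C by ring.
  eapply Rle_trans; [apply Cmod_triangle|]; lra.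
- assert (B := fresnel_small x Hx); lra.
Qed.

(** For [c = 0] and [c = - PI / 2] these are, up to sign, the real and imaginary
    parts of the classical parametric integral whose derivative cancels that of
    the square of [fresnel]. *)
Definition fresnel_partner (c x : R) : R :=
  RInt (fun t => cos (x ^ 2 * (1 + t ^ 2) + c) / (1 + t ^ 2)) 0 1.

Lemma one_plus_sq_pos (t : R) : 0 < 1 + t ^ 2.
Proof. nra. Qed.

Lemma continuous_fresnel_partner_integrand (c x t : R) :
  continuous (fun t => cos (x ^ 2 * (1 + t ^ 2) + c) / (1 + t ^ 2)) t.
Proof.
assert (H := one_plus_sq_pos t).
eapply continuous_of_derivable; auto_derive; [|reflexivity].
simpl in H; lra.
Qed.

Lemma fresnel_parts (x : R) :
  is_derive (fun t => Re (fresnel t)) x (cos (x ^ 2)) /\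
  is_derive (fun t => Im (fresnel t)) x (- sin (x ^ 2)).
Proof.
assert (H := is_Cder_fresnel x); rewrite fresnel_density_parts in H.
split; [apply (is_Cder_Re _ _ _ H)|apply (is_Cder_Im _ _ _ H)].
Qed.

Lemma is_derive_fresnel_partner (c x : R) :
  is_derive (fresnel_partner c) x
    (- 2 * (sin (x ^ 2 + c) * Re (fresnel x) - cos (x ^ 2 + c) * Im (fresnel x))).
Proof.
assert (D0 : forall y t, is_derive (fun u => cos (u ^ 2 * (1 + t ^ 2) + c) / (1 + t ^ 2)) y
   (- 2 * (y * sin (y ^ 2 * (1 + t ^ 2) + c)))).
{ intros y t; assert (H := one_plus_sq_pos t); auto_derive.
  - simpl in H; lra.
  - simpl; simpl in H; field; lra. }
evar_last.
{ apply (is_derive_RInt_param (fun u t => cos (u ^ 2 * (1 + t ^ 2) + c) / (1 + t ^ 2)) 0 1 x).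
  - apply filter_forall; intros y t _; eexists; apply D0.
  - intros t _.
    apply continuity_2d_pt_ext with (fun u v => - 2 * (u * sin (u ^ 2 * (1 + v ^ 2) + c))).
    { intros u v; symmetry; apply is_derive_unique, D0. }
    apply continuity_2d_pt_filterlim.
    apply (continuous_comp (U := prod_UniformSpace R_UniformSpace R_UniformSpace)
      (fun z => fst z * sin (fst z ^ 2 * (1 + snd z ^ 2) + c)) (fun r => -2 * r)).
    2:{ apply (continuous_of_derivable _ _ (-2)); auto_derive; trivial; ring. }
    apply (continuous_mult (K := R_AbsRing) (fun z : prod_UniformSpace R_UniformSpace R_UniformSpace => fst z)); [apply continuous_fst|].
    apply (continuous_comp (fun z : prod_UniformSpace R_UniformSpace R_UniformSpace => fst z ^ 2 * (1 + snd z ^ 2) + c) sin); [|apply continuous_sin].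
    apply (continuous_plus (V := R_NormedModule) (fun z : prod_UniformSpace R_UniformSpace R_UniformSpace => fst z ^ 2 * (1 + snd z ^ 2))); [|apply continuous_const].
    apply (continuous_mult (K := R_AbsRing) (fun z : prod_UniformSpace R_UniformSpace R_UniformSpace => fst z ^ 2)).
    + apply (continuous_comp (fun z : prod_UniformSpace R_UniformSpace R_UniformSpace => fst z) (fun r => r ^ 2)); [apply continuous_fst|apply continuous_poly_sq].
    + apply (continuous_comp (fun z : prod_UniformSpace R_UniformSpace R_UniformSpace => snd z) (fun r => 1 + r ^ 2)); [apply continuous_snd|].
      apply (continuous_of_derivable _ _ (2 * t)); auto_derive; trivial; simpl; ring.
  - apply filter_forall; intros y; apply (ex_RInt_continuous (V := R_CompleteNormedModule)); intros t _.
    apply continuous_fresnel_partner_integrand. }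
apply is_RInt_unique.
set (Q := fun t => - 2 * (sin (x ^ 2 + c) * Re (fresnel (x * t)) - cos (x ^ 2 + c) * Im (fresnel (x * t)))).
replace (- 2 * (sin (x ^ 2 + c) * Re (fresnel x) - cos (x ^ 2 + c) * Im (fresnel x)))
  with (minus (Q 1) (Q 0)).
2:{ unfold Q; rewrite Rmult_0_r, Rmult_1_r, fresnel_0; unfold minus, plus, opp, Re, Im; simpl; ring. }
apply (is_RInt_derive (V := R_CompleteNormedModule) Q).
- intros t _.
  replace (Derive _ x) with (- 2 * (x * sin (x ^ 2 * (1 + t ^ 2) + c))) by (symmetry; apply is_derive_unique, D0).
  destruct (fresnel_parts (x * t)) as [F1 F2].
  assert (Z : forall u v : R -> R, is_derive u (x * t) (cos ((x * t) ^ 2)) -> is_derive v (x * t) (- sin ((x * t) ^ 2)) ->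
     is_derive (fun t => - 2 * (sin (x ^ 2 + c) * u (x * t) - cos (x ^ 2 + c) * v (x * t))) t
      (- 2 * (x * sin (x ^ 2 * (1 + t ^ 2) + c)))).
  { intros u v Hu Hv; auto_derive.
    - repeat split; eapply ex_intro; eassumption.
    - change (fun x0 : R => u x0) with u; change (fun x0 : R => v x0) with v.
      rewrite (is_derive_unique _ _ _ Hu), (is_derive_unique _ _ _ Hv).
      replace (x ^ 2 * (1 + t ^ 2) + c) with ((x ^ 2 + c) + (x * t) ^ 2) by ring.
      rewrite (sin_plus (x ^ 2 + c)); replace (x * (x * 1) + c) with (x ^ 2 + c) by ring; ring. }
  exact (Z _ _ F1 F2).
- intros t _.
  apply continuous_ext with (fun t => - 2 * (x * sin (x ^ 2 * (1 + t ^ 2) + c))).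
  { intros s; symmetry; apply is_derive_unique, D0. }
  eapply continuous_of_derivable; auto_derive; trivial; reflexivity.
Qed.

Lemma fresnel_partner_0 (c : R) : fresnel_partner c 0 = cos c * (PI / 4).
Proof.
unfold fresnel_partner; apply is_RInt_unique.
replace (cos c * (PI / 4)) with (minus (cos c * atan 1) (cos c * atan 0)).
2:{ rewrite atan_1, atan_0; unfold minus, plus, opp; simpl; ring. }
apply (is_RInt_derive (V := R_CompleteNormedModule) (fun t => cos c * atan t)).
- intros t _; assert (H := one_plus_sq_pos t); auto_derive; trivial.
  replace (0 ^ 2 * (1 + t ^ 2) + c) with c by ring; unfold Rsqr; simpl in *; field; simpl in *; lra.
- intros t _; apply continuous_fresnel_partner_integrand.
Qed.

(** Both sides agree at [0], and the left-hand side has zero derivative. *)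
Lemma fresnel_square (c x : R) :
  fresnel_partner c x - 2 * cos c * (Re (fresnel x) * Im (fresnel x))
   + sin c * (Re (fresnel x) ^ 2 - Im (fresnel x) ^ 2) = cos c * (PI / 4).
Proof.
set (T := fun x => fresnel_partner c x - 2 * cos c * (Re (fresnel x) * Im (fresnel x))
   + sin c * (Re (fresnel x) ^ 2 - Im (fresnel x) ^ 2)).
assert (HT : forall y, is_derive T y 0).
{ intros y.
  assert (H1 := is_derive_fresnel_partner c y); destruct (fresnel_parts y) as [H2 H3].
  assert (Z : forall h u v : R -> R,
     is_derive h y (- 2 * (sin (y ^ 2 + c) * u y - cos (y ^ 2 + c) * v y)) ->
     is_derive u y (cos (y ^ 2)) -> is_derive v y (- sin (y ^ 2)) ->
     is_derive (fun x => h x - 2 * cos c * (u x * v x) + sin c * (u x ^ 2 - v x ^ 2)) y 0).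
  { intros h u v Hh Hu Hv; auto_derive.
    - repeat split; eapply ex_intro; eassumption.
    - change (fun x0 : R => u x0) with u; change (fun x0 : R => v x0) with v;
      change (fun x0 : R => h x0) with h.
      rewrite (is_derive_unique _ _ _ Hu), (is_derive_unique _ _ _ Hv), (is_derive_unique _ _ _ Hh).
      rewrite sin_plus, cos_plus; ring. }
  exact (Z _ _ _ H1 H2 H3). }
assert (E : T x = T 0).
{ destruct (MVT_gen T 0 x (fun _ => 0)) as [z [_ Hz]].
  - intros; apply HT.
  - intros y _; apply continuity_pt_filterlim; eapply continuous_of_derivable, HT.
  - lra. }
change (T x = cos c * (PI / 4)); rewrite E; unfold T.
rewrite fresnel_partner_0, fresnel_0; simpl; ring.
Qed.

(** The factor [exp (- i x^2 t^2)] has the primitive [fresnel (x t) / x], and the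
    other factor is monotone. *)
Lemma fresnel_partner_bound (c x : R) : 0 < x -> Rabs (fresnel_partner c x) <= 4 / x.
Proof.
intros Hx.
set (G := fun t : R => RtoC (/ (1 + t ^ 2))).
set (g := fun t : R => fresnel_density (x * t)).
set (P := fun t : R => (RtoC (/ x) * fresnel (x * t))%C).
assert (Gc : forall t, Ccont G t).
{ intros t; assert (H := one_plus_sq_pos t); apply Ccont_RtoC.
  eapply continuous_of_derivable; auto_derive; [simpl in H; lra|reflexivity]. }
assert (gc : forall t, Ccont g t).
{ intros t; apply (continuous_comp (V := R_UniformSpace) (fun t => x * t) fresnel_density); [|apply Ccont_fresnel_density].
  apply (continuous_of_derivable _ t x); auto_derive; trivial; ring. }
assert (A : Cmod (CInt (fun t => G t * g t)%C 0 1) <=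
  (2 / x) * (Cmod (G 0) + Cmod (G 1) + ((fun t => - / (1 + t ^ 2)) 1 - (fun t => - / (1 + t ^ 2)) 0))).
{ apply (abel_bound G g P (fun t => - / (1 + t ^ 2)) 0 1 (2 / x) 1); auto; try lra.
  - intros s t H1 H2 H3; unfold G.
    rewrite <- RtoC_minus, Cmod_R, Rabs_left1; [lra|].
    assert (/ (1 + t ^ 2) <= / (1 + s ^ 2)) by (apply Rinv_le_contravar; nra); lra.
  - intros t _; unfold P, g.
    replace (fresnel_density (x * t)) with
      (RtoC 0 * fresnel (x * t) + RtoC (/ x) * (scal x (fresnel_density (x * t))))%C.
    2:{ rewrite scal_R_Cmult, (Cmult_assoc (RtoC (/ x))), <- RtoC_mult, Rinv_l by lra; ring. }
    apply (is_Cder_mult (fun _ => RtoC (/ x)) (fun t => fresnel (x * t))); [apply is_Cder_const|].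
    apply (is_derive_comp (V := C_R_NormedModule) fresnel (fun t => x * t)); [apply is_Cder_fresnel|].
    auto_derive; trivial; ring.
  - intros t Ht; unfold P; rewrite Cmod_mult, Cmod_R, Rabs_pos_eq by (left; now apply Rinv_0_lt_compat).
    unfold Rdiv; rewrite Rmult_comm; apply Rmult_le_compat_r; [left; now apply Rinv_0_lt_compat|].
    apply fresnel_bounded; nra.
  - intros t _; unfold g; rewrite Cmod_fresnel_density; lra. }
unfold G in A at 2 3; rewrite !Cmod_R, !Rabs_pos_eq in A by (left; apply Rinv_0_lt_compat; lra).
assert (I : is_CInt (fun t => Cexp (- (Ci * RtoC (x ^ 2 + c))) * (G t * g t))%C 0 1
   (Cexp (- (Ci * RtoC (x ^ 2 + c))) * CInt (fun t => G t * g t) 0 1)%C).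
{ apply is_CInt_Cmult, CInt_correct, ex_CInt_cont; intros; apply Ccont_mult; auto. }
assert (J : fresnel_partner c x = Re (Cexp (- (Ci * RtoC (x ^ 2 + c))) * CInt (fun t => G t * g t) 0 1)%C).
{ apply is_RInt_unique.
  apply (is_RInt_fct_extend_fst (U := R_NormedModule) (V := R_NormedModule)) in I.
  revert I; apply is_RInt_ext; intros t _; unfold G, g; rewrite fresnel_density_parts.
  assert (H := one_plus_sq_pos t).
  unfold Cexp; simpl fst; simpl snd.
  match goal with |- context [exp ?a] => replace a with 0 by ring end.
  match goal with |- context [cos (- ?b)] => replace b with (x ^ 2 + c) by (simpl; ring) end.
  replace (x ^ 2 * (1 + t ^ 2) + c) with ((x ^ 2 + c) + (x * t) ^ 2) by ring.
  replace (x * t * (x * t * 1)) with ((x * t) ^ 2) by ring.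
  replace (t * (t * 1)) with (t ^ 2) by ring.
  rewrite exp_0, cos_neg, sin_neg, (cos_plus (x ^ 2 + c)).
  match goal with |- ?u = ?v => change (@eq R u v) end; field; lra. }
rewrite J; eapply Rle_trans; [apply re_le_Cmod|].
rewrite Cmod_mult, Cmod_Cexp_opp_i, Rmult_1_l; eapply Rle_trans; [exact A|].
right; field; lra.
Qed.

Lemma Cmod_le_parts (z : C) : Cmod z <= Rabs (Re z) + Rabs (Im z).
Proof.
replace z with (RtoC (Re z) + Ci * RtoC (Im z))%C at 1
  by (apply injective_projections; simpl; unfold Re, Im; ring).
eapply Rle_trans; [apply Cmod_triangle|].
rewrite Cmod_mult, Cmod_Ci, !Cmod_R; lra.
Qed.

Lemma fresnel_limit_parts :
  fresnel_limit = (sqrt (2 * PI) / 4, - (sqrt (2 * PI) / 4)).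
Proof.
unfold fresnel_limit, Cexp; simpl.
match goal with |- context [exp ?a] => replace a with 0 by ring end.
match goal with |- context [cos ?a] => replace a with (- (PI / 4)) by ring end.
rewrite exp_0, cos_neg, sin_neg, cos_PI4, sin_PI4.
rewrite sqrt_mult by (try lra; left; apply PI_RGT_0).
assert (H2 : sqrt 2 * sqrt 2 = 2) by (apply sqrt_sqrt; lra).
assert (H3 : 0 < sqrt 2) by (apply sqrt_lt_R0; lra).
assert (E : 1 / sqrt 2 = sqrt 2 / 2) by (field_simplify_eq; [simpl in *; lra|lra]).
rewrite E; apply injective_projections; simpl; field.
Qed.

Lemma fresnel_limit_Re_lower : 3 / 5 <= sqrt (2 * PI) / 4.
Proof.
assert (H : 12 / 5 <= sqrt (2 * PI)); [|lra].
assert (P2 := PI2_3_2).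
rewrite <- (sqrt_Rsqr (12 / 5)) by lra; apply sqrt_le_1_alt; unfold Rsqr; lra.
Qed.

Lemma fresnel_1_Re_lower : 1 / 2 <= Re (fresnel 1).
Proof.
assert (P2 := PI2_3_2).
assert (I : is_RInt (fun t => Re (fresnel_density t)) 0 1 (Re (fresnel 1))).
{ apply (is_RInt_fct_extend_fst (U := R_NormedModule) (V := R_NormedModule) fresnel_density 0 1 (fresnel 1)).
  apply CInt_correct, ex_CInt_fresnel. }
apply (is_RInt_le (fun _ => 1 / 2) (fun t => Re (fresnel_density t)) 0 1); [lra| |exact I|].
- evar_last; [apply (is_RInt_const (V := R_NormedModule))|]; unfold scal; simpl; unfold mult; simpl; lra.
- intros t Ht; rewrite fresnel_density_parts; simpl Re.
  rewrite <- cos_PI3; apply cos_decr_1; nra.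
Qed.

(** The square of the Fresnel integral tends to [- i PI / 4].  That the limit is
    the root in the right half plane follows from the lower bound on the real part
    at [1], since the tail beyond [1] is too small to lead to the other root. *)
Lemma fresnel_asymptotic (x : R) : 0 < x ->
  Cmod (fresnel x - fresnel_limit)%C <= 80 / x.
Proof.
intros Hx.
assert (Q := fresnel_limit_Re_lower).
destruct (Rle_dec 1 x) as [H1|H1].
- assert (S1 := fresnel_square 0 x); assert (S2 := fresnel_square (- (PI / 2)) x).
  rewrite cos_0, sin_0 in S1; rewrite cos_neg, sin_neg, cos_PI2, sin_PI2 in S2.
  assert (B1 := fresnel_partner_bound 0 x Hx); assert (B2 := fresnel_partner_bound (- (PI / 2)) x Hx).
  assert (K : Cmod ((fresnel x - fresnel_limit) * (fresnel x + fresnel_limit))%C <= 8 / x).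
  { eapply Rle_trans; [apply Cmod_le_parts|].
    assert (HS : sqrt (2 * PI) / 4 * (sqrt (2 * PI) / 4) = PI / 8).
    { assert (P0 := PI_RGT_0).
      replace (_ * _) with (sqrt (2 * PI) * sqrt (2 * PI) / 16) by field.
      rewrite sqrt_sqrt by lra; field. }
    rewrite fresnel_limit_parts; destruct (fresnel x) as [u v]; simpl in *.
    set (w := sqrt (2 * PI) / 4) in *.
    match goal with |- Rabs ?a + Rabs ?b <= _ =>
      replace a with (fresnel_partner (- (PI / 2)) x) by nra;
      replace b with (fresnel_partner 0 x) by nra end.
    replace (8 / x) with (4 / x + 4 / x) by (field; lra); lra. }
  assert (T := fresnel_tail x H1); assert (F1 := fresnel_1_Re_lower).
  assert (L : 1 / 10 <= Cmod (fresnel x + fresnel_limit)%C).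
  { eapply Rle_trans; [|apply re_le_Cmod]; eapply Rle_trans; [|apply Rle_abs].
    assert (T2 := re_le_Cmod (fresnel x - fresnel 1)%C).
    assert (T3 := Rabs_maj2 (Re (fresnel x - fresnel 1)%C)).
    rewrite fresnel_limit_parts; clear - Q T T2 T3 F1.
    destruct (fresnel x) as [u v], (fresnel 1) as [u' v']; unfold Re in *; simpl in *; lra. }
  rewrite Cmod_mult in K.
  assert (N := Cmod_ge_0 (fresnel x - fresnel_limit)%C).
  replace (80 / x) with (10 * (8 / x)) by (field; lra); nra.
- assert (A := fresnel_small x ltac:(lra)).
  assert (B : Cmod fresnel_limit <= 1).
  { unfold fresnel_limit.
    replace (- Ci * RtoC (PI / 4)%R)%C with (- (Ci * RtoC (PI / 4)%R))%C by ring.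
    rewrite Cmod_mult, Cmod_R, Cmod_Cexp_opp_i, Rabs_pos_eq by (assert (Z := sqrt_pos PI); lra).
    assert (Z : sqrt PI <= 2); [|lra].
    rewrite <- (sqrt_Rsqr 2) by lra; apply sqrt_le_1_alt; unfold Rsqr; assert (W := PI_4); lra. }
  apply Rle_trans with 2.
  + eapply Rle_trans; [apply Cmod_triangle|]; rewrite Cmod_opp; lra.
  + apply Rmult_le_reg_r with x; [lra|]; unfold Rdiv; rewrite Rmult_assoc, Rinv_l; lra.
Qed.

(** * Functions dominated by a monotone Hoelder function *)

(** [F] is Lipschitz for the distance [|W x - W y|] of some nondecreasing
    1/2-Hoelder function [W].  This controls at once the variation of [F] over
    an interval and its modulus of continuity, and is stable under products,
    inverses and monotone changes of variable, although it allows square root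
    branch points. *)
Definition tame (a b : R) (F : R -> C) : Prop :=
  exists (W : R -> R) (K : R), 0 <= K /\
  forall x y, a <= x -> x <= y -> y <= b ->
    Cmod (F y - F x)%C <= W y - W x /\ W y - W x <= K * sqrt (y - x).

Lemma sqrt_sub_le (x y : R) : 0 <= x -> x <= y -> sqrt y - sqrt x <= sqrt (y - x).
Proof.
intros Hx Hxy.
assert (A := sqrt_pos x); assert (B := sqrt_pos (y - x)).
assert (C1 := sqrt_sqrt x Hx); assert (D := sqrt_sqrt (y - x) ltac:(lra)).
assert (E : sqrt y <= sqrt x + sqrt (y - x)); [|lra].
rewrite <- (sqrt_Rsqr (sqrt x + sqrt (y - x))) by lra.
apply sqrt_le_1_alt; unfold Rsqr; nra.
Qed.

Lemma tame_ext (a b : R) (F G : R -> C) :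
  (forall x, a <= x <= b -> F x = G x) -> tame a b F -> tame a b G.
Proof.
intros E (W & K & HK & H); exists W, K; split; [exact HK|].
intros x y H1 H2 H3; rewrite <- !E by lra; auto.
Qed.

Lemma tame_lipschitz (a b L : R) (F : R -> C) : 0 <= L ->
  (forall x y, a <= x -> x <= y -> y <= b -> Cmod (F y - F x)%C <= L * (y - x)) ->
  tame a b F.
Proof.
intros HL H; exists (fun x => L * x), (L * sqrt (b - a)); split.
{ apply Rmult_le_pos; [lra|apply sqrt_pos]. }
intros x y H1 H2 H3; split; [rewrite <- Rmult_minus_distr_l; auto|].
rewrite <- Rmult_minus_distr_l, Rmult_assoc; apply Rmult_le_compat_l; [lra|].
rewrite <- (sqrt_sqrt (y - x)) at 1 by lra.
apply Rmult_le_compat_r; [apply sqrt_pos|apply sqrt_le_1_alt; lra].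
Qed.

Lemma tame_const (a b : R) (c : C) : tame a b (fun _ => c).
Proof.
apply (tame_lipschitz a b 0); [lra|]; intros.
replace (c - c)%C with (RtoC 0) by ring; rewrite Cmod_0; lra.
Qed.

Lemma tame_plus (a b : R) (F G : R -> C) :
  tame a b F -> tame a b G -> tame a b (fun x => F x + G x)%C.
Proof.
intros (W & K & HK & H) (W' & K' & HK' & H').
exists (fun x => W x + W' x), (K + K'); split; [lra|].
intros x y H1 H2 H3; destruct (H x y H1 H2 H3) as [A1 A2]; destruct (H' x y H1 H2 H3) as [B1 B2].
split; [|lra].
replace (F y + G y - (F x + G x))%C with ((F y - F x) + (G y - G x))%C by ring.
eapply Rle_trans; [apply Cmod_triangle|lra].
Qed.

Lemma tame_bounded (a b : R) (F : R -> C) : tame a b F ->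
  exists B, 0 <= B /\ forall x, a <= x <= b -> Cmod (F x) <= B.
Proof.
intros (W & K & HK & H); exists (Cmod (F a) + K * sqrt (b - a)); split.
{ assert (A := Cmod_ge_0 (F a)); assert (B := Rmult_le_pos _ _ HK (sqrt_pos (b - a))); lra. }
intros x Hx; destruct (H a x ltac:(lra) ltac:(lra) ltac:(lra)) as [A1 A2].
replace (F x) with (F a + (F x - F a))%C by ring.
eapply Rle_trans; [apply Cmod_triangle|].
assert (A3 : K * sqrt (x - a) <= K * sqrt (b - a)) by (apply Rmult_le_compat_l; [lra|apply sqrt_le_1_alt; lra]).
lra.
Qed.

Lemma tame_mult (a b : R) (F G : R -> C) :
  tame a b F -> tame a b G -> tame a b (fun x => F x * G x)%C.
Proof.
intros HF HG; destruct (tame_bounded _ _ _ HF) as (B & HB & BF).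
destruct (tame_bounded _ _ _ HG) as (B' & HB' & BG).
destruct HF as (W & K & HK & H); destruct HG as (W' & K' & HK' & H').
exists (fun x => B' * W x + B * W' x), (B' * K + B * K'); split; [nra|].
intros x y H1 H2 H3; destruct (H x y H1 H2 H3) as [A1 A2]; destruct (H' x y H1 H2 H3) as [B1 B2].
split; [|nra].
replace (F y * G y - F x * G x)%C with ((F y - F x) * G x + F y * (G y - G x))%C by ring.
eapply Rle_trans; [apply Cmod_triangle|]; rewrite !Cmod_mult.
assert (C1 : Cmod (F y - F x)%C * Cmod (G x) <= (W y - W x) * B')
  by (apply Rmult_le_compat; auto using Cmod_ge_0; apply BG; lra).
assert (C2 : Cmod (F y) * Cmod (G y - G x)%C <= B * (W' y - W' x))
  by (apply Rmult_le_compat; auto using Cmod_ge_0; apply BF; lra).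
lra.
Qed.

Lemma tame_opp (a b : R) (F : R -> C) : tame a b F -> tame a b (fun x => - F x)%C.
Proof.
intros H; apply tame_ext with (fun x => (- (1)) * F x)%C; [intros; ring|].
apply tame_mult; [apply tame_const|exact H].
Qed.

Lemma tame_inv (a b c : R) (F : R -> C) : 0 < c ->
  (forall x, a <= x <= b -> c <= Cmod (F x)) -> tame a b F -> tame a b (fun x => / F x)%C.
Proof.
intros Hc HF (W & K & HK & H).
assert (Hc2 : 0 < / (c * c)) by (apply Rinv_0_lt_compat; nra).
exists (fun x => / (c * c) * W x), (/ (c * c) * K); split; [nra|].
intros x y H1 H2 H3; destruct (H x y H1 H2 H3) as [A1 A2].
split; [|nra].
assert (Lx := HF x ltac:(lra)); assert (Ly := HF y ltac:(lra)).
assert (Nx : F x <> RtoC 0) by (apply Cmod_gt_0; lra).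
assert (Ny : F y <> RtoC 0) by (apply Cmod_gt_0; lra).
replace (/ F y - / F x)%C with (/ (F x * F y) * - (F y - F x))%C by (field; split; assumption).
rewrite Cmod_mult, Cmod_opp, Cmod_inv by (now apply Cmult_neq_0).
rewrite Cmod_mult, <- Rmult_minus_distr_l.
apply Rmult_le_compat; auto using Cmod_ge_0.
- left; apply Rinv_0_lt_compat; nra.
- apply Rinv_le_contravar; nra.
Qed.

Lemma tame_Cexp (a b : R) (F : R -> C) : tame a b F -> tame a b (fun x => Cexp (F x)).
Proof.
intros HF; destruct (tame_bounded _ _ _ HF) as (B & HB & BF).
destruct HF as (W & K & HK & H).
assert (P := exp_pos B).
exists (fun x => exp B * W x), (exp B * K); split; [nra|].
intros x y H1 H2 H3; destruct (H x y H1 H2 H3) as [A1 A2]; split; [|nra].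
assert (R1 : forall z, a <= z <= b -> Re (F z) <= B).
{ intros z Hz; eapply Rle_trans; [apply Rle_abs|].
  eapply Rle_trans; [apply re_le_Cmod|auto]. }
eapply Rle_trans; [apply (Cexp_lipschitz _ _ B); apply R1; lra|].
rewrite <- Rmult_minus_distr_l; apply Rmult_le_compat_l; lra.
Qed.

Lemma tame_comp_incr (a b c d L : R) (F : R -> C) (u : R -> R) : 0 <= L ->
  (forall x, a <= x <= b -> c <= u x <= d) ->
  (forall x y, a <= x -> x <= y -> y <= b -> 0 <= u y - u x <= L * (y - x)) ->
  tame c d F -> tame a b (fun x => F (u x)).
Proof.
intros HL Hu Hm (W & K & HK & H).
exists (fun x => W (u x)), (K * sqrt L); split; [apply Rmult_le_pos; [lra|apply sqrt_pos]|].
intros x y H1 H2 H3; assert (M := Hm x y H1 H2 H3).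
assert (Ux := Hu x ltac:(lra)); assert (Uy := Hu y ltac:(lra)).
destruct (H (u x) (u y) ltac:(lra) ltac:(lra) ltac:(lra)) as [A1 A2]; split; [exact A1|].
eapply Rle_trans; [exact A2|]; rewrite Rmult_assoc; apply Rmult_le_compat_l; [lra|].
rewrite <- sqrt_mult_alt by lra; apply sqrt_le_1_alt; lra.
Qed.

Lemma tame_comp_decr (a b c d L : R) (F : R -> C) (u : R -> R) : 0 <= L ->
  (forall x, a <= x <= b -> c <= u x <= d) ->
  (forall x y, a <= x -> x <= y -> y <= b -> 0 <= u x - u y <= L * (y - x)) ->
  tame c d F -> tame a b (fun x => F (u x)).
Proof.
intros HL Hu Hm (W & K & HK & H).
exists (fun x => - W (u x)), (K * sqrt L); split; [apply Rmult_le_pos; [lra|apply sqrt_pos]|].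
intros x y H1 H2 H3; assert (M := Hm x y H1 H2 H3).
assert (Ux := Hu x ltac:(lra)); assert (Uy := Hu y ltac:(lra)).
destruct (H (u y) (u x) ltac:(lra) ltac:(lra) ltac:(lra)) as [A1 A2]; split.
- replace (F (u y) - F (u x))%C with (- (F (u x) - F (u y)))%C by ring.
  rewrite Cmod_opp; lra.
- replace (- W (u y) - - W (u x)) with (W (u x) - W (u y)) by ring.
  eapply Rle_trans; [exact A2|]; rewrite Rmult_assoc; apply Rmult_le_compat_l; [lra|].
  rewrite <- sqrt_mult_alt by lra; apply sqrt_le_1_alt; lra.
Qed.

(** The dominating functions are concatenated by freezing each of them outside
    its own interval. *)
Lemma tame_glue (a b c : R) (F : R -> C) : tame a b F -> tame b c F -> tame a c F.
Proof.
intros (W & K & HK & H) (W' & K' & HK' & H').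
exists (fun x => W (Rmin x b) + W' (Rmax x b)), (K + K'); split; [lra|].
intros x y H1 H2 H3.
assert (S0 := sqrt_pos (y - x)).
destruct (Rle_dec y b) as [Y|Y].
- rewrite !Rmin_left, !Rmax_right by lra.
  destruct (H x y H1 H2 Y); split; [lra|nra].
- destruct (Rle_dec b x) as [X|X].
  + rewrite !Rmin_right, !Rmax_left by lra.
    destruct (H' x y X H2 H3); split; [lra|nra].
  + rewrite (Rmin_right y), (Rmin_left x), (Rmax_left y), (Rmax_right x) by lra.
    destruct (H x b H1 ltac:(lra) ltac:(lra)) as [A1 A2].
    destruct (H' b y ltac:(lra) ltac:(lra) H3) as [B1 B2]; split.
    * eapply Rle_trans; [apply (Cmod_sub_triangle _ (F b))|lra].
    * assert (S1 : sqrt (b - x) <= sqrt (y - x)) by (apply sqrt_le_1_alt; lra).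
      assert (S2 : sqrt (y - b) <= sqrt (y - x)) by (apply sqrt_le_1_alt; lra).
      nra.
Qed.

Lemma RtoC_neq_0 (x : R) : x <> 0 -> RtoC x <> RtoC 0.
Proof. intros H E; apply H; now injection E. Qed.

(** The increments of [H / q] are controlled by those of [W / q - 4 K / sqrt q]:
    the correction pays for the growth of [1 / q]. *)
Lemma quotient_variation (Hx Hy : C) (wx wy qx qy K : R) :
  0 < qx -> qx <= qy -> 0 <= wx -> Cmod (Hy - Hx)%C <= wy - wx -> Cmod Hx <= wx ->
  wx <= K * sqrt qx ->
  Cmod (Hy / RtoC qy - Hx / RtoC qx)%C <=
    (wy / qy - 4 * K / sqrt qy) - (wx / qx - 4 * K / sqrt qx).
Proof.
intros Hq Hqq Hw H1 H2 H3.
assert (Q1 : RtoC qx <> RtoC 0) by (apply RtoC_neq_0; lra).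
assert (Q2 : RtoC qy <> RtoC 0) by (apply RtoC_neq_0; lra).
replace (Hy / RtoC qy - Hx / RtoC qx)%C with
  ((Hy - Hx) * RtoC (/ qy) + Hx * RtoC (/ qy - / qx))%C.
2:{ rewrite RtoC_minus, !RtoC_inv by lra; field; split; assumption. }
assert (I : / qy <= / qx) by (apply Rinv_le_contravar; lra).
assert (I0 : 0 < / qy) by (apply Rinv_0_lt_compat; lra).
eapply Rle_trans; [apply Cmod_triangle|]; rewrite !Cmod_mult, !Cmod_R.
rewrite (Rabs_pos_eq (/ qy)), Rabs_left1 by lra.
assert (A1 : Cmod (Hy - Hx)%C * / qy <= (wy - wx) * / qy) by (apply Rmult_le_compat_r; lra).
assert (A2 : Cmod Hx * - (/ qy - / qx) <= wx * (/ qx - / qy)) by (rewrite Ropp_minus_distr; apply Rmult_le_compat_r; lra).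
enough (E : 2 * wx * (/ qx - / qy) <= 4 * K * (/ sqrt qx - / sqrt qy)).
{ unfold Rdiv; lra. }
assert (Px := sqrt_lt_R0 _ Hq); assert (Py : sqrt qx <= sqrt qy) by (apply sqrt_le_1_alt; lra).
assert (E1 := sqrt_sqrt qx ltac:(lra)); assert (E2 := sqrt_sqrt qy ltac:(lra)).
set (p := sqrt qx) in *; set (s := sqrt qy) in *.
rewrite <- E1, <- E2, !Rinv_mult.
assert (Ps : 0 < / s) by (apply Rinv_0_lt_compat; lra).
assert (Pp : 0 < / p) by (apply Rinv_0_lt_compat; lra).
assert (Psp : / s <= / p) by (apply Rinv_le_contravar; lra).
assert (K0 : 0 <= K) by nra.
apply Rle_trans with (2 * (K * p) * (/ p * / p - / s * / s)).
- apply Rmult_le_compat_r; [nra|lra].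
- assert (PP : p * / p = 1) by (apply Rinv_r; lra).
  replace (2 * (K * p) * (/ p * / p - / s * / s)) with
    (2 * K * ((/ p - / s) * ((p * / p) + (p * / s)))) by ring.
  rewrite PP; replace (4 * K * (/ p - / s)) with (2 * K * ((/ p - / s) * 2)) by ring.
  apply Rmult_le_compat_l; [lra|]; apply Rmult_le_compat_l; [lra|].
  assert (p * / s <= p * / p) by (apply Rmult_le_compat_l; lra). lra.
Qed.

(** * One-sided stationary phase *)

(** Below, the large parameter of the phase is written [t ^ 4]: the exponents
    1/4, 1/2 and 3/4 of the estimates then become integer powers of [t]. *)
Notation circle_phase lam s := (Cexp (Ci * RtoC (lam * cos s))%C).

Lemma Ccont_circle_phase (lam s : R) : Ccont (fun s => circle_phase lam s) s.
Proof.
apply Ccont_Cexp, Ccont_mult; [apply Ccont_const|].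
apply Ccont_RtoC; eapply continuous_of_derivable; auto_derive; trivial; reflexivity.
Qed.

Lemma Ccont_RtoC_cos_half (s : R) : Ccont (fun s => RtoC (cos (s / 2))) s.
Proof. apply Ccont_RtoC; eapply continuous_of_derivable; auto_derive; trivial; reflexivity. Qed.

Lemma cos_half_pos (b s : R) : 0 < b < PI -> 0 <= s <= b -> 0 < cos (b / 2) <= cos (s / 2).
Proof.
intros Hb Hs; split; [apply cos_gt_0; lra|].
apply cos_decr_1; lra.
Qed.

(** The amplitude [cos (s / 2)] is the one for which [2 sin (s / 2)] turns the
    phase into an exact square. *)
Lemma circle_fresnel (b t : R) : 0 < b < PI -> 0 < t ->
  is_CInt (fun s => RtoC (cos (s / 2)) * circle_phase (t ^ 4) s)%C 0 b
   (Cexp (Ci * RtoC (t ^ 4)) * RtoC (sqrt 2 / t ^ 2) * fresnel (sqrt 2 * t ^ 2 * sin (b / 2)))%C.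
Proof.
intros Hb Ht.
assert (H2 : sqrt 2 * sqrt 2 = 2) by (apply sqrt_sqrt; lra).
set (Phi := fun s => (Cexp (Ci * RtoC (t ^ 4)) * RtoC (sqrt 2 / t ^ 2) * fresnel (sqrt 2 * t ^ 2 * sin (s / 2)))%C).
assert (E : (Cexp (Ci * RtoC (t ^ 4)) * RtoC (sqrt 2 / t ^ 2) * fresnel (sqrt 2 * t ^ 2 * sin (b / 2)))%C = (Phi b - Phi 0)%C).
{ unfold Phi; replace (0 / 2) with 0 by field; rewrite sin_0, Rmult_0_r, fresnel_0; ring. }
rewrite E; apply is_CInt_der; [lra| |].
2:{ intros; apply Ccont_mult; [apply Ccont_RtoC_cos_half|apply Ccont_circle_phase]. }
intros s _; unfold Phi.
evar_last.
{ apply is_Cder_mult; [apply is_Cder_const|].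
  apply (is_derive_comp (V := C_R_NormedModule) fresnel (fun s => sqrt 2 * t ^ 2 * sin (s / 2))); [apply is_Cder_fresnel|].
  auto_derive; [trivial|reflexivity]. }
rewrite scal_R_Cmult; unfold fresnel_density.
set (v := sqrt 2 * t ^ 2 * sin (s / 2)).
replace (t ^ 4 * cos s) with (t ^ 4 - v ^ 2).
2:{ assert (Cs : cos s = 1 - 2 * sin (s / 2) * sin (s / 2)) by (rewrite <- cos_2a_sin; f_equal; field).
    rewrite Cs; unfold v.
    transitivity (t ^ 4 - (sqrt 2 * sqrt 2) * t ^ 4 * sin (s / 2) ^ 2); [ring|rewrite H2; ring]. }
rewrite RtoC_minus.
replace (Ci * (RtoC (t ^ 4) - RtoC (v ^ 2)))%C with (Ci * RtoC (t ^ 4) + - (Ci * RtoC (v ^ 2)))%C by ring.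
rewrite Cexp_plus.
match goal with |- (RtoC 0 * ?f + ?A * RtoC ?r * (RtoC ?w * ?B))%C = (?c * (?A * ?B))%C =>
  replace c with (RtoC (r * w)); [rewrite (RtoC_mult r w); ring|f_equal] end.
transitivity ((sqrt 2 * sqrt 2) / 2 * cos (s / 2)); [unfold Rdiv; field; lra|rewrite H2; field].
Qed.

Lemma two_sin_half_bounds (b x y : R) : 0 < b < PI -> 0 <= x -> x <= y -> y <= b ->
  cos (b / 2) * (y - x) <= 2 * sin (y / 2) - 2 * sin (x / 2).
Proof.
intros Hb Hx Hxy Hy.
destruct (MVT_gen (fun s => 2 * sin (s / 2)) x y (fun s => cos (s / 2))) as [z [Hz E]].
- intros z _; auto_derive; trivial; unfold Rdiv; field.
- intros z _; eapply continuity_pt_of_derivable; auto_derive; trivial; reflexivity.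
- rewrite Rmin_left, Rmax_right in Hz by lra; rewrite E.
  apply Rmult_le_compat_r; [lra|]; apply (cos_half_pos b); lra.
Qed.

(** Close to the stationary point the amplitude is small by its 1/2-Hoelder bound;
    farther away the phase moves and Abel summation applies.  The two errors
    balance at distance [b / t^2]. *)
Lemma stationary_vanishing (b : R) (H : R -> C) : 0 < b < PI -> tame 0 b H ->
  (forall s, 0 <= s <= b -> Ccont H s) -> H 0 = RtoC 0 ->
  exists M, forall t, 1 <= t ->
    Cmod (CInt (fun s => H s * (RtoC (cos (s / 2)) * circle_phase (t ^ 4) s))%C 0 b) <= M / t ^ 3.
Proof.
intros Hb (W & K & HK & HW) Hc H0.
set (m := cos (b / 2)).
assert (Hm : 0 < m) by (apply (cos_half_pos b b); lra).
assert (Hm1 : m <= 1) by apply COS_bound.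
set (K' := K / sqrt m).
assert (Sm := sqrt_lt_R0 _ Hm).
assert (HK' : 0 <= K') by (apply Rdiv_le_0_compat; lra).
set (w := fun s => W s - W 0).
assert (Hw : forall s, 0 <= s <= b -> Cmod (H s) <= w s /\ w s <= K * sqrt s).
{ intros s Hs; destruct (HW 0 s) as [A1 A2]; try lra.
  rewrite H0 in A1; replace (H s - RtoC 0)%C with (H s) in A1 by ring.
  replace (s - 0) with s in A2 by ring; split; assumption. }
assert (Hw0 : forall s, 0 <= s <= b -> 0 <= w s).
{ intros s Hs; eapply Rle_trans; [apply Cmod_ge_0|apply Hw, Hs]. }
set (q := fun s => 2 * sin (s / 2)).
assert (q0 : q 0 = 0) by (unfold q; replace (0 / 2) with 0 by field; rewrite sin_0; ring).
assert (Hq : forall x y, 0 <= x -> x <= y -> y <= b -> m * (y - x) <= q y - q x)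
  by (intros; now apply two_sin_half_bounds).
assert (Hqm : forall x, 0 <= x <= b -> m * x <= q x).
{ intros x Hx; assert (A := Hq 0 x); rewrite q0 in A; lra. }
assert (HwK' : forall s, 0 <= s <= b -> w s <= K' * sqrt (q s)).
{ intros s Hs; eapply Rle_trans; [apply Hw, Hs|].
  replace (K' * sqrt (q s)) with (K * (sqrt (q s) / sqrt m)) by (unfold K'; field; lra).
  apply Rmult_le_compat_l; [lra|].
  apply Rmult_le_reg_r with (sqrt m); [lra|].
  replace (sqrt (q s) / sqrt m * sqrt m) with (sqrt (q s)) by (field; lra).
  rewrite <- sqrt_mult_alt by lra; apply sqrt_le_1_alt; rewrite Rmult_comm; now apply Hqm. }
assert (Sb := sqrt_lt_R0 b ltac:(lra)).
(* 7 = 2 for the two end values of the quotient [H / q], 1 for [W / q] and 4 for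
   the correction term in [quotient_variation] *)
exists (K * sqrt b * b + 7 * K' / (sqrt m * sqrt b)); intros t Ht.
assert (Pt1 : 1 <= t ^ 2) by nra.
set (e := b / t ^ 2).
assert (He : 0 < e <= b).
{ unfold e; split; [apply Rdiv_lt_0_compat; lra|].
  apply Rmult_le_reg_r with (t ^ 2); [lra|]; unfold Rdiv; rewrite Rmult_assoc, Rinv_l by lra; nra. }
assert (Se : sqrt e = sqrt b / t).
{ unfold e; rewrite sqrt_div_alt by lra; rewrite sqrt_pow2; lra. }
assert (Gcont : forall s, 0 <= s <= b ->
  Ccont (fun s => H s * (RtoC (cos (s / 2)) * circle_phase (t ^ 4) s))%C s).
{ intros s Hs; apply Ccont_mult; [now apply Hc|].
  apply Ccont_mult; [apply Ccont_RtoC_cos_half|apply Ccont_circle_phase]. }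
assert (Hex : forall x y, 0 <= x -> x <= y -> y <= b ->
  ex_CInt (fun s => H s * (RtoC (cos (s / 2)) * circle_phase (t ^ 4) s))%C x y).
{ intros x y A1 A2 A3; apply ex_CInt_cont; rewrite Rmin_left, Rmax_right by lra.
  intros; apply Gcont; lra. }
rewrite (CInt_Chasles _ 0 e b) by (apply Hex; lra).
eapply Rle_trans; [apply Cmod_triangle|].
assert (N : Cmod (CInt (fun s => H s * (RtoC (cos (s / 2)) * circle_phase (t ^ 4) s))%C 0 e) <= (K * sqrt e) * (e - 0)).
{ apply (is_CInt_norm_const (fun s => H s * (RtoC (cos (s / 2)) * circle_phase (t ^ 4) s))%C 0 e); [lra| |apply CInt_correct, Hex; lra].
  intros s Hs; rewrite !Cmod_mult, Cmod_Cexp_i, Cmod_R, Rmult_1_r.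
  replace (K * sqrt e) with (K * sqrt e * 1) by ring.
  apply Rmult_le_compat; [apply Cmod_ge_0|apply Rabs_pos| |apply Rabs_le, COS_bound].
  eapply Rle_trans; [apply (Hw s); lra|].
  eapply Rle_trans; [apply (Hw s); lra|].
  apply Rmult_le_compat_l; [lra|apply sqrt_le_1_alt; lra]. }
set (G := fun s => (H s / RtoC (q s))%C).
set (g := fun s => (RtoC (sin s) * circle_phase (t ^ 4) s)%C).
set (P := fun s => (RtoC (/ t ^ 4) * (Ci * circle_phase (t ^ 4) s))%C).
assert (Pt4 : 0 < t ^ 4) by (apply pow_lt; lra).
assert (qpos : forall s, e <= s <= b -> 0 < q s).
{ intros s Hs; assert (A := Hqm s ltac:(lra)); assert (0 < m * s) by (apply Rmult_lt_0_compat; lra); lra. }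
assert (GB : forall s, e <= s <= b -> Cmod (G s) <= K' / sqrt (q s)).
{ intros s Hs; assert (A := qpos s Hs); assert (A1 := sqrt_lt_R0 _ A).
  unfold G, Cdiv; rewrite Cmod_mult, Cmod_inv, Cmod_R, Rabs_pos_eq by (try apply RtoC_neq_0; lra).
  replace (K' / sqrt (q s)) with ((K' * sqrt (q s)) * / q s).
  2:{ rewrite <- (sqrt_sqrt (q s)) at 2 by lra; field; lra. }
  apply Rmult_le_compat_r; [left; now apply Rinv_0_lt_compat|].
  eapply Rle_trans; [apply Hw|apply HwK']; lra. }
assert (A : Cmod (CInt (fun s => G s * g s)%C e b) <=
  / t ^ 4 * (Cmod (G e) + Cmod (G b) + ((w b / q b - 4 * K' / sqrt (q b)) - (w e / q e - 4 * K' / sqrt (q e))))).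
{ apply (abel_bound G g P (fun s => w s / q s - 4 * K' / sqrt (q s)) e b _ 1); try lra.
  - intros x y A1 A2 A3; apply quotient_variation.
    + apply qpos; lra.
    + assert (Z := Hq x y ltac:(lra) A2 A3).
      assert (0 <= m * (y - x)) by (apply Rmult_le_pos; lra); lra.
    + apply Hw0; lra.
    + unfold w; destruct (HW x y ltac:(lra) A2 A3); lra.
    + apply Hw; lra.
    + apply HwK'; lra.
  - intros s _; unfold P, g.
    evar_last.
    { apply is_Cder_mult; [apply is_Cder_const|].
      apply is_Cder_mult; [apply is_Cder_const|].
      apply is_Cder_Cexp, is_Cder_mult; [apply is_Cder_const|].
      apply is_Cder_RtoC; auto_derive; [trivial|reflexivity]. }
    set (z := circle_phase (t ^ 4) s).
    replace (RtoC (sin s)) with (RtoC (/ t ^ 4) * RtoC (t ^ 4 * sin s))%C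
      by (rewrite <- RtoC_mult; f_equal; field; lra).
    match goal with |- context [RtoC (?u * (1 * - sin s))] =>
      replace (RtoC (u * (1 * - sin s))) with (- RtoC (t ^ 4 * sin s))%C
        by (rewrite <- RtoC_opp; f_equal; simpl; ring) end.
    cbv beta; generalize (RtoC (t ^ 4 * sin s)) (RtoC (/ t ^ 4)) (RtoC (t ^ 4 * cos s)) z; intros u v u' z'.
    apply injective_projections; simpl; ring.
  - intros s _; apply Ccont_mult; [|apply Ccont_circle_phase].
    apply Ccont_RtoC, continuous_sin.
  - intros s Hs; unfold G.
    apply Ccont_mult; [apply Hc; lra|].
    apply continuous_ext_loc with (fun s => RtoC (/ q s)).
    + assert (Q : continuous q s) by (unfold q; eapply continuous_of_derivable; auto_derive; trivial; reflexivity).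
      assert (Q2 : locally (q s) (fun z => z <> 0)) by (apply open_neq; assert (Z := qpos s Hs); lra).
      generalize (Q _ Q2); unfold filtermap; apply filter_imp; intros z Hz; now rewrite RtoC_inv.
    + apply Ccont_RtoC.
      unfold q; eapply continuous_of_derivable; auto_derive; [|reflexivity].
      assert (Z := qpos s Hs); unfold q in Z; unfold Rdiv in Z; lra.
  - intros s _; unfold P; rewrite !Cmod_mult, Cmod_R, Cmod_Ci, Cmod_Cexp_i, Rabs_pos_eq; [lra|].
    left; now apply Rinv_0_lt_compat.
  - intros s _; unfold g; rewrite Cmod_mult, Cmod_Cexp_i, Cmod_R, Rmult_1_r.
    apply Rabs_le, SIN_bound. }
assert (EI : CInt (fun s => H s * (RtoC (cos (s / 2)) * circle_phase (t ^ 4) s))%C e b = CInt (fun s => G s * g s)%C e b).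
{ symmetry; apply is_CInt_unique.
  apply (is_CInt_ext (fun s => H s * (RtoC (cos (s / 2)) * circle_phase (t ^ 4) s))%C); [lra| |apply CInt_correct, Hex; lra].
  intros s Hs; unfold G, g.
  assert (Z := qpos s ltac:(lra)).
  assert (Es : sin s = q s * cos (s / 2)).
  { unfold q; rewrite <- sin_2a; f_equal; field. }
  rewrite Es, (RtoC_mult (q s)); field; apply RtoC_neq_0; lra. }
rewrite EI.
assert (me : 0 < m * e) by (apply Rmult_lt_0_compat; lra).
assert (Sme := sqrt_lt_R0 _ me).
assert (QI : forall s, e <= s <= b -> K' / sqrt (q s) <= K' / sqrt (m * e)).
{ intros s Hs; apply Rmult_le_compat_l; [lra|]; apply Rinv_le_contravar; [exact Sme|].
  apply sqrt_le_1_alt; eapply Rle_trans; [|apply Hqm; lra]; apply Rmult_le_compat_l; lra. }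
assert (G1 := GB e ltac:(lra)); assert (G2 := GB b ltac:(lra)).
assert (Q1 := QI e ltac:(lra)); assert (Q2 := QI b ltac:(lra)).
assert (Qb : 0 <= K' / sqrt (q b)) by (apply Rdiv_le_0_compat; [lra|apply sqrt_lt_R0, qpos; lra]).
assert (We : 0 <= w e / q e) by (apply Rdiv_le_0_compat; [apply Hw0; lra|apply qpos; lra]).
assert (Wb : w b / q b <= K' / sqrt (q b)).
{ assert (Z := qpos b ltac:(lra)); assert (Z1 := sqrt_lt_R0 _ Z).
  replace (K' / sqrt (q b)) with ((K' * sqrt (q b)) / q b).
  2:{ rewrite <- (sqrt_sqrt (q b)) at 2 by lra; field; lra. }
  apply Rmult_le_compat_r; [left; now apply Rinv_0_lt_compat|apply HwK'; lra]. }
assert (T : Cmod (CInt (fun s => G s * g s)%C e b) <= / t ^ 4 * (7 * (K' / sqrt (m * e)))).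
{ eapply Rle_trans; [exact A|]; apply Rmult_le_compat_l; [left; now apply Rinv_0_lt_compat|].
  unfold Rdiv in *; lra. }
replace ((K * sqrt b * b + 7 * K' / (sqrt m * sqrt b)) / t ^ 3) with
  (K * sqrt e * (e - 0) + / t ^ 4 * (7 * (K' / sqrt (m * e)))); [lra|].
rewrite sqrt_mult_alt, Se by lra; unfold e; field; lra.
Qed.

(** The amplitude splits into its value at the stationary point times
    [cos (s / 2)], which is an exact Fresnel integral, and a remainder vanishing
    there. *)
Lemma one_sided_stationary_phase (b : R) (F : R -> C) : 0 < b < PI -> tame 0 b F ->
  (forall s, 0 <= s <= b -> Ccont F s) ->
  exists M, forall t, 1 <= t ->
    Cmod (CInt (fun s => F s * circle_phase (t ^ 4) s)%C 0 b
      - F 0%R * (Cexp (Ci * RtoC (t ^ 4)) * RtoC (sqrt 2 / t ^ 2)%R * fresnel_limit))%C <= M / t ^ 3.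
Proof.
intros Hb HF Hc.
set (H := fun s => (F s * / RtoC (cos (s / 2)) - F 0%R)%C).
assert (cpos : forall s, 0 <= s <= b -> 0 < cos (b / 2) <= cos (s / 2)) by (intros; now apply cos_half_pos).
assert (cneq : forall s, 0 <= s <= b -> RtoC (cos (s / 2)) <> RtoC 0).
{ intros s Hs; apply RtoC_neq_0; assert (Z := cpos s Hs); lra. }
assert (TH : tame 0 b H).
{ apply tame_plus; [|apply tame_opp, tame_const].
  apply tame_mult; [exact HF|].
  apply tame_inv with (cos (b / 2)); [apply (cpos b); lra| |].
  - intros s Hs; assert (Z := cpos s Hs); rewrite Cmod_R, Rabs_pos_eq; lra.
  - apply (tame_lipschitz 0 b 1); [lra|]; intros x y A1 A2 A3.
    rewrite <- RtoC_minus, Cmod_R.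
    destruct (MVT_gen (fun s => cos (s / 2)) x y (fun s => - sin (s / 2) / 2)) as [z [Hz E]].
    + intros z _; auto_derive; trivial; unfold Rdiv; field.
    + intros z _; eapply continuity_pt_of_derivable; auto_derive; trivial; reflexivity.
    + rewrite E, Rabs_mult, (Rabs_pos_eq (y - x)) by lra.
      apply Rmult_le_compat_r; [lra|].
      assert (Z := SIN_bound (z / 2)); apply Rabs_le; lra. }
assert (CH : forall s, 0 <= s <= b -> Ccont H s).
{ intros s Hs; apply Ccont_minus; [|apply Ccont_const].
  apply Ccont_mult; [now apply Hc|].
  assert (Z := cpos s Hs).
  apply continuous_ext_loc with (fun s => RtoC (/ cos (s / 2))).
  - assert (Q : continuous (fun s => cos (s / 2)) s) by (eapply continuous_of_derivable; auto_derive; trivial; reflexivity).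
    assert (Q2 : locally (cos (s / 2)) (fun z => z <> 0)) by (apply open_neq; lra).
    generalize (Q _ Q2); unfold filtermap; apply filter_imp; intros z Hz; now rewrite RtoC_inv.
  - apply Ccont_RtoC; eapply continuous_of_derivable; auto_derive; [|reflexivity].
    unfold Rdiv in Z; lra. }
assert (H0 : H 0 = RtoC 0).
{ unfold H; replace (0 / 2) with 0 by field; rewrite cos_0; field; apply RtoC_neq_0; lra. }
destruct (stationary_vanishing b H Hb TH CH H0) as [M HM].
assert (Ps : 0 < sin (b / 2)) by (apply sin_gt_0; lra).
exists (M + Cmod (F 0) * (80 / sin (b / 2))); intros t Ht.
assert (S2 := sqrt_lt_R0 2 ltac:(lra)).
assert (T1 := HM t Ht).
assert (I1 : is_CInt (fun s => H s * (RtoC (cos (s / 2)) * circle_phase (t ^ 4) s))%C 0 b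
  (CInt (fun s => H s * (RtoC (cos (s / 2)) * circle_phase (t ^ 4) s))%C 0 b)).
{ apply CInt_correct, ex_CInt_cont; rewrite Rmin_left, Rmax_right by lra; intros s Hs.
  apply Ccont_mult; [now apply CH|].
  apply Ccont_mult; [apply Ccont_RtoC_cos_half|apply Ccont_circle_phase]. }
assert (I2 := is_CInt_Cmult _ _ _ _ (F 0) (circle_fresnel b t Hb ltac:(lra))).
assert (I3 := is_CInt_plus _ _ _ _ _ _ I1 I2).
set (J := CInt (fun s => H s * (RtoC (cos (s / 2)) * circle_phase (t ^ 4) s))%C 0 b) in *.
set (X := sqrt 2 * t ^ 2 * sin (b / 2)) in *.
assert (PX : 0 < X) by (repeat apply Rmult_lt_0_compat; try lra; apply pow_lt; lra).
assert (FA := fresnel_asymptotic X PX).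
set (p := (Cexp (Ci * RtoC (t ^ 4)))%C) in *.
assert (EI : CInt (fun s => F s * circle_phase (t ^ 4) s)%C 0 b = (J + F 0%R * (p * RtoC (sqrt 2 / t ^ 2) * fresnel X))%C).
{ apply is_CInt_unique; revert I3; apply is_CInt_ext; [lra|]; intros s Hs; unfold H.
  assert (Z := cneq s ltac:(lra)); field; exact Z. }
rewrite EI.
match goal with |- Cmod ?z <= _ => replace z with
  (J + F 0%R * (p * RtoC (sqrt 2 / t ^ 2)%R * (fresnel X - fresnel_limit)))%C
  by (generalize (fresnel X) J; intros; ring) end.
eapply Rle_trans; [apply Cmod_triangle|].
replace ((M + Cmod (F 0) * (80 / sin (b / 2))) / t ^ 3) with
  (M / t ^ 3 + Cmod (F 0) * (80 / sin (b / 2) / t ^ 3)) by (field; lra).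
apply Rplus_le_compat; [exact T1|].
unfold p; rewrite !Cmod_mult, Cmod_Cexp_i, Rmult_1_l, Cmod_R.
apply Rmult_le_compat_l; [apply Cmod_ge_0|].
rewrite Rabs_pos_eq by (apply Rdiv_le_0_compat; [lra|apply pow_lt; lra]).
apply Rle_trans with (sqrt 2 / t ^ 2 * (80 / X)).
- apply Rmult_le_compat_l; [apply Rdiv_le_0_compat; [lra|apply pow_lt; lra]|exact FA].
- unfold X; replace (sqrt 2 / t ^ 2 * (80 / (sqrt 2 * t ^ 2 * sin (b / 2)))) with
    (80 / sin (b / 2) * / (t ^ 3 * t)) by (field; lra).
  apply Rmult_le_compat_l; [apply Rdiv_le_0_compat; lra|].
  assert (0 < t ^ 3) by (apply pow_lt; lra).
  apply Rinv_le_contravar; [lra|]; nra.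
Qed.

(** * Stationary phase on the half circle of propagating directions *)

Lemma cos_lipschitz (x y : R) : x <= y -> Rabs (cos y - cos x) <= y - x.
Proof.
intros H; destruct (MVT_gen cos x y (fun s => - sin s)) as [z [_ E]].
- intros z _; auto_derive; trivial; ring.
- intros z _; eapply continuity_pt_of_derivable; auto_derive; trivial; reflexivity.
- rewrite E, Rabs_mult, (Rabs_pos_eq (y - x)) by lra.
  rewrite <- (Rmult_1_l (y - x)) at 2; apply Rmult_le_compat_r; [lra|].
  assert (Z := SIN_bound z); apply Rabs_le; lra.
Qed.

Lemma tame_sin_comp (a b c d : R) : Rabs d = 1 -> tame a b (fun s => RtoC (sin (c + d * s))).
Proof.
intros Hd; apply (tame_lipschitz a b 1); [lra|]; intros x y H1 H2 H3.
rewrite <- RtoC_minus, Cmod_R.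
destruct (MVT_gen (fun s => sin (c + d * s)) x y (fun s => d * cos (c + d * s))) as [z [_ E]].
- intros z _; auto_derive; trivial; ring.
- intros z _; eapply continuity_pt_of_derivable; auto_derive; trivial; reflexivity.
- rewrite E, !Rabs_mult, Hd, (Rabs_pos_eq (y - x)) by lra.
  rewrite Rmult_1_l; apply Rmult_le_compat_r; [lra|].
  assert (Z := COS_bound (c + d * z)); apply Rabs_le; lra.
Qed.

Lemma Ccont_circle_amplitude (k c d : R) (f : R -> C) (s : R) : (forall x, Ccont f x) ->
  Ccont (fun s => RtoC (sin (c + d * s)) * f (k * cos (c + d * s))%R)%C s.
Proof.
intros Hf; apply Ccont_mult.
- apply Ccont_RtoC; eapply continuous_of_derivable; auto_derive; trivial; reflexivity.
- apply (continuous_comp (V := R_UniformSpace) (fun s => k * cos (c + d * s)) f); [|apply Hf].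
  eapply continuous_of_derivable; auto_derive; trivial; reflexivity.
Qed.

(** The stationary point splits the half circle into two arcs, on each of which
    the angle from it is the integration variable. *)
Lemma circle_stationary_phase (k theta : R) (f : R -> C) : 0 < k -> 0 < theta < PI ->
  tame (- k) k f -> (forall x, Ccont f x) ->
  exists M, forall t, 1 <= t ->
    Cmod (CInt (fun phi => RtoC (sin phi) * f (k * cos phi)%R
                  * Cexp (Ci * RtoC (t ^ 4 * cos (phi - theta))))%C 0 PI
      - RtoC 2 * (RtoC (sin theta) * f (k * cos theta)%R
          * (Cexp (Ci * RtoC (t ^ 4)) * RtoC (sqrt 2 / t ^ 2)%R * fresnel_limit)))%C <= M / t ^ 3.
Proof.
intros Hk Hth Hf Hc.
set (A := fun d s => (RtoC (sin (theta + d * s)) * f (k * cos (theta + d * s))%R)%C).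
assert (T1 : tame 0 (PI - theta) (A 1)).
{ apply tame_mult; [apply tame_sin_comp, Rabs_R1|].
  apply (tame_comp_decr 0 (PI - theta) (- k) k k f (fun s => k * cos (theta + 1 * s))); [lra| | |exact Hf].
  - intros x _; assert (Z := COS_bound (theta + 1 * x)); nra.
  - intros x y H1 H2 H3.
    assert (Z := cos_lipschitz (theta + 1 * x) (theta + 1 * y) ltac:(lra)).
    assert (Z2 : cos (theta + 1 * y) <= cos (theta + 1 * x)) by (apply cos_decr_1; lra).
    rewrite Rabs_left1 in Z by lra; nra. }
assert (T2 : tame 0 theta (A (-1))).
{ apply tame_mult; [apply tame_sin_comp; rewrite Rabs_left; lra|].
  apply (tame_comp_incr 0 theta (- k) k k f (fun s => k * cos (theta + -1 * s))); [lra| | |exact Hf].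
  - intros x _; assert (Z := COS_bound (theta + -1 * x)); nra.
  - intros x y H1 H2 H3.
    assert (Z := cos_lipschitz (theta + -1 * y) (theta + -1 * x) ltac:(lra)).
    assert (Z2 : cos (theta + -1 * x) <= cos (theta + -1 * y)) by (apply cos_decr_1; lra).
    rewrite Rabs_left1 in Z by lra; nra. }
assert (Cc : forall d s, Ccont (A d) s) by (intros; now apply Ccont_circle_amplitude).
destruct (one_sided_stationary_phase (PI - theta) (A 1) ltac:(lra) T1 ltac:(auto)) as [M1 HM1].
destruct (one_sided_stationary_phase theta (A (-1)) ltac:(lra) T2 ltac:(auto)) as [M2 HM2].
exists (M1 + M2); intros t Ht.
specialize (HM1 t Ht); specialize (HM2 t Ht).
assert (A0 : forall d, A d 0 = (RtoC (sin theta) * f (k * cos theta)%R)%C).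
{ intros d; unfold A; now replace (theta + d * 0) with theta by ring. }
rewrite A0 in HM1, HM2.
set (h := fun phi => (RtoC (sin phi) * f (k * cos phi)%R
                  * Cexp (Ci * RtoC (t ^ 4 * cos (phi - theta))))%C).
assert (Ch : forall s, Ccont h s).
{ intros s; apply continuous_ext with (fun phi => (RtoC (sin (0 + 1 * phi)) * f (k * cos (0 + 1 * phi))%R * Cexp (Ci * RtoC (t ^ 4 * cos (phi - theta))))%C).
  { assert (E0 : forall v : R, 0 + 1 * v = v) by (intros; ring).
    intros u; unfold h; now rewrite E0. }
  apply Ccont_mult; [now apply Ccont_circle_amplitude|].
  apply Ccont_Cexp, Ccont_mult; [apply Ccont_const|].
  apply Ccont_RtoC; eapply continuous_of_derivable; auto_derive; trivial; reflexivity. }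
assert (Eh : forall x y, ex_CInt h x y) by (intros; apply ex_CInt_cont; auto).
assert (I1 : is_CInt (fun s => A 1 s * circle_phase (t ^ 4) s)%C 0 (PI - theta) (CInt h theta PI)).
{ apply is_CInt_ext with (fun s => scal 1 (h (1 * s + theta))); [lra| |].
  - intros s _; rewrite scal_R_Cmult, Cmult_1_l; unfold h, A; cbv beta.
    replace (1 * s + theta - theta) with s by ring.
    now replace (theta + 1 * s) with (1 * s + theta) by ring.
  - apply (is_RInt_comp_lin (V := C_R_NormedModule) h 1 theta 0 (PI - theta)).
    replace (1 * 0 + theta) with theta by ring; replace (1 * (PI - theta) + theta) with PI by ring.
    apply CInt_correct, Eh. }
assert (I2 : is_CInt (fun s => A (-1) s * circle_phase (t ^ 4) s)%C 0 theta (CInt h 0 theta)).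
{ apply is_CInt_ext with (fun s => opp (scal (-1) (h (-1 * s + theta)))); [lra| |].
  - intros s _; rewrite scal_R_Cmult; change (opp (RtoC (-1) * h (-1 * s + theta)%R)%C) with (- (RtoC (-1) * h (-1 * s + theta)%R))%C.
    replace (- (RtoC (-1) * h (-1 * s + theta)%R))%C with (h (-1 * s + theta)) by (apply injective_projections; simpl; ring).
    unfold h, A; cbv beta.
    replace (-1 * s + theta - theta) with (- s) by ring; rewrite cos_neg.
    now replace (theta + -1 * s) with (-1 * s + theta) by ring.
  - replace (CInt h 0 theta) with (opp (opp (CInt h 0 theta))) by apply opp_opp.
    apply (is_RInt_opp (V := C_R_NormedModule)).
    apply (is_RInt_comp_lin (V := C_R_NormedModule) h (-1) theta 0 theta).
    replace (-1 * 0 + theta) with theta by ring; replace (-1 * theta + theta) with 0 by ring.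
    apply (is_RInt_swap (V := C_R_NormedModule)), CInt_correct, Eh. }
rewrite (is_CInt_unique _ _ _ _ I1) in HM1; rewrite (is_CInt_unique _ _ _ _ I2) in HM2.
rewrite (CInt_Chasles h 0 theta PI) by apply Eh.
set (X := (Cexp (Ci * RtoC (t ^ 4)) * RtoC (sqrt 2 / t ^ 2)%R * fresnel_limit)%C) in *.
set (Y := (RtoC (sin theta) * f (k * cos theta)%R)%C) in *.
match goal with |- Cmod ?z <= _ => replace z with
  ((CInt h theta PI - Y * X) + (CInt h 0 theta - Y * X))%C
  by (generalize (CInt h theta PI) (CInt h 0 theta); intros; replace (RtoC 2) with (1 + 1)%C by (rewrite <- RtoC_plus; f_equal; ring); ring) end.
eapply Rle_trans; [apply Cmod_triangle|].
unfold Rdiv in *; lra.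
Qed.

Lemma beta_inside (m : medium) (a : wave) (s : side) (phi : R) :
  0 < k m a s -> 0 <= phi <= PI ->
  beta m a s (k m a s * cos phi) = (- Ci * RtoC (k m a s * sin phi)%R)%C.
Proof.
intros Hk Hphi; unfold beta; set (kk := k m a s) in *.
assert (S0 : 0 <= sin phi) by (apply sin_ge_0; lra).
assert (E : kk ^ 2 - (kk * cos phi) ^ 2 = (kk * sin phi) ^ 2).
{ assert (Z := sin2_cos2 phi); unfold Rsqr in Z; nra. }
assert (P0 : 0 <= kk * sin phi) by nra.
destruct (Rle_dec kk (Rabs (kk * cos phi))) as [H|H].
- rewrite Rabs_mult, (Rabs_pos_eq kk) in H by lra.
  assert (Z := COS_bound phi).
  assert (Z1 : Rabs (cos phi) <= 1) by (apply Rabs_le; lra).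
  assert (Z2 : Rabs (cos phi) = 1) by nra.
  assert (Z3 : cos phi ^ 2 = 1) by (rewrite <- (pow2_abs (cos phi)), Z2; ring).
  assert (Z4 : sin phi = 0).
  { assert (Q := sin2_cos2 phi); unfold Rsqr in Q; nra. }
  rewrite Z4, Rmult_0_r; replace ((kk * cos phi) ^ 2 - kk ^ 2) with 0 by (rewrite Rpow_mult_distr, Z3; ring).
  rewrite sqrt_0; ring.
- rewrite E, sqrt_pow2; trivial.
Qed.

(** The mode of horizontal frequency [xi] in the upper half plane, propagating
    for [|xi|] below the wave number and evanescent above it. *)
Definition plane_wave (m : medium) (a : wave) (x : point) (xi : R) : C :=
  (Cexp (- beta m a Plus xi * RtoC (snd x)) * Cexp (Ci * RtoC (fst x * xi)%R))%C.

Lemma plane_wave_inside (m : medium) (a : wave) (r theta phi : R) :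
  0 < k m a Plus -> 0 <= phi <= PI ->
  plane_wave m a (polar r theta) (k m a Plus * cos phi)
    = Cexp (Ci * RtoC (k m a Plus * r * cos (phi - theta)))%C.
Proof.
intros Hk Hphi; unfold plane_wave; rewrite beta_inside by assumption.
rewrite <- Cexp_plus; f_equal; rewrite cos_minus.
apply injective_projections; simpl; ring.
Qed.

(** The substitution [xi = k cos phi] removes the square root from the phase,
    which becomes a translate of the cosine. *)
Lemma propagating_integral (m : medium) (a : wave) (r theta : R) (f : R -> C) :
  0 < k m a Plus -> (forall x, Ccont (fun xi => f xi * plane_wave m a (polar r theta) xi)%C x) ->
  CInt (fun xi => f xi * plane_wave m a (polar r theta) xi)%C (- k m a Plus) (k m a Plus) =
  (RtoC (k m a Plus) * CInt (fun phi => RtoC (sin phi) * f (k m a Plus * cos phi)%R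
      * Cexp (Ci * RtoC (k m a Plus * r * cos (phi - theta))))%C 0 PI)%C.
Proof.
intros Hk Hc; set (kk := k m a Plus) in *.
set (h := fun xi => (f xi * plane_wave m a (polar r theta) xi)%C) in *.
assert (I := is_RInt_comp (V := C_R_CompleteNormedModule) h (fun phi => kk * cos phi) (fun phi => - kk * sin phi) 0 PI
   ltac:(intros; apply Hc)).
specialize (I ltac:(intros phi _; split; [auto_derive; trivial; ring|eapply continuous_of_derivable; auto_derive; trivial; reflexivity])).
simpl in I; rewrite cos_0, cos_PI in I.
replace (kk * 1) with kk in I by ring; replace (kk * -1) with (- kk) in I by ring.
apply (is_CInt_Cmult _ _ _ _ (- RtoC (/ kk))%C) in I.
assert (J : CInt (fun phi => RtoC (sin phi) * f (kk * cos phi)%R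
      * Cexp (Ci * RtoC (kk * r * cos (phi - theta))))%C 0 PI = (- RtoC (/ kk) * RInt (V := C_R_CompleteNormedModule) h kk (- kk))%C).
{ apply is_CInt_unique; revert I; apply is_CInt_ext; [left; apply PI_RGT_0|].
  intros phi Hphi; rewrite scal_R_Cmult; unfold h, kk; rewrite plane_wave_inside by (fold kk; lra).
  fold kk; replace (- kk * sin phi) with (- (kk * sin phi)) by ring.
  rewrite RtoC_opp, RtoC_mult, RtoC_inv by lra; field; apply RtoC_neq_0; lra. }
rewrite J.
change (RInt (V := C_R_CompleteNormedModule) h kk (- kk)) with (CInt h kk (- kk)).
rewrite (CInt_swap h (- kk) kk) by (apply ex_CInt_cont; intros; apply Hc).
rewrite RtoC_inv by lra; field; apply RtoC_neq_0; lra.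
Qed.

(** * Branch points and evanescent tails *)

Lemma tame_continuous (a b x : R) (F : R -> C) : a < x < b -> tame a b F -> Ccont F x.
Proof.
intros Hx (W & K & HK & H); apply filterlim_locally; intros eps.
assert (He := cond_pos eps).
set (d := Rmin (Rmin (x - a) (b - x)) ((eps / (K + 1)) ^ 2)).
assert (Hq : 0 < eps / (K + 1)) by (apply Rdiv_lt_0_compat; lra).
assert (Hd : 0 < d) by (repeat apply Rmin_glb_lt; try lra; apply pow_lt; lra).
exists (mkposreal d Hd); intros y Hy.
assert (Hy' : Rabs (y - x) < d) by exact Hy.
assert (D1 : d <= x - a) by (eapply Rle_trans; [apply Rmin_l|apply Rmin_l]).
assert (D2 : d <= b - x) by (eapply Rle_trans; [apply Rmin_l|apply Rmin_r]).
assert (D3 : d <= (eps / (K + 1)) ^ 2) by apply Rmin_r.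
assert (B : Cmod (F y - F x)%C <= K * sqrt (Rabs (y - x))).
{ destruct (Rle_dec x y) as [L|L].
  - rewrite (Rabs_pos_eq (y - x)) in * by lra.
    destruct (H x y ltac:(lra) L ltac:(lra)) as [A1 A2]; lra.
  - rewrite (Rabs_left (y - x)) in * by lra.
    replace (- (y - x)) with (x - y) in * by ring.
    destruct (H y x ltac:(lra) ltac:(lra) ltac:(lra)) as [A1 A2].
    replace (F y - F x)%C with (- (F x - F y))%C by ring; rewrite Cmod_opp; lra. }
assert (B2 : sqrt (Rabs (y - x)) <= eps / (K + 1)).
{ rewrite <- (sqrt_pow2 (eps / (K + 1))) by lra; apply sqrt_le_1_alt; lra. }
assert (B3 : Cmod (F y - F x)%C < eps).
{ apply Rle_lt_trans with (K * (eps / (K + 1))); [eapply Rle_trans; [exact B|apply Rmult_le_compat_l; lra]|].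
  replace (pos eps) with ((K + 1) * (eps / (K + 1))) at 2 by (field; lra). nra. }
apply (norm_compat1 (V := C_R_NormedModule)); rewrite <- Cmod_norm; exact B3.
Qed.

(** The branch of the square root used by [beta]: values in the closed fourth
    quadrant. *)
Definition branch_sqrt (t : R) : C :=
  if Rle_dec 0 t then RtoC (sqrt t) else (- Ci * RtoC (sqrt (- t)))%C.

(** The dominating function is the odd extension of the square root: across the
    branch point the real and the imaginary part add up. *)
Lemma tame_branch_sqrt (a b : R) : tame a b branch_sqrt.
Proof.
exists (fun t => if Rle_dec 0 t then sqrt t else - sqrt (- t)), 2; split; [lra|].
intros x y _ Hxy _; unfold branch_sqrt.
assert (S0 := sqrt_pos (y - x)).
assert (Ci1 : forall u : R, 0 <= u -> Cmod (- Ci * RtoC u)%C = u).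
{ intros u Hu; rewrite Cmod_mult, Cmod_opp, Cmod_Ci, Cmod_R, Rabs_pos_eq; lra. }
destruct (Rle_dec 0 x) as [X|X]; destruct (Rle_dec 0 y) as [Y|Y]; try (exfalso; lra).
- assert (Z : sqrt x <= sqrt y) by (apply sqrt_le_1_alt; lra).
  assert (Z2 := sqrt_sub_le x y X Hxy).
  rewrite <- RtoC_minus, Cmod_R, Rabs_pos_eq by lra; lra.
- assert (Z : sqrt (- x) <= sqrt (y - x)) by (apply sqrt_le_1_alt; lra).
  assert (Z2 : sqrt y <= sqrt (y - x)) by (apply sqrt_le_1_alt; lra).
  split; [|lra].
  eapply Rle_trans; [apply Cmod_triangle|].
  rewrite Cmod_opp, Ci1, Cmod_R, Rabs_pos_eq by apply sqrt_pos; lra.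
- assert (Z : sqrt (- y) <= sqrt (- x)) by (apply sqrt_le_1_alt; lra).
  assert (Z2 := sqrt_sub_le (- y) (- x) ltac:(lra) ltac:(lra)).
  replace (- x - - y) with (y - x) in Z2 by ring.
  replace (- Ci * RtoC (sqrt (- y)) - - Ci * RtoC (sqrt (- x)))%C with
    (- (- Ci * RtoC (sqrt (- x) - sqrt (- y))))%C by (rewrite RtoC_minus; ring).
  rewrite Cmod_opp, Ci1 by lra; lra.
Qed.

Lemma beta_factor (m : medium) (a : wave) (s : side) (xi : R) : 0 < k m a s ->
  beta m a s xi = (branch_sqrt (Rabs xi - k m a s) * RtoC (sqrt (Rabs xi + k m a s)))%C.
Proof.
intros Hk; unfold beta, branch_sqrt; set (kk := k m a s) in *.
assert (Z := Rabs_pos xi); assert (E : xi ^ 2 = Rabs xi ^ 2) by (symmetry; apply pow2_abs).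
rewrite E; destruct (Rle_dec kk (Rabs xi)); destruct (Rle_dec 0 (Rabs xi - kk)); try (exfalso; lra).
- rewrite <- RtoC_mult, <- sqrt_mult by lra; do 2 f_equal; ring.
- rewrite <- Cmult_assoc, <- RtoC_mult, <- sqrt_mult by lra; do 3 f_equal; ring.
Qed.

Lemma tame_beta (m : medium) (a : wave) (s : side) (T : R) : 0 < k m a s ->
  tame (- T) T (beta m a s).
Proof.
intros Hk; set (kk := k m a s).
apply tame_ext with (fun xi => (fun z => branch_sqrt (z - kk) * RtoC (sqrt (z + kk)))%C (Rabs xi)).
{ intros xi _; symmetry; now apply beta_factor. }
destruct (Rle_dec 0 T) as [HT|HT].
2:{ exists (fun _ => 0), 0; split; [lra|intros; exfalso; lra]. }
assert (Base : tame 0 T (fun z => branch_sqrt (z - kk) * RtoC (sqrt (z + kk)))%C).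
{ apply tame_mult.
  - apply (tame_comp_incr 0 T (- kk) (T - kk) 1 branch_sqrt (fun z => z - kk)); try (intros; lra).
    apply tame_branch_sqrt.
  - exists (fun z => sqrt (z + kk)), 1; split; [lra|].
    intros x y H1 H2 H3.
    assert (Z := sqrt_sub_le (x + kk) (y + kk) ltac:(unfold kk; lra) ltac:(lra)).
    replace (y + kk - (x + kk)) with (y - x) in Z by ring.
    assert (Z2 : sqrt (x + kk) <= sqrt (y + kk)) by (apply sqrt_le_1_alt; lra).
    rewrite <- RtoC_minus, Cmod_R, Rabs_pos_eq by lra; lra. }
apply tame_glue with 0.
- apply (tame_comp_decr (- T) 0 0 T 1 (fun z => branch_sqrt (z - kk) * RtoC (sqrt (z + kk)))%C Rabs); [lra| | |exact Base].
  + intros x Hx; rewrite Rabs_left1; lra.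
  + intros x y H1 H2 H3; rewrite !Rabs_left1 by lra; lra.
- apply (tame_comp_incr 0 T 0 T 1 (fun z => branch_sqrt (z - kk) * RtoC (sqrt (z + kk)))%C Rabs); [lra| | |exact Base].
  + intros x Hx; rewrite Rabs_pos_eq; lra.
  + intros x y H1 H2 H3; rewrite !Rabs_pos_eq by lra; lra.
Qed.

Lemma Ccont_beta (m : medium) (a : wave) (s : side) (x : R) : 0 < k m a s -> Ccont (beta m a s) x.
Proof.
intros Hk; apply (tame_continuous (- (Rabs x + 1)) (Rabs x + 1)); [|now apply tame_beta].
split; [assert (Z := Rabs_maj2 x)|assert (Z := Rle_abs x)]; lra.
Qed.

Lemma beta_quadrant (m : medium) (a : wave) (s : side) (xi : R) :
  0 <= Re (beta m a s xi) /\ Im (beta m a s xi) <= 0.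
Proof.
unfold beta; destruct (Rle_dec _ _); simpl.
- split; [apply sqrt_pos|lra].
- match goal with |- context [sqrt ?z] => assert (Z := sqrt_pos z) end; split; lra.
Qed.

Lemma beta_outside (m : medium) (a : wave) (s : side) (xi : R) : k m a s <= Rabs xi ->
  beta m a s xi = RtoC (sqrt (xi ^ 2 - k m a s ^ 2)).
Proof. intros H; unfold beta; now destruct (Rle_dec _ _). Qed.

Lemma Cmod_Cexp_beta_le_1 (m : medium) (a : wave) (s : side) (xi t : R) : 0 <= t ->
  Cmod (Cexp (- beta m a s xi * RtoC t))%C <= 1.
Proof.
intros Ht; rewrite Cmod_Cexp, <- exp_0; apply exp_le.
destruct (beta_quadrant m a s xi) as [H _]; simpl; unfold Re in *; nra.
Qed.

Lemma Ccont_plane_wave (m : medium) (a : wave) (x : point) (xi : R) : 0 < k m a Plus ->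
  Ccont (plane_wave m a x) xi.
Proof.
intros Hk; apply Ccont_mult; apply Ccont_Cexp, Ccont_mult.
- apply Ccont_opp, Ccont_beta, Hk.
- apply Ccont_const.
- apply Ccont_const.
- apply Ccont_RtoC; eapply continuous_of_derivable; auto_derive; trivial; reflexivity.
Qed.

(** From [exp u = (exp (u / 2))^2] and the Taylor polynomial of degree 2; the
    square makes the right-hand side integrable after [u] is bounded below by a
    multiple of a square root. *)
Lemma exp_opp_le (u : R) : 0 <= u -> exp (- u) <= / (1 + u ^ 2 / 8) ^ 2.
Proof.
intros Hu; rewrite exp_Ropp; apply Rinv_le_contravar; [apply pow_lt; nra|].
assert (H := exp_ge_taylor (u / 2) 2 ltac:(lra)); simpl in H.
replace (exp u) with (exp (u / 2) ^ 2).
- apply pow_incr; split; [nra|]; eapply Rle_trans; [|exact H]; field_simplify; nra.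
- simpl; rewrite Rmult_1_r, <- exp_plus; f_equal; field.
Qed.

(** An integrable majorant of the evanescent part of a plane wave whose
    primitive is elementary and smooth at the branch point. *)
Lemma plane_wave_decay (m : medium) (a : wave) (x : point) (xi : R) :
  0 < k m a Plus -> 0 < snd x -> k m a Plus <= Rabs xi ->
  Cmod (plane_wave m a x xi) <=
    / (1 + snd x ^ 2 * k m a Plus / 4 * (Rabs xi - k m a Plus)) ^ 2.
Proof.
intros Hk Hx Hxi; unfold plane_wave; set (kk := k m a Plus) in *.
rewrite Cmod_mult, Cmod_Cexp_i, Rmult_1_r, Cmod_Cexp, beta_outside by exact Hxi.
fold kk; set (tau := sqrt (xi ^ 2 - kk ^ 2)).
assert (E : xi ^ 2 = Rabs xi ^ 2) by (symmetry; apply pow2_abs).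
assert (P : 0 <= xi ^ 2 - kk ^ 2) by (rewrite E; nra).
assert (T0 := sqrt_pos (xi ^ 2 - kk ^ 2)); fold tau in T0.
assert (T2 : tau * tau = xi ^ 2 - kk ^ 2) by (apply sqrt_sqrt, P).
match goal with |- exp ?z <= _ => replace z with (- (snd x * tau)) by (simpl; ring) end.
eapply Rle_trans; [apply exp_opp_le; nra|].
assert (Q : 0 <= snd x ^ 2 * kk / 4 * (Rabs xi - kk)) by (apply Rmult_le_pos; [|lra]; assert (0 < snd x ^ 2) by nra; nra).
apply Rinv_le_contravar; [apply pow_lt; lra|].
apply pow_incr; split; [lra|]; apply Rplus_le_compat_l.
replace ((snd x * tau) ^ 2 / 8) with (snd x ^ 2 / 8 * (xi ^ 2 - kk ^ 2)) by (rewrite <- T2; field).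
rewrite E; replace (snd x ^ 2 * kk / 4 * (Rabs xi - kk)) with (snd x ^ 2 / 8 * (2 * kk * (Rabs xi - kk))) by field.
apply Rmult_le_compat_l; nra.
Qed.

Lemma tail_interval (h : R -> C) (k0 c B x y : R) : 0 < c -> (forall x, Ccont h x) ->
  (forall x, k0 <= x -> Cmod (h x) <= B * / (1 + c * (x - k0)) ^ 2) -> k0 <= x -> x <= y ->
  Cmod (CInt h x y) <= B / c * (/ (1 + c * (x - k0)) - / (1 + c * (y - k0))).
Proof.
intros Hc Hh HB Hx Hxy.
assert (P : forall z, k0 <= z -> 0 < 1 + c * (z - k0)).
{ intros z Hz; assert (0 <= c * (z - k0)) by (apply Rmult_le_pos; lra); lra. }
apply (is_CInt_norm h (fun x => B * / (1 + c * (x - k0)) ^ 2) x y); [exact Hxy| | |].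
- intros z Hz; apply HB; lra.
- apply CInt_correct, ex_CInt_cont; auto.
- replace (B / c * (/ (1 + c * (x - k0)) - / (1 + c * (y - k0)))) with
    (minus ((fun z => - (B / c * / (1 + c * (z - k0)))) y) ((fun z => - (B / c * / (1 + c * (z - k0)))) x))
    by (unfold minus, plus, opp; simpl; ring).
  apply (is_RInt_derive (V := R_CompleteNormedModule) (fun z => - (B / c * / (1 + c * (z - k0))))); 
  rewrite Rmin_left, Rmax_right by lra; intros z Hz; assert (Pz := P z ltac:(lra)).
  + auto_derive; [lra|]; simpl; field; lra.
  + eapply continuous_of_derivable; auto_derive; [|reflexivity].
    assert (0 < (1 + c * (z - k0)) * ((1 + c * (z - k0)) * 1)) by nra; unfold Rminus in *; lra.
Qed.

Lemma tail_right (h : R -> C) (k0 c B : R) : 0 < c -> 0 <= B -> (forall x, Ccont h x) ->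
  (forall x, k0 <= x -> Cmod (h x) <= B * / (1 + c * (x - k0)) ^ 2) ->
  exists l, @is_RInt_gen C_R_NormedModule h (at_point k0) (Rbar_locally p_infty) l /\ Cmod l <= B / c.
Proof.
intros Hc HB0 Hh HB.
assert (Bc : 0 <= B / c) by (apply Rdiv_le_0_compat; lra).
assert (P : forall z, k0 <= z -> 0 < 1 + c * (z - k0)).
{ intros z Hz; assert (0 <= c * (z - k0)) by (apply Rmult_le_pos; lra); lra. }
assert (T := fun x y => tail_interval h k0 c B x y Hc Hh HB).
assert (Hex : forall x y, ex_CInt h x y) by (intros; apply ex_CInt_cont; auto).
assert (Cau : forall eps : posreal, exists M, k0 <= M /\ forall x y, M < x -> x <= y -> Cmod (CInt h x y) < eps).
{ intros eps; assert (He := cond_pos eps).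
  exists (k0 + (B / c + 1) / (c * eps)).
  assert (Q : 0 < (B / c + 1) / (c * eps)) by (apply Rdiv_lt_0_compat; nra).
  split; [lra|]; intros x y Hx Hxy.
  eapply Rle_lt_trans; [apply T; lra|].
  assert (Py := Rinv_0_lt_compat _ (P y ltac:(lra))).
  apply Rle_lt_trans with (B / c * / (1 + c * (x - k0))); [apply Rmult_le_compat_l; lra|].
  apply Rmult_lt_reg_r with (1 + c * (x - k0)); [apply P; lra|].
  rewrite Rmult_assoc, Rinv_l, Rmult_1_r by (assert (Z := P x ltac:(lra)); lra).
  assert (E : c * ((B / c + 1) / (c * eps)) * eps = B / c + 1) by (field; lra).
  assert (c * ((B / c + 1) / (c * eps)) < c * (x - k0)) by (apply Rmult_lt_compat_l; lra).
  nra. }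
destruct (proj1 (filterlim_locally_cauchy (U := C_R_CompleteNormedModule) (F := Rbar_locally p_infty) (fun x => CInt h k0 x))) as [l Hl].
{ intros eps; destruct (Cau eps) as (M & HM & H); exists (fun x => M < x); split.
  { now exists M. }
  intros u v Hu Hv; apply (norm_compat1 (V := C_R_NormedModule)); rewrite <- Cmod_norm.
  destruct (Rle_dec u v) as [L|L].
  - rewrite (CInt_Chasles h k0 u v) by apply Hex.
    match goal with |- Cmod ?z < _ => replace z with (CInt h u v) end; [apply H; lra|].
    generalize (CInt h k0 u) (CInt h u v); intros p q; change (@eq C q ((p + q) - p)%C); ring.
  - rewrite (CInt_Chasles h k0 v u) by apply Hex.
    match goal with |- Cmod ?z < _ => replace z with (- CInt h v u)%C end; [rewrite Cmod_opp; apply H; lra|].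
    generalize (CInt h k0 v) (CInt h v u); intros p q; change (@eq C (- q)%C (p - (p + q))%C); ring. }
exists l; split.
- intros Q HQ; unfold filtermapi.
  exists (fun a => a = k0) (fun x => Q (CInt h k0 x)).
  + reflexivity.
  + exact (Hl Q HQ).
  + intros a b Ha Hb; exists (CInt h k0 b); subst a; split; [apply CInt_correct, Hex|exact Hb].
- apply Rnot_lt_le; intros Hlt.
  set (d := Cmod l - B / c).
  assert (Hd : 0 < d / 2) by (unfold d; lra).
  assert (Lc : locally l (fun z : C_R_NormedModule => norm (minus z l) < d / 2)).
  { apply (locally_le_locally_norm (V := C_R_NormedModule)).
    exists (mkposreal _ Hd); intros z Hz; exact Hz. }
  destruct (Hl _ Lc) as [M HM].
  set (X := Rmax k0 M + 1).
  assert (X1 := Rmax_l k0 M); assert (X2 := Rmax_r k0 M).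
  specialize (HM X ltac:(unfold X; lra)).
  rewrite <- Cmod_norm in HM; change (minus (CInt h k0 X) l) with (CInt h k0 X - l)%C in HM.
  assert (A := T k0 X ltac:(lra) ltac:(unfold X; lra)).
  replace (1 + c * (k0 - k0)) with 1 in A by ring; rewrite Rinv_1 in A.
  assert (PX := Rinv_0_lt_compat _ (P X ltac:(unfold X; lra))).
  assert (A2 : Cmod (CInt h k0 X) <= B / c) by nra.
  assert (A3 : Cmod l <= Cmod (CInt h k0 X) + Cmod (CInt h k0 X - l)%C).
  { replace l with (CInt h k0 X + - (CInt h k0 X - l))%C at 1
      by (apply injective_projections; simpl; ring).
    eapply Rle_trans; [apply Cmod_triangle|]; rewrite Cmod_opp; lra. }
  unfold d in HM; lra.
Qed.

Lemma tail_left (h : R -> C) (k0 c B : R) : 0 < c -> 0 <= B -> (forall x, Ccont h x) ->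
  (forall x, k0 <= x -> Cmod (h (- x)) <= B * / (1 + c * (x - k0)) ^ 2) ->
  exists l, @is_RInt_gen C_R_NormedModule h (Rbar_locally m_infty) (at_point (- k0)) l /\ Cmod l <= B / c.
Proof.
intros Hc HB0 Hh HB.
destruct (tail_right (fun x => h (- x)) k0 c B Hc HB0) as [l [Hl Bl]]; [|exact HB|].
{ intros x; apply (continuous_comp (V := R_UniformSpace) (fun x => - x) h); [|apply Hh].
  eapply continuous_of_derivable; auto_derive; trivial; reflexivity. }
exists l; split; [|exact Bl].
intros Q HQ; destruct (Hl Q HQ) as [Q1 Q2 H1 [M HM] H3].
exists (fun x => Q2 (- x)) (fun x => Q1 (- x)).
- exists (- M); intros x Hx; apply HM; lra.
- unfold at_point in *; now rewrite Ropp_involutive.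
- intros a b Ha Hb; destruct (H3 _ _ Hb Ha) as [y [Iy Qy]]; exists y; split; [|exact Qy].
  apply (is_RInt_comp_opp (V := C_R_NormedModule) (fun x => h (- x)) b a) in Iy.
  apply (is_RInt_opp (V := C_R_NormedModule)), (is_RInt_swap (V := C_R_NormedModule)) in Iy.
  rewrite opp_opp in Iy; simpl.
  revert Iy; apply (is_RInt_ext (V := C_R_NormedModule)); intros x _.
  now rewrite opp_opp, Ropp_involutive.
Qed.

(** On either side the majorant of [plane_wave_decay] has an integral of order
    [1 / x2^2]; this gives convergence and isolates the propagating frequencies. *)
Lemma plane_wave_integral (m : medium) (a : wave) (x : point) (f : R -> C) (B : R) :
  0 < k m a Plus -> 0 < snd x -> (forall xi, Ccont f xi) -> (forall xi, Cmod (f xi) <= B) ->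
  exists l, @is_RInt_gen C_R_NormedModule (fun xi => f xi * plane_wave m a x xi)%C
     (Rbar_locally m_infty) (Rbar_locally p_infty) l /\
   Cmod (l - CInt (fun xi => f xi * plane_wave m a x xi)%C (- k m a Plus) (k m a Plus))%C
     <= 8 * B / (snd x ^ 2 * k m a Plus).
Proof.
intros Hk Hx Hf HB; set (kk := k m a Plus) in *.
set (h := fun xi => (f xi * plane_wave m a x xi)%C).
assert (Ch : forall xi, Ccont h xi) by (intros; apply Ccont_mult; [apply Hf|now apply Ccont_plane_wave]).
set (c := snd x ^ 2 * kk / 4).
assert (Hc : 0 < c) by (unfold c; assert (0 < snd x ^ 2) by (apply pow_lt; lra); nra).
assert (B0 : 0 <= B) by (eapply Rle_trans; [apply Cmod_ge_0|apply (HB 0)]).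
assert (Bh : forall xi, kk <= Rabs xi -> Cmod (h xi) <= B * / (1 + c * (Rabs xi - kk)) ^ 2).
{ intros xi Hxi; unfold h; rewrite Cmod_mult; apply Rmult_le_compat; try apply Cmod_ge_0; [apply HB|].
  now apply plane_wave_decay. }
destruct (tail_right h kk c B Hc B0 Ch) as [l1 [L1 N1]].
{ intros xi Hxi; rewrite <- (Rabs_pos_eq xi) at 2 by lra; apply Bh; rewrite Rabs_pos_eq; lra. }
destruct (tail_left h kk c B Hc B0 Ch) as [l2 [L2 N2]].
{ intros xi Hxi; rewrite <- (Rabs_pos_eq xi) at 2 by lra; rewrite <- Rabs_Ropp.
  apply Bh; rewrite Rabs_Ropp, Rabs_pos_eq; lra. }
exists (plus (plus l2 (CInt h (- kk) kk)) l1); split.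
- apply (is_RInt_gen_Chasles (V := C_R_NormedModule) h kk); [|exact L1].
  apply (is_RInt_gen_Chasles (V := C_R_NormedModule) h (- kk)); [exact L2|].
  apply is_RInt_gen_at_point, CInt_correct, ex_CInt_cont; auto.
- match goal with |- Cmod ?z <= _ => replace z with (l1 + l2)%C
    by (generalize (CInt h (- kk) kk); intros p; change (@eq C (l1 + l2)%C (l2 + p + l1 - p)%C); ring) end.
  eapply Rle_trans; [apply Cmod_triangle|].
  replace (8 * B / (snd x ^ 2 * kk)) with (B / c + B / c) by (unfold c; field; lra); lra.
Qed.

Lemma plane_wave_integral_bound (m : medium) (a : wave) (x : point) (f : R -> C) (B : R) (l : C) :
  0 < k m a Plus -> 0 < snd x -> (forall xi, Ccont f xi) -> (forall xi, Cmod (f xi) <= B) ->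
  @is_RInt_gen C_R_NormedModule (fun xi => f xi * plane_wave m a x xi)%C
     (Rbar_locally m_infty) (Rbar_locally p_infty) l ->
  Cmod l <= B * (2 * k m a Plus + 8 / (snd x ^ 2 * k m a Plus)).
Proof.
intros Hk Hx Hf HB Hl; destruct (plane_wave_integral m a x f B Hk Hx Hf HB) as [l' [L' N]].
assert (E : l = l').
{ rewrite <- (is_RInt_gen_unique (V := C_R_CompleteNormedModule) _ _ Hl).
  exact (is_RInt_gen_unique (V := C_R_CompleteNormedModule) _ _ L'). }
subst l'; set (kk := k m a Plus) in *.
set (h := fun xi => (f xi * plane_wave m a x xi)%C) in *.
assert (A : Cmod (CInt h (- kk) kk) <= B * (kk - - kk)).
{ apply (is_CInt_norm_const h (- kk) kk); [lra| |].
  - intros xi _; unfold h, plane_wave; rewrite !Cmod_mult, Cmod_Cexp_i, Rmult_1_r.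
    rewrite <- (Rmult_1_r B); apply Rmult_le_compat; try apply Cmod_ge_0; [apply HB|].
    apply Cmod_Cexp_beta_le_1; lra.
  - apply CInt_correct, ex_CInt_cont; intros; apply Ccont_mult; [apply Hf|now apply Ccont_plane_wave]. }
replace l with ((l - CInt h (- kk) kk) + CInt h (- kk) kk)%C by (generalize (CInt h (- kk) kk); intros p; change (@eq C (l - p + p)%C l); ring).
eapply Rle_trans; [apply Cmod_triangle|].
replace (B * (2 * kk + 8 / (snd x ^ 2 * kk))) with (8 * B / (snd x ^ 2 * kk) + B * (kk - - kk)) by (field; lra).
lra.
Qed.

(** * Radiated field and far field *)

Definition bounded_continuous (f : R -> C) : Prop :=
  (forall xi, Ccont f xi) /\ exists B, forall xi, Cmod (f xi) <= B.

Definition radiated (m : medium) (a : wave) (x : point) (f : R -> C) : C :=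
  (RtoC (1 / (2 * PI)) *
   RInt_gen (V := C_R_CompleteNormedModule) (fun xi => f xi * plane_wave m a x xi)%C
     (Rbar_locally m_infty) (Rbar_locally p_infty))%C.

Definition far_field (m : medium) (a : wave) (theta : R) (f : R -> C) : C :=
  (Cexp (- Ci * RtoC (PI / 4)%R) * RtoC (sqrt (k m a Plus / (2 * PI)))
   * (RtoC (sin theta) * f (k m a Plus * cos theta)%R))%C.

Lemma stationary_constant (k r : R) : 0 < k -> 0 < r ->
  1 / (2 * PI) * k * 2 * (sqrt 2 / sqrt (k * r)) * (sqrt PI / 2) = sqrt (k / (2 * PI)) / sqrt r.
Proof.
intros Hk Hr; assert (P := PI_RGT_0).
rewrite sqrt_div_alt, !sqrt_mult by lra.
assert (S2 := sqrt_lt_R0 2 ltac:(lra)); assert (SP := sqrt_lt_R0 _ P);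
assert (Sk := sqrt_lt_R0 _ Hk); assert (Sr := sqrt_lt_R0 _ Hr).
assert (E2 := sqrt_sqrt 2 ltac:(lra)); assert (EP := sqrt_sqrt PI ltac:(lra)); assert (Ek := sqrt_sqrt k ltac:(lra)).
set (u := sqrt 2) in *; set (p := sqrt PI) in *; set (v := sqrt k) in *.
rewrite <- EP, <- Ek; field_simplify_eq; [|repeat split; lra].
simpl; nra.
Qed.

Lemma Rpower_quarter (x : R) : 1 <= x ->
  1 <= Rpower x (1 / 4) /\ Rpower x (1 / 4) ^ 4 = x /\ Rpower x (1 / 4) ^ 2 = sqrt x /\
  / Rpower x (1 / 4) ^ 3 = Rpower x (- (3 / 4)).
Proof.
intros Hx.
assert (P : 0 < Rpower x (1 / 4)) by (unfold Rpower; apply exp_pos).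
repeat split.
- rewrite <- (Rpower_O x) at 1 by lra; apply Rle_Rpower; lra.
- rewrite <- Rpower_pow by exact P; rewrite Rpower_mult.
  replace (1 / 4 * INR 4) with 1 by (simpl; field); apply Rpower_1; lra.
- rewrite <- Rpower_pow by exact P; rewrite Rpower_mult.
  replace (1 / 4 * INR 2) with (/ 2) by (simpl; field); apply Rpower_sqrt; lra.
- rewrite <- Rpower_pow by exact P; rewrite Rpower_mult, <- Rpower_Ropp; f_equal; simpl; field.
Qed.

Lemma radiated_unique (m : medium) (a : wave) (x : point) (f : R -> C) (l : C) :
  @is_RInt_gen C_R_NormedModule (fun xi => f xi * plane_wave m a x xi)%C
     (Rbar_locally m_infty) (Rbar_locally p_infty) l ->
  radiated m a x f = (RtoC (1 / (2 * PI)) * l)%C.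
Proof.
intros H; unfold radiated; f_equal.
exact (is_RInt_gen_unique (V := C_R_CompleteNormedModule) _ _ H).
Qed.

(** Evanescent frequencies contribute [O (1 / r^2)], and the propagating ones an
    integral over the half circle with large parameter [k r]. *)
Lemma radiation_asymptotics (m : medium) (a : wave) (theta : R) (f : R -> C) :
  0 < k m a Plus -> 0 < theta < PI -> bounded_continuous f ->
  tame (- k m a Plus) (k m a Plus) f ->
  exists M, forall r, Rmax 1 (/ k m a Plus) <= r ->
    Cmod (radiated m a (polar r theta) f
      - Cexp (Ci * RtoC (k m a Plus * r)%R) / RtoC (sqrt r) * far_field m a theta f)%C
    <= M * Rpower r (- (3 / 4)).
Proof.
intros Hk Hth [Hc [B HB]] Ht; set (kk := k m a Plus) in *.
destruct (circle_stationary_phase kk theta f Hk Hth Ht Hc) as [M HM].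
assert (PP := PI_RGT_0).
assert (Hs : 0 < sin theta) by (apply sin_gt_0; lra).
assert (B0 : 0 <= B) by (eapply Rle_trans; [apply Cmod_ge_0|apply (HB 0)]).
exists (1 / (2 * PI) * (kk * (M * Rpower kk (- (3 / 4))) + 8 * B / (sin theta ^ 2 * kk))); intros r Hr.
assert (Hr1 : 1 <= r) by (eapply Rle_trans; [apply Rmax_l|exact Hr]).
assert (Hr2 : 1 <= kk * r).
{ assert (Z : / kk <= r) by (eapply Rle_trans; [apply Rmax_r|exact Hr]).
  replace 1 with (kk * / kk) by (field; lra); apply Rmult_le_compat_l; lra. }
destruct (Rpower_quarter (kk * r) Hr2) as (T1 & T4 & T2 & T3).
set (t := Rpower (kk * r) (1 / 4)) in *.
specialize (HM t T1); rewrite T4, T2 in HM.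
assert (Hx2 : 0 < snd (polar r theta)) by (unfold polar; simpl; nra).
destruct (plane_wave_integral m a (polar r theta) f B Hk Hx2 Hc HB) as [l [L N]].
rewrite (radiated_unique _ _ _ _ _ L).
rewrite (propagating_integral m a r theta f Hk) in N
  by (intros; apply Ccont_mult; [apply Hc|now apply Ccont_plane_wave]).
fold kk in N.
set (J := CInt (fun phi => RtoC (sin phi) * f (kk * cos phi)%R * Cexp (Ci * RtoC (kk * r * cos (phi - theta))))%C 0 PI) in *.
set (Y := (RtoC (sin theta) * f (kk * cos theta)%R)%C) in *.
set (E := Cexp (Ci * RtoC (kk * r))%C) in *.
set (X := (E * RtoC (sqrt 2 / sqrt (kk * r)) * fresnel_limit)%C) in *.
assert (Sr := sqrt_lt_R0 r ltac:(lra)).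
assert (EQ : (E / RtoC (sqrt r) * far_field m a theta f)%C = (RtoC (1 / (2 * PI)) * (RtoC kk * (RtoC 2 * (Y * X))))%C).
{ unfold far_field, X, fresnel_limit; fold kk; fold Y.
  transitivity (RtoC (sqrt (kk / (2 * PI)) / sqrt r) * (E * Cexp (- Ci * RtoC (PI / 4)%R) * Y))%C.
  { rewrite (RtoC_div (sqrt (kk / (2 * PI))) (sqrt r)) by lra; field; apply RtoC_neq_0; lra. }
  rewrite <- stationary_constant by lra; rewrite !RtoC_mult; ring. }
rewrite EQ.
replace (RtoC (1 / (2 * PI)) * l - RtoC (1 / (2 * PI)) * (RtoC kk * (RtoC 2 * (Y * X))))%C with
  (RtoC (1 / (2 * PI)) * ((l - RtoC kk * J) + RtoC kk * (J - RtoC 2 * (Y * X))))%C by ring.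
assert (IP : 0 < 1 / (2 * PI)) by (apply Rdiv_lt_0_compat; lra).
rewrite Cmod_mult, Cmod_R, Rabs_pos_eq, Rmult_assoc by lra.
apply Rmult_le_compat_l; [lra|].
eapply Rle_trans; [apply Cmod_triangle|].
rewrite Cmod_mult, Cmod_R, Rabs_pos_eq by lra.
rewrite Rmult_plus_distr_r, Rplus_comm; apply Rplus_le_compat.
- rewrite Rmult_assoc; apply Rmult_le_compat_l; [lra|].
  eapply Rle_trans; [exact HM|]; unfold Rdiv at 1; rewrite T3, Rmult_assoc, Rpower_mult_distr by lra.
  apply Rle_refl.
- eapply Rle_trans; [exact N|]; unfold polar; simpl snd.
  assert (K2 : / r ^ 2 <= Rpower r (- (3 / 4))).
  { rewrite <- Rpower_pow, <- Rpower_Ropp by lra; apply Rle_Rpower; simpl; lra. }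
  replace (8 * B / ((r * sin theta) ^ 2 * kk)) with (8 * B / (sin theta ^ 2 * kk) * / r ^ 2) by (field; lra).
  apply Rmult_le_compat_l; [|exact K2].
  apply Rdiv_le_0_compat; [lra|]; apply Rmult_lt_0_compat; [apply pow_lt|]; lra.
Qed.

Lemma is_Cder_of_quadratic_remainder (f : R -> C) (x d M : R) (l : C) : 0 < d ->
  (forall t, Rabs (t - x) < d -> Cmod (f t - f x - RtoC (t - x) * l)%C <= M * (t - x) ^ 2) ->
  is_Cder f x l.
Proof.
intros Hd H; split; [apply (is_linear_scal_l (V := C_R_NormedModule))|].
intros y Hy eps; assert (Hx := is_filter_lim_locally_unique _ _ Hy); subst y.
assert (He := cond_pos eps).
set (M' := Rabs M + 1).
assert (HM' : 0 < M') by (assert (Z := Rabs_pos M); unfold M'; lra).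
assert (Q : 0 < Rmin d (eps / M')) by (apply Rmin_glb_lt; [exact Hd|now apply Rdiv_lt_0_compat]).
exists (mkposreal _ Q); intros t Ht.
assert (Ht' : Rabs (t - x) < Rmin d (eps / M')) by exact Ht.
assert (Z1 := Rmin_l d (eps / M')); assert (Z2 := Rmin_r d (eps / M')).
rewrite <- Cmod_norm, scal_R_Cmult.
change (Cmod (f t - f x - RtoC (t - x) * l)%C <= eps * Rabs (t - x)).
eapply Rle_trans; [apply H; lra|].
rewrite <- (pow2_abs (t - x)); simpl; rewrite Rmult_1_r, <- Rmult_assoc.
apply Rmult_le_compat_r; [apply Rabs_pos|].
apply Rle_trans with (M' * Rabs (t - x)).
- apply Rmult_le_compat_r; [apply Rabs_pos|]; assert (Z := Rle_abs M); unfold M'; lra.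
- replace (pos eps) with (M' * (eps / M')) by (field; lra); apply Rmult_le_compat_l; lra.
Qed.

(** The remainder is uniform in the frequency so that it can be integrated against
    the plane wave and also evaluated at the stationary point. *)
Definition uniform_derivative (F : R -> R -> C) (t0 : R) (F' : R -> C) : Prop :=
  exists d M, 0 < d /\ bounded_continuous F' /\
    forall t, Rabs (t - t0) < d -> bounded_continuous (F t) /\
      forall xi, Cmod (F t xi - F t0 xi - RtoC (t - t0) * F' xi)%C <= M * (t - t0) ^ 2.

(** A common property of the radiated field and the far field as functions of the
    amplitude.  Linearity is stated for the combination that occurs in the
    remainder of a difference quotient. *)
Definition bounded_functional (L : (R -> C) -> C) : Prop :=
  (forall f g f' h, bounded_continuous f -> bounded_continuous g -> bounded_continuous f' ->
    L (fun xi => f xi - g xi - RtoC h * f' xi)%C = (L f - L g - RtoC h * L f')%C) /\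
  exists N, 0 <= N /\ forall f B, (forall xi, Ccont f xi) -> (forall xi, Cmod (f xi) <= B) ->
    Cmod (L f) <= N * B.

Lemma bounded_functional_derive (L : (R -> C) -> C) (F : R -> R -> C) (t0 : R) (F' : R -> C) :
  bounded_functional L -> uniform_derivative F t0 F' -> is_Cder (fun t => L (F t)) t0 (L F').
Proof.
intros [Lin [N [HN Bd]]] (d & M & Hd & HF' & H).
apply is_Cder_of_quadratic_remainder with d (N * M); [exact Hd|].
intros t Ht; destruct (H t Ht) as [Ft R].
destruct (H t0) as [F0 _]; [rewrite Rminus_diag, Rabs_R0; exact Hd|].
rewrite <- Lin by assumption; rewrite Rmult_assoc; apply Bd; [|exact R].
destruct Ft as [C1 _], F0 as [C2 _], HF' as [C3 _].
intros xi; apply Ccont_minus; [apply Ccont_minus; auto|].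
apply Ccont_mult; [apply Ccont_const|auto].
Qed.

Lemma far_field_functional (m : medium) (a : wave) (theta : R) :
  bounded_functional (far_field m a theta).
Proof.
split.
- intros f g f' h _ _ _; unfold far_field; ring.
- exists (Cmod (Cexp (- Ci * RtoC (PI / 4)%R) * RtoC (sqrt (k m a Plus / (2 * PI))) * RtoC (sin theta))%C).
  split; [apply Cmod_ge_0|]; intros f B _ HB; unfold far_field.
  rewrite Cmult_assoc, Cmod_mult; apply Rmult_le_compat_l; [apply Cmod_ge_0|apply HB].
Qed.

Lemma radiated_functional (m : medium) (a : wave) (x : point) :
  0 < k m a Plus -> 0 < snd x -> bounded_functional (radiated m a x).
Proof.
intros Hk Hx; split.
- intros f g f' h [Cf [Bf HBf]] [Cg [Bg HBg]] [Cf' [Bf' HBf']].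
  destruct (plane_wave_integral m a x f Bf Hk Hx Cf HBf) as [l1 [L1 _]].
  destruct (plane_wave_integral m a x g Bg Hk Hx Cg HBg) as [l2 [L2 _]].
  destruct (plane_wave_integral m a x f' Bf' Hk Hx Cf' HBf') as [l3 [L3 _]].
  rewrite (radiated_unique _ _ _ _ _ L1), (radiated_unique _ _ _ _ _ L2), (radiated_unique _ _ _ _ _ L3).
  rewrite (radiated_unique _ _ _ _ (l1 - l2 - RtoC h * l3)%C); [ring|].
  assert (I := is_RInt_gen_minus (V := C_R_NormedModule) _ _ _ _
    (is_RInt_gen_minus (V := C_R_NormedModule) _ _ _ _ L1 L2)
    (is_RInt_gen_scal (V := C_R_NormedModule) _ h _ L3)).
  rewrite scal_R_Cmult in I.
  revert I; apply (is_RInt_gen_ext (V := C_R_NormedModule)).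
  apply filter_forall; intros ab u _; rewrite scal_R_Cmult.
  change (f u * plane_wave m a x u - g u * plane_wave m a x u - RtoC h * (f' u * plane_wave m a x u)
    = (f u - g u - RtoC h * f' u) * plane_wave m a x u)%C; ring.
- exists (1 / (2 * PI) * (2 * k m a Plus + 8 / (snd x ^ 2 * k m a Plus))).
  assert (PP := PI_RGT_0).
  assert (IP : 0 < 1 / (2 * PI)) by (apply Rdiv_lt_0_compat; lra).
  assert (Q : 0 < 8 / (snd x ^ 2 * k m a Plus)).
  { apply Rdiv_lt_0_compat; [lra|]; apply Rmult_lt_0_compat; [apply pow_lt|]; lra. }
  split; [apply Rmult_le_pos; lra|].
  intros f B Cf HB; destruct (plane_wave_integral m a x f B Hk Hx Cf HB) as [l [L _]].
  rewrite (radiated_unique _ _ _ _ _ L), Cmod_mult, Cmod_R, Rabs_pos_eq, Rmult_assoc by lra.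
  apply Rmult_le_compat_l; [lra|]; rewrite Rmult_comm.
  exact (plane_wave_integral_bound m a x f B l Hk Hx Cf HB L).
Qed.

(** * The coefficients as symbols *)

(** Polynomial growth is all that is needed at infinity, since a symbol only
    occurs multiplied by the exponential decay of a source off the interface. *)
Definition symbol (g : R -> C) : Prop :=
  (forall T, tame (- T) T g) /\
  exists B n, 0 <= B /\ forall xi, Cmod (g xi) <= B * (1 + Rabs xi) ^ n.

Lemma symbol_ext (f g : R -> C) : (forall xi, f xi = g xi) -> symbol f -> symbol g.
Proof.
intros E [T (B & n & HB & H)]; split.
- intros S; apply tame_ext with f; auto.
- exists B, n; split; [exact HB|]; intros xi; rewrite <- E; apply H.
Qed.

Lemma symbol_continuous (g : R -> C) (xi : R) : symbol g -> Ccont g xi.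
Proof.
intros [T _]; apply (tame_continuous (- (Rabs xi + 1)) (Rabs xi + 1)); [|apply T].
assert (Z := Rabs_maj2 xi); assert (Z' := Rle_abs xi); lra.
Qed.

Lemma pow_one_plus_abs_mono (xi : R) (n p : nat) : (n <= p)%nat ->
  (1 + Rabs xi) ^ n <= (1 + Rabs xi) ^ p.
Proof. intros H; apply Rle_pow; [assert (Z := Rabs_pos xi); lra|exact H]. Qed.

Lemma symbol_const (c : C) : symbol (fun _ => c).
Proof.
split; [intros; apply tame_const|].
exists (Cmod c), 0%nat; split; [apply Cmod_ge_0|intros; simpl; lra].
Qed.

Lemma symbol_plus (f g : R -> C) : symbol f -> symbol g -> symbol (fun xi => f xi + g xi)%C.
Proof.
intros [Tf (B & n & HB & H)] [Tg (B' & n' & HB' & H')]; split.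
{ intros; now apply tame_plus. }
exists (B + B'), (max n n'); split; [lra|]; intros xi.
assert (A := pow_one_plus_abs_mono xi n (max n n') ltac:(lia)).
assert (A' := pow_one_plus_abs_mono xi n' (max n n') ltac:(lia)).
eapply Rle_trans; [apply Cmod_triangle|].
specialize (H xi); specialize (H' xi); nra.
Qed.

Lemma symbol_mult (f g : R -> C) : symbol f -> symbol g -> symbol (fun xi => f xi * g xi)%C.
Proof.
intros [Tf (B & n & HB & H)] [Tg (B' & n' & HB' & H')]; split.
{ intros; now apply tame_mult. }
exists (B * B'), (n + n')%nat; split; [nra|]; intros xi.
rewrite Cmod_mult, pow_add.
replace (B * B' * ((1 + Rabs xi) ^ n * (1 + Rabs xi) ^ n')) with
  ((B * (1 + Rabs xi) ^ n) * (B' * (1 + Rabs xi) ^ n')) by ring.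
apply Rmult_le_compat; auto using Cmod_ge_0.
Qed.

Lemma symbol_opp (f : R -> C) : symbol f -> symbol (fun xi => - f xi)%C.
Proof.
intros H; apply symbol_ext with (fun xi => (- (1)) * f xi)%C; [intros; ring|].
apply symbol_mult; [apply symbol_const|exact H].
Qed.

Lemma symbol_inv (f : R -> C) (c : R) : 0 < c -> (forall xi, c <= Cmod (f xi)) ->
  symbol f -> symbol (fun xi => / f xi)%C.
Proof.
intros Hc Hf [T _]; split.
{ intros; apply tame_inv with c; auto. }
exists (/ c), 0%nat; split; [left; now apply Rinv_0_lt_compat|]; intros xi; simpl.
rewrite Cmod_inv by (apply Cmod_gt_0; specialize (Hf xi); lra).
rewrite Rmult_1_r; now apply Rinv_le_contravar.
Qed.

Lemma symbol_frequency : symbol RtoC.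
Proof.
split.
- intros T; apply (tame_lipschitz _ _ 1); [lra|]; intros.
  rewrite <- RtoC_minus, Cmod_R, Rabs_pos_eq by lra; lra.
- exists 1, 1%nat; split; [lra|]; intros xi; rewrite Cmod_R; simpl; lra.
Qed.

Lemma Cmod_beta_le (m : medium) (a : wave) (s : side) (xi : R) : 0 < k m a s ->
  Cmod (beta m a s xi) <= Rabs xi + k m a s.
Proof.
intros Hk; unfold beta; set (kk := k m a s) in *; assert (A := Rabs_pos xi).
assert (E : xi ^ 2 = Rabs xi ^ 2) by (symmetry; apply pow2_abs).
destruct (Rle_dec _ _).
- rewrite Cmod_R, Rabs_pos_eq by apply sqrt_pos.
  rewrite <- (sqrt_pow2 (Rabs xi + kk)) by lra; apply sqrt_le_1_alt; nra.
- rewrite Cmod_mult, Cmod_opp, Cmod_Ci, Cmod_R, Rabs_pos_eq, Rmult_1_l by apply sqrt_pos.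
  rewrite <- (sqrt_pow2 (Rabs xi + kk)) by lra; apply sqrt_le_1_alt; nra.
Qed.

Lemma symbol_beta (m : medium) (a : wave) (s : side) : 0 < k m a s -> symbol (beta m a s).
Proof.
intros Hk; split; [intros; now apply tame_beta|].
exists (1 + k m a s), 1%nat; split; [lra|]; intros xi.
eapply Rle_trans; [now apply Cmod_beta_le|].
assert (A := Rabs_pos xi); simpl; nra.
Qed.

Lemma Re_beta_ge (m : medium) (a : wave) (s : side) (xi : R) : 0 < k m a s ->
  Rabs xi - k m a s <= Re (beta m a s xi).
Proof.
intros Hk; assert (E : xi ^ 2 = Rabs xi ^ 2) by (symmetry; apply pow2_abs).
destruct (Rle_dec (k m a s) (Rabs xi)) as [H|H].
- rewrite beta_outside by exact H; unfold Re, RtoC, fst.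
  rewrite <- (sqrt_pow2 (Rabs xi - k m a s)) at 1 by lra; apply sqrt_le_1_alt; rewrite E; nra.
- destruct (beta_quadrant m a s xi); lra.
Qed.

Lemma uniform_lower_bound (g : R -> C) (T c : R) : (forall xi, Ccont g xi) ->
  (forall xi, g xi <> RtoC 0) -> 0 < c -> (forall xi, T <= Rabs xi -> c <= Cmod (g xi)) ->
  exists c', 0 < c' /\ forall xi, c' <= Cmod (g xi).
Proof.
intros Hc Hn Hc0 HT.
set (S := Rmax T 0); assert (S1 := Rmax_l T 0); assert (S2 := Rmax_r T 0); fold S in S1, S2.
destruct (continuity_ab_min (fun xi => Cmod (g xi)) (- S) S ltac:(lra)) as [x0 [Hx0 _]].
{ intros z _; apply continuity_pt_filterlim, Ccont_Cmod, Hc. }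
exists (Rmin c (Cmod (g x0))); split.
- apply Rmin_glb_lt; [exact Hc0|apply Cmod_gt_0, Hn].
- intros xi; destruct (Rle_dec T (Rabs xi)) as [H|H].
  + eapply Rle_trans; [apply Rmin_l|now apply HT].
  + eapply Rle_trans; [apply Rmin_r|apply Hx0].
    assert (Z := Rabs_maj2 xi); assert (Z' := Rle_abs xi); lra.
Qed.

Definition admissible (m : medium) : Prop :=
  0 < mu m /\ 0 < 2 * lambda m + 2 * mu m /\ (forall s, 0 < rho m s) /\
  rho m Plus <> rho m Minus /\ 0 < omega m.

Definition inverse_inertia (m : medium) (s : side) : R := / (omega m ^ 2 * rho m s).

Lemma modulus_pos (m : medium) (a : wave) : admissible m -> 0 < modulus m a.
Proof. intros (H1 & H2 & _); destruct a; simpl; lra. Qed.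

Lemma inverse_inertia_pos (m : medium) (s : side) : admissible m -> 0 < inverse_inertia m s.
Proof.
intros (_ & _ & H & _ & Hw); apply Rinv_0_lt_compat, Rmult_lt_0_compat; [apply pow_lt|]; auto.
Qed.

Lemma inverse_inertia_neq (m : medium) : admissible m -> inverse_inertia m Plus <> inverse_inertia m Minus.
Proof.
intros (_ & _ & H & Hn & Hw) E; apply Hn.
assert (P := H Plus); assert (Q := H Minus).
assert (W : 0 < omega m ^ 2) by (apply pow_lt, Hw).
apply (f_equal Rinv) in E; unfold inverse_inertia in E; rewrite !Rinv_inv in E.
apply Rmult_eq_reg_l in E; lra.
Qed.

Lemma k_pos (m : medium) (a : wave) (s : side) : admissible m -> 0 < k m a s.
Proof.
intros Hm; assert (P := modulus_pos m a Hm); destruct Hm as (_ & _ & H & _ & Hw).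
apply Rmult_lt_0_compat; [exact Hw|]; apply sqrt_lt_R0, Rdiv_lt_0_compat; auto.
Qed.

Lemma ik2_eq (m : medium) (a : wave) (s : side) : admissible m ->
  ik2 m a s = modulus m a * inverse_inertia m s.
Proof.
intros Hm; assert (P := modulus_pos m a Hm); destruct Hm as (_ & _ & H & _ & Hw).
specialize (H s); unfold ik2, k, inverse_inertia.
rewrite Rpow_mult_distr, pow2_sqrt by (left; now apply Rdiv_lt_0_compat).
field; repeat split; lra.
Qed.

Lemma ik2_pos (m : medium) (a : wave) (s : side) : admissible m -> 0 < ik2 m a s.
Proof.
intros Hm; rewrite ik2_eq by exact Hm.
apply Rmult_lt_0_compat; [now apply modulus_pos|now apply inverse_inertia_pos].
Qed.

Lemma k_sq (m : medium) (a : wave) (s : side) : admissible m -> k m a s ^ 2 = / ik2 m a s.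
Proof. intros _; unfold ik2; now rewrite Rinv_inv. Qed.

Lemma Lam_parts (m : medium) (a : wave) (xi : R) :
  Re (Lam m a xi) = ik2 m a Plus * Re (beta m a Plus xi) + ik2 m a Minus * Re (beta m a Minus xi) /\
  Im (Lam m a xi) = ik2 m a Plus * Im (beta m a Plus xi) + ik2 m a Minus * Im (beta m a Minus xi).
Proof. unfold Lam; simpl; unfold Re, Im; split; ring. Qed.

Lemma Lam_quadrant (m : medium) (a : wave) (xi : R) : admissible m ->
  0 <= Re (Lam m a xi) /\ Im (Lam m a xi) <= 0.
Proof.
intros Hm; destruct (Lam_parts m a xi) as [-> ->].
assert (P := ik2_pos m a Plus Hm); assert (Q := ik2_pos m a Minus Hm).
destruct (beta_quadrant m a Plus xi); destruct (beta_quadrant m a Minus xi); split; nra.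
Qed.

Lemma beta_zero (m : medium) (a : wave) (s : side) (xi : R) : 0 < k m a s ->
  Re (beta m a s xi) = 0 -> Im (beta m a s xi) = 0 -> xi ^ 2 = k m a s ^ 2.
Proof.
intros Hk; unfold beta; assert (E : xi ^ 2 = Rabs xi ^ 2) by (symmetry; apply pow2_abs).
assert (A := Rabs_pos xi).
destruct (Rle_dec (k m a s) (Rabs xi)) as [H|H].
- unfold Re, RtoC, fst; intros R _; apply sqrt_eq_0 in R; [lra|rewrite E; nra].
- intros _ I; exfalso.
  assert (Q : 0 < sqrt (k m a s ^ 2 - xi ^ 2)) by (apply sqrt_lt_R0; rewrite E; nra).
  revert I; unfold Im, RtoC, Ci, Cmult, Copp, fst, snd; lra.
Qed.

Lemma beta_inside_neg (m : medium) (a : wave) (s : side) (xi : R) :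
  Rabs xi < k m a s -> Im (beta m a s xi) < 0.
Proof.
intros Hk; unfold beta; assert (E : xi ^ 2 = Rabs xi ^ 2) by (symmetry; apply pow2_abs).
assert (A := Rabs_pos xi).
destruct (Rle_dec (k m a s) (Rabs xi)) as [H|H]; [lra|].
assert (Q : 0 < sqrt (k m a s ^ 2 - xi ^ 2)) by (apply sqrt_lt_R0; rewrite E; nra).
unfold Im, RtoC, Ci, Cmult, Copp, fst, snd; lra.
Qed.

Lemma k_sq_neq (m : medium) (a : wave) : admissible m -> k m a Plus ^ 2 <> k m a Minus ^ 2.
Proof.
intros Hm E; rewrite !k_sq, !ik2_eq in E by exact Hm.
assert (P := modulus_pos m a Hm); assert (I1 := inverse_inertia_pos m Plus Hm); assert (I2 := inverse_inertia_pos m Minus Hm).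
apply (f_equal Rinv) in E; rewrite !Rinv_inv in E.
apply Rmult_eq_reg_l in E; [|lra]; exact (inverse_inertia_neq m Hm E).
Qed.

(** Both terms lie in the fourth quadrant, so they can only cancel by vanishing
    together, which the distinct wave numbers exclude. *)
Lemma Lam_neq_0 (m : medium) (a : wave) (xi : R) : admissible m -> Lam m a xi <> RtoC 0.
Proof.
intros Hm E; destruct (Lam_parts m a xi) as [R I]; rewrite E in R, I.
unfold Re at 1 in R; unfold Im at 1 in I; simpl fst in R; simpl snd in I.
assert (P := ik2_pos m a Plus Hm); assert (Q := ik2_pos m a Minus Hm).
destruct (beta_quadrant m a Plus xi); destruct (beta_quadrant m a Minus xi).
apply (k_sq_neq m a Hm).
rewrite <- (beta_zero m a Plus xi), <- (beta_zero m a Minus xi); try nra; now apply k_pos.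
Qed.

(** Beyond all wave numbers the dispersion terms are real, and the lighter side
    alone already dominates: with [u] the larger and [v] the smaller inverse inertia,
    [Lam >= modulus * sqrt (u (u - v)) * |xi|], against
    [|delta| = modulus * (u - v)]. *)
Lemma Lam_large (m : medium) (a : wave) (s1 s0 : side) (xi : R) : admissible m ->
  (s1 = Plus /\ s0 = Minus \/ s1 = Minus /\ s0 = Plus) ->
  inverse_inertia m s0 < inverse_inertia m s1 -> k m a Plus <= Rabs xi -> k m a Minus <= Rabs xi ->
  exists L : R, Lam m a xi = RtoC L /\
   modulus m a * sqrt (inverse_inertia m s1 * (inverse_inertia m s1 - inverse_inertia m s0)) * Rabs xi <= L.
Proof.
intros Hm Hs Hlt HP HM.
assert (P := modulus_pos m a Hm); assert (I0 := inverse_inertia_pos m s0 Hm).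
exists (ik2 m a Plus * sqrt (xi ^ 2 - k m a Plus ^ 2) + ik2 m a Minus * sqrt (xi ^ 2 - k m a Minus ^ 2)).
split.
{ unfold Lam; rewrite !beta_outside by assumption; now rewrite RtoC_plus, !RtoC_mult. }
assert (E : xi ^ 2 = Rabs xi ^ 2) by (symmetry; apply pow2_abs).
assert (Main : modulus m a * sqrt (inverse_inertia m s1 * (inverse_inertia m s1 - inverse_inertia m s0)) * Rabs xi
   <= ik2 m a s1 * sqrt (xi ^ 2 - k m a s1 ^ 2)).
{ assert (H0 : k m a s0 <= Rabs xi) by (destruct Hs as [[_ ->]|[_ ->]]; assumption).
  assert (K0 := k_pos m a s0 Hm).
  assert (X0 : k m a s0 ^ 2 <= xi ^ 2) by (rewrite E; apply pow_incr; lra).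
  rewrite k_sq, ik2_eq in X0 by exact Hm; rewrite k_sq, ik2_eq by exact Hm.
  set (M := modulus m a) in *; set (u := inverse_inertia m s1) in *; set (v := inverse_inertia m s0) in *.
  assert (W : 1 <= M * v * xi ^ 2).
  { replace 1 with (M * v * / (M * v)) by (field; lra).
    apply Rmult_le_compat_l; [left; apply Rmult_lt_0_compat; lra|exact X0]. }
  rewrite !Rmult_assoc; apply Rmult_le_compat_l; [lra|].
  rewrite <- (sqrt_pow2 (Rabs xi)) by apply Rabs_pos; rewrite <- E.
  rewrite <- sqrt_mult_alt by (apply Rmult_le_pos; lra).
  rewrite <- (sqrt_pow2 u) at 3 by lra; rewrite <- sqrt_mult_alt by apply pow2_ge_0.
  apply sqrt_le_1_alt.
  replace (u ^ 2 * (xi ^ 2 - / (M * u))) with (u * (u * xi ^ 2 - / M)) by (field; lra).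
  rewrite Rmult_assoc; apply Rmult_le_compat_l; [lra|].
  enough (/ M <= v * xi ^ 2) by lra.
  apply Rmult_le_reg_l with M; [exact P|]; rewrite Rinv_r by lra; lra. }
assert (Z1 := Rmult_le_pos _ _ (Rlt_le _ _ (ik2_pos m a Plus Hm)) (sqrt_pos (xi ^ 2 - k m a Plus ^ 2))).
assert (Z2 := Rmult_le_pos _ _ (Rlt_le _ _ (ik2_pos m a Minus Hm)) (sqrt_pos (xi ^ 2 - k m a Minus ^ 2))).
destruct Hs as [[-> ->]|[-> ->]]; lra.
Qed.

Lemma inverse_inertia_order (m : medium) : admissible m ->
  exists s1 s0, (s1 = Plus /\ s0 = Minus \/ s1 = Minus /\ s0 = Plus) /\ inverse_inertia m s0 < inverse_inertia m s1.
Proof.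
intros Hm; destruct (Rtotal_order (inverse_inertia m Plus) (inverse_inertia m Minus)) as [H|[H|H]].
- exists Minus, Plus; auto.
- now destruct (inverse_inertia_neq m Hm).
- exists Plus, Minus; auto.
Qed.

Lemma Lam_lower_bound (m : medium) (a : wave) : admissible m ->
  exists c, 0 < c /\ forall xi, c <= Cmod (Lam m a xi).
Proof.
intros Hm; destruct (inverse_inertia_order m Hm) as (s1 & s0 & Hs & Hlt).
assert (KP := k_pos m a Plus Hm); assert (KM := k_pos m a Minus Hm).
assert (P := modulus_pos m a Hm); assert (I0 := inverse_inertia_pos m s0 Hm).
assert (Sq : 0 < sqrt (inverse_inertia m s1 * (inverse_inertia m s1 - inverse_inertia m s0)))
  by (apply sqrt_lt_R0, Rmult_lt_0_compat; lra).
apply (uniform_lower_bound _ (k m a Plus + k m a Minus)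
  (modulus m a * sqrt (inverse_inertia m s1 * (inverse_inertia m s1 - inverse_inertia m s0)) * k m a Plus)).
- intros xi; unfold Lam; apply Ccont_plus; apply Ccont_mult;
  auto using Ccont_const, Ccont_beta.
- intros xi; now apply Lam_neq_0.
- apply Rmult_lt_0_compat; [apply Rmult_lt_0_compat|]; assumption.
- intros xi Hxi; destruct (Lam_large m a s1 s0 xi Hm Hs Hlt ltac:(lra) ltac:(lra)) as (L & -> & HL).
  rewrite Cmod_R; eapply Rle_trans; [|apply Rle_abs]; eapply Rle_trans; [|exact HL].
  apply Rmult_le_compat_l; [left; apply Rmult_lt_0_compat; lra|lra].
Qed.

Lemma delta_eq (m : medium) (a : wave) : admissible m ->
  delta m a = modulus m a * (inverse_inertia m Plus - inverse_inertia m Minus).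
Proof. intros Hm; unfold delta; rewrite !ik2_eq by exact Hm; ring. Qed.

(** Twice [Lam_large] gives the product [u (u - v) xi^2] up to the moduli, which
    exceeds the competing term [(u - v)^2 xi^2] by [v (u - v) xi^2]. *)
Lemma D_large (m : medium) (xi : R) : admissible m ->
  (forall a s, k m a s <= Rabs xi) ->
  exists s1 s0, inverse_inertia m s0 < inverse_inertia m s1 /\
   modulus m Wp * modulus m Ws * inverse_inertia m s0 * (inverse_inertia m s1 - inverse_inertia m s0) * xi ^ 2 <= Cmod (D m xi).
Proof.
intros Hm Hk; destruct (inverse_inertia_order m Hm) as (s1 & s0 & Hs & Hlt); exists s1, s0; split; [exact Hlt|].
destruct (Lam_large m Wp s1 s0 xi Hm Hs Hlt (Hk _ _) (Hk _ _)) as (Lp & Ep & Bp).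
destruct (Lam_large m Ws s1 s0 xi Hm Hs Hlt (Hk _ _) (Hk _ _)) as (Ls & Es & Bs).
assert (Pp := modulus_pos m Wp Hm); assert (Ps := modulus_pos m Ws Hm); assert (I0 := inverse_inertia_pos m s0 Hm).
unfold D; rewrite Ep, Es, <- RtoC_mult, <- RtoC_opp, <- RtoC_plus, Cmod_R.
assert (Ed : delta m Wp * delta m Ws * xi ^ 2 = modulus m Wp * modulus m Ws * (inverse_inertia m s1 - inverse_inertia m s0) ^ 2 * xi ^ 2).
{ rewrite !delta_eq by exact Hm; destruct Hs as [[-> ->]|[-> ->]]; ring. }
rewrite Ed; rewrite <- Rabs_Ropp; eapply Rle_trans; [|apply Rle_abs].
set (u := inverse_inertia m s1) in *; set (v := inverse_inertia m s0) in *.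
assert (Sq := sqrt_sqrt (u * (u - v)) ltac:(apply Rmult_le_pos; lra)).
assert (S0 := sqrt_pos (u * (u - v))); set (q := sqrt (u * (u - v))) in *.
assert (A := Rabs_pos xi); rewrite <- (pow2_abs xi); set (x := Rabs xi) in *.
set (Mp := modulus m Wp) in *; set (Ms := modulus m Ws) in *.
assert (B : (Mp * q * x) * (Ms * q * x) <= Lp * Ls).
{ apply Rmult_le_compat; auto; repeat apply Rmult_le_pos; lra. }
replace ((Mp * q * x) * (Ms * q * x)) with (Mp * Ms * (q * q) * x ^ 2) in B by ring.
rewrite Sq in B.
replace (Mp * Ms * v * (u - v) * x ^ 2) with (Mp * Ms * (u * (u - v)) * x ^ 2 - Mp * Ms * (u - v) ^ 2 * x ^ 2) by ring.
lra.
Qed.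

(** No interface wave is bound to a density jump alone.  Below some wave number
    one factor of the product [Lam Wp * Lam Ws] leaves the real axis; as both
    lie in the closed fourth quadrant, the product can then only be real and
    nonnegative, as [delta Wp * delta Ws * xi^2] is, if the other factor vanishes.
    Above all wave numbers [D_large] applies. *)
Lemma D_neq_0 (m : medium) (xi : R) : admissible m -> D m xi <> RtoC 0.
Proof.
intros Hm E.
assert (Pp := modulus_pos m Wp Hm); assert (Ps := modulus_pos m Ws Hm).
destruct (Lam_quadrant m Wp xi Hm) as [A1 A2]; destruct (Lam_quadrant m Ws xi Hm) as [B1 B2].
assert (Dd : 0 <= delta m Wp * delta m Ws * xi ^ 2).
{ rewrite !delta_eq by exact Hm; apply Rmult_le_pos; [|apply pow2_ge_0].
  replace (modulus m Wp * (inverse_inertia m Plus - inverse_inertia m Minus) * (modulus m Ws * (inverse_inertia m Plus - inverse_inertia m Minus)))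
   with (modulus m Wp * modulus m Ws * (inverse_inertia m Plus - inverse_inertia m Minus) ^ 2) by ring.
  apply Rmult_le_pos; [left; now apply Rmult_lt_0_compat|apply pow2_ge_0]. }
assert (NP := Lam_neq_0 m Wp xi Hm); assert (NS := Lam_neq_0 m Ws xi Hm).
assert (Zero : forall z : C, Re z = 0 -> Im z = 0 -> z = RtoC 0)
  by (intros z R I; apply injective_projections; assumption).
assert (ER : Re (Lam m Wp xi) * Re (Lam m Ws xi) - Im (Lam m Wp xi) * Im (Lam m Ws xi) = delta m Wp * delta m Ws * xi ^ 2
  /\ Re (Lam m Wp xi) * Im (Lam m Ws xi) + Im (Lam m Wp xi) * Re (Lam m Ws xi) = 0).
{ unfold D in E; generalize dependent (delta m Wp * delta m Ws * xi ^ 2); intros d E _.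
  destruct (Lam m Wp xi) as [p1 p2], (Lam m Ws xi) as [q1 q2].
  apply (f_equal Re) in E as R; apply (f_equal Im) in E as I; unfold Re, Im in *; simpl in *; split; lra. }
destruct ER as [ER EI].
assert (Neg : forall a s, Rabs xi < k m a s -> Im (Lam m a xi) < 0).
{ intros a s H; apply beta_inside_neg in H; destruct (Lam_parts m a xi) as [_ ->].
  assert (P := ik2_pos m a Plus Hm); assert (Q := ik2_pos m a Minus Hm).
  destruct (beta_quadrant m a Plus xi); destruct (beta_quadrant m a Minus xi); destruct s; nra. }
assert (Cross : ~ Im (Lam m Wp xi) < 0 /\ ~ Im (Lam m Ws xi) < 0).
{ assert (Q : forall p1 p2 q1 q2 d : R, 0 <= p1 -> 0 <= q1 -> p2 < 0 -> q2 <= 0 -> 0 <= d ->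
    p1 * q1 - p2 * q2 = d -> p1 * q2 + p2 * q1 = 0 -> q1 = 0 /\ q2 = 0).
  { intros p1 p2 q1 q2 d Z1 Z2 Z3 Z4 Z5 Z6 Z7.
    assert (Y1 := Rmult_le_pos p1 (- q2) Z1 ltac:(lra)).
    assert (Y2 := Rmult_le_pos (- p2) q1 ltac:(lra) Z2).
    assert (Y3 := Rmult_le_pos (- p2) (- q2) ltac:(lra) ltac:(lra)).
    assert (q1 = 0) by (destruct (Rmult_integral p2 q1); lra); subst q1; split; [reflexivity|].
    destruct (Rmult_integral p2 q2); lra. }
  split; intros L.
  - destruct (Q _ _ _ _ _ A1 B1 L B2 Dd ER EI); auto.
  - destruct (Q (Re (Lam m Ws xi)) (Im (Lam m Ws xi)) (Re (Lam m Wp xi)) (Im (Lam m Wp xi)) _ B1 A1 L A2 Dd); auto; lra. }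
assert (All : forall a s, k m a s <= Rabs xi).
{ intros a s; apply Rnot_lt_le; intros L; apply Neg in L; destruct a; tauto. }
destruct (D_large m xi Hm All) as (s1 & s0 & Hlt & B).
rewrite E, Cmod_0 in B; assert (I0 := inverse_inertia_pos m s0 Hm); assert (K := k_pos m Wp Plus Hm).
assert (X : 0 < xi ^ 2).
{ rewrite <- pow2_abs; apply pow_lt; specialize (All Wp Plus); lra. }
assert (0 < modulus m Wp * modulus m Ws * inverse_inertia m s0 * (inverse_inertia m s1 - inverse_inertia m s0) * xi ^ 2)
  by (apply Rmult_lt_0_compat; [|exact X]; repeat apply Rmult_lt_0_compat; lra).
lra.
Qed.

Lemma symbol_Lam (m : medium) (a : wave) : admissible m -> symbol (Lam m a).
Proof.
intros Hm; unfold Lam; apply symbol_plus; apply symbol_mult;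
auto using symbol_const, symbol_beta, k_pos.
Qed.

Lemma symbol_square : symbol (fun xi => RtoC (xi ^ 2)).
Proof.
apply symbol_ext with (fun xi => RtoC xi * RtoC xi)%C.
- intros xi; rewrite <- RtoC_mult; f_equal; ring.
- apply symbol_mult; apply symbol_frequency.
Qed.

Lemma symbol_D (m : medium) : admissible m -> symbol (D m).
Proof.
intros Hm; unfold D; apply symbol_plus.
- apply symbol_opp, symbol_mult; now apply symbol_Lam.
- apply symbol_ext with (fun xi => RtoC (delta m Wp * delta m Ws) * RtoC (xi ^ 2))%C.
  + intros xi; now rewrite <- RtoC_mult.
  + apply symbol_mult; [apply symbol_const|apply symbol_square].
Qed.

Lemma D_lower_bound (m : medium) : admissible m ->
  exists c, 0 < c /\ forall xi, c <= Cmod (D m xi).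
Proof.
intros Hm.
assert (K := fun a s => k_pos m a s Hm).
set (T := k m Wp Plus + k m Wp Minus + k m Ws Plus + k m Ws Minus).
assert (HT : 0 < T) by (unfold T; assert (Z1 := K Wp Plus); assert (Z2 := K Wp Minus); assert (Z3 := K Ws Plus); assert (Z4 := K Ws Minus); lra).
assert (Pp := modulus_pos m Wp Hm); assert (Ps := modulus_pos m Ws Hm).
assert (J := fun s => inverse_inertia_pos m s Hm).
set (v := Rmin (inverse_inertia m Plus) (inverse_inertia m Minus)).
assert (Hv : 0 < v) by (apply Rmin_glb_lt; apply J).
assert (Hd : 0 < Rabs (inverse_inertia m Plus - inverse_inertia m Minus)).
{ apply Rabs_pos_lt; assert (Z := inverse_inertia_neq m Hm); lra. }
apply (uniform_lower_bound _ T (modulus m Wp * modulus m Ws * v * Rabs (inverse_inertia m Plus - inverse_inertia m Minus) * T ^ 2)).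
- intros xi; apply symbol_continuous, symbol_D, Hm.
- intros xi; now apply D_neq_0.
- repeat apply Rmult_lt_0_compat; try assumption; lra.
- intros xi Hxi.
  destruct (D_large m xi Hm) as (s1 & s0 & Hlt & B).
  { intros a s; unfold T in Hxi.
    assert (Z1 := K Wp Plus); assert (Z2 := K Wp Minus); assert (Z3 := K Ws Plus); assert (Z4 := K Ws Minus).
    destruct a, s; lra. }
  eapply Rle_trans; [|exact B].
  rewrite <- (pow2_abs xi); apply Rmult_le_compat; [|apply pow2_ge_0| |apply pow_incr; lra].
  { repeat apply Rmult_le_pos; lra. }
  apply Rmult_le_compat; [repeat apply Rmult_le_pos; lra|lra| |].
  + apply Rmult_le_compat_l; [left; now apply Rmult_lt_0_compat|].
    destruct s0; [apply Rmin_l|apply Rmin_r].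
  + destruct s0, s1; try (exfalso; lra); [rewrite Rabs_left|rewrite Rabs_pos_eq]; lra.
Qed.

Lemma symbol_inv_Lam (m : medium) (a : wave) : admissible m -> symbol (fun xi => / Lam m a xi)%C.
Proof.
intros Hm; destruct (Lam_lower_bound m a Hm) as (c & Hc & H).
now apply symbol_inv with c; [| |apply symbol_Lam].
Qed.

Lemma symbol_inv_D (m : medium) : admissible m -> symbol (fun xi => / D m xi)%C.
Proof.
intros Hm; destruct (D_lower_bound m Hm) as (c & Hc & H).
now apply symbol_inv with c; [| |apply symbol_D].
Qed.

Definition orientation (s : side) : R := match s with Plus => 1 | Minus => -1 end.

(** This is [exp (- beta |y2|)] when the source lies on side [s]. *)
Definition source_decay (m : medium) (b : wave) (s : side) (y2 xi : R) : C :=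
  Cexp (- (RtoC (orientation s) * beta m b s xi * RtoC y2))%C.

Definition coef (m : medium) (s : side) (a : wave) (j : axis) (xi y2 : R) : C :=
  match s with Plus => coefA m a j xi y2 | Minus => coefB m a j xi y2 end.

(** The signs in which the two families of coefficients differ are those of
    [orientation]. *)
Lemma coef_symbols (m : medium) (s : side) (a : wave) (j : axis) : admissible m ->
  exists gp gs, symbol gp /\ symbol gs /\ forall xi y2,
    coef m s a j xi y2 =
      (gp xi * source_decay m Wp s y2 xi + gs xi * source_decay m Ws s y2 xi)%C.
Proof.
intros Hm.
assert (SB : forall b, symbol (beta m b s)) by (intros; apply symbol_beta, k_pos, Hm).
assert (SD := symbol_inv_D m Hm); assert (SL := fun b => symbol_inv_Lam m b Hm).
assert (SX := symbol_frequency); assert (SX2 := symbol_square).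
assert (SC := symbol_const).
assert (EP : forall b y2 xi, Cexp (- beta m b Plus xi * RtoC y2) = source_decay m b Plus y2 xi).
{ intros; unfold source_decay, orientation; f_equal; ring. }
assert (EM : forall b y2 xi, Cexp (beta m b Minus xi * RtoC y2) = source_decay m b Minus y2 xi).
{ intros; unfold source_decay, orientation; f_equal.
  assert (Om : RtoC (-1) = (- (1))%C) by (rewrite <- RtoC_opp; f_equal; ring).
  rewrite Om; ring. }
assert (Om : RtoC (-1) = (- (1))%C) by (rewrite <- RtoC_opp; f_equal; ring).
set (q := fun xi : R => (RtoC (C0 m) * RtoC xi * / D m xi)%C).
assert (Sq : symbol q) by (unfold q; auto using symbol_mult).
set (kp := RtoC (ik2 m Wp s)); set (ks := RtoC (ik2 m Ws s)).
set (dp := RtoC (delta m Wp)); set (ds := RtoC (delta m Ws)).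
set (o := RtoC (orientation s)).
destruct a, j.
- exists (fun xi => - (q xi * Ci * (ds * kp * RtoC (xi ^ 2)%R * / Lam m Wp xi)))%C,
         (fun xi => o * (q xi * Ci * (ks * beta m Ws s xi)))%C.
  split; [auto 12 using symbol_mult, symbol_opp|]; split; [auto 12 using symbol_mult, symbol_opp|].
  intros xi y2; unfold q, o; destruct s; simpl; rewrite ?EP, ?EM, ?Om; unfold Cdiv, kp, ks, dp, ds; ring.
- exists (fun xi => - o * (q xi * (ds * kp * beta m Wp s xi * RtoC xi * / Lam m Wp xi)))%C,
         (fun xi => q xi * (ks * RtoC xi))%C.
  split; [auto 12 using symbol_mult, symbol_opp|]; split; [auto 12 using symbol_mult, symbol_opp|].
  intros xi y2; unfold q, o; destruct s; simpl; rewrite ?EP, ?EM, ?Om; unfold Cdiv, kp, ks, dp, ds; ring.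
- exists (fun xi => q xi * (kp * RtoC xi))%C,
         (fun xi => - o * (q xi * (dp * ks * beta m Ws s xi * RtoC xi * / Lam m Ws xi)))%C.
  split; [auto 12 using symbol_mult, symbol_opp|]; split; [auto 12 using symbol_mult, symbol_opp|].
  intros xi y2; unfold q, o; destruct s; simpl; rewrite ?EP, ?EM, ?Om; unfold Cdiv, kp, ks, dp, ds; ring.
- exists (fun xi => - o * (q xi * Ci * (kp * beta m Wp s xi)))%C,
         (fun xi => q xi * Ci * (dp * ks * RtoC (xi ^ 2)%R * / Lam m Ws xi))%C.
  split; [auto 12 using symbol_mult, symbol_opp|]; split; [auto 12 using symbol_mult, symbol_opp|].
  intros xi y2; unfold q, o; destruct s; simpl; rewrite ?EP, ?EM, ?Om; unfold Cdiv, kp, ks, dp, ds; ring.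
Qed.

(** * Dependence on the source point *)

Lemma pow_le_exp (n : nat) (tau : R) : 0 < tau ->
  exists A, 0 <= A /\ forall x, 0 <= x -> (1 + x) ^ n <= A * exp (tau * x).
Proof.
revert tau; induction n as [|n IH]; intros tau Ht.
- exists 1; split; [lra|]; intros x Hx; simpl.
  assert (exp 0 <= exp (tau * x)) by (apply exp_le; nra); rewrite exp_0 in *; lra.
- destruct (IH (tau / 2) ltac:(lra)) as (A & HA & H).
  assert (It : 0 < 2 / tau) by (apply Rdiv_lt_0_compat; lra).
  exists (A * (1 + 2 / tau)); split; [apply Rmult_le_pos; lra|].
  intros x Hx; specialize (H x Hx).
  assert (E : exp (tau * x) = exp (tau / 2 * x) * exp (tau / 2 * x)) by (rewrite <- exp_plus; f_equal; field).
  assert (L : 1 + x <= (1 + 2 / tau) * exp (tau / 2 * x)).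
  { assert (Z : 1 + tau / 2 * x <= exp (tau / 2 * x)).
    { destruct (Req_dec (tau / 2 * x) 0) as [Q|Q]; [rewrite Q, exp_0; lra|left; now apply exp_ineq1]. }
    apply Rle_trans with ((1 + 2 / tau) * (1 + tau / 2 * x)); [|apply Rmult_le_compat_l; lra].
    replace ((1 + 2 / tau) * (1 + tau / 2 * x)) with (1 + x + 2 / tau + tau / 2 * x) by (field; lra).
    assert (0 <= tau / 2 * x) by (apply Rmult_le_pos; lra); lra. }
  rewrite E; simpl.
  replace (A * (1 + 2 / tau) * (exp (tau / 2 * x) * exp (tau / 2 * x))) with
    (((1 + 2 / tau) * exp (tau / 2 * x)) * (A * exp (tau / 2 * x))) by ring.
  apply Rmult_le_compat; [lra|apply pow_le; lra|exact L|exact H].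
Qed.

Lemma symbol_le_exp (g : R -> C) (tau : R) : symbol g -> 0 < tau ->
  exists A, 0 <= A /\ forall xi, Cmod (g xi) <= A * exp (tau * Rabs xi).
Proof.
intros [_ (B & n & HB & H)] Ht; destruct (pow_le_exp n tau Ht) as (A & HA & HE).
exists (B * A); split; [nra|]; intros xi; eapply Rle_trans; [apply H|].
rewrite Rmult_assoc; apply Rmult_le_compat_l; [exact HB|apply HE, Rabs_pos].
Qed.

(** Amplitudes which depend on the parameter through an exponential whose
    exponent is affine in it; half of the decay of [exp w] absorbs the growth of
    [g] and [z], the other half that of [exp (h z)]. *)
Lemma exponential_family (g w z : R -> C) (t0 kappa tau A : R) :
  symbol g -> symbol z -> (forall T, tame (- T) T w) -> 0 < tau ->
  (forall xi, Cmod (z xi) <= Rabs xi + kappa) ->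
  (forall xi, Cmod (Cexp (w xi)) <= A * exp (- (2 * tau) * Rabs xi)) ->
  uniform_derivative (fun t xi => g xi * Cexp (w xi + RtoC (t - t0) * z xi))%C t0
    (fun xi => g xi * z xi * Cexp (w xi))%C.
Proof.
intros Hg Hz Hw Ht Bz Bw.
assert (A0 : 0 <= A).
{ specialize (Bw 0); assert (Z := Cmod_ge_0 (Cexp (w 0))).
  assert (P := exp_pos (- (2 * tau) * Rabs 0)); nra. }
assert (Cw : forall xi, Ccont w xi).
{ intros xi; apply (tame_continuous (- (Rabs xi + 1)) (Rabs xi + 1)); [|apply Hw].
  assert (Z := Rabs_maj2 xi); assert (Z' := Rle_abs xi); lra. }
assert (Split : forall f B xi, (forall xi, Cmod (f xi) <= B * exp (tau * Rabs xi)) -> 0 <= B -> 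
  Cmod (f xi) * Cmod (Cexp (w xi)) * exp (tau * (Rabs xi + kappa)) <= B * A * exp (tau * kappa)).
{ intros f B xi Hf HB.
  apply Rle_trans with (B * exp (tau * Rabs xi) * (A * exp (- (2 * tau) * Rabs xi)) * exp (tau * (Rabs xi + kappa))).
  - apply Rmult_le_compat_r; [left; apply exp_pos|].
    apply Rmult_le_compat; auto using Cmod_ge_0.
  - right.
    replace (B * exp (tau * Rabs xi) * (A * exp (- (2 * tau) * Rabs xi)) * exp (tau * (Rabs xi + kappa))) with
      (B * A * (exp (tau * Rabs xi) * exp (- (2 * tau) * Rabs xi) * exp (tau * (Rabs xi + kappa)))) by ring.
    rewrite <- !exp_plus; f_equal; f_equal; ring. }
assert (Bexp : forall h xi, Rabs h < tau -> exp (Rabs h * Cmod (z xi)) <= exp (tau * (Rabs xi + kappa))).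
{ intros h xi Hh; apply exp_le.
  apply Rle_trans with (tau * Cmod (z xi)); [apply Rmult_le_compat_r; [apply Cmod_ge_0|lra]|].
  apply Rmult_le_compat_l; [lra|apply Bz]. }
destruct (symbol_le_exp g tau Hg Ht) as (B0 & P0 & H0).
destruct (symbol_le_exp (fun xi => g xi * z xi)%C tau (symbol_mult _ _ Hg Hz) Ht) as (B1 & P1 & H1).
destruct (symbol_le_exp (fun xi => g xi * (z xi * z xi))%C tau (symbol_mult _ _ Hg (symbol_mult _ _ Hz Hz)) Ht) as (B2 & P2 & H2).
exists tau, (B2 * A * exp (tau * kappa)); split; [exact Ht|]; split; [split|].
- intros xi; apply Ccont_mult; [|apply Ccont_Cexp, Cw].
  apply Ccont_mult; now apply symbol_continuous.
- exists (B1 * A * exp (tau * kappa)); intros xi; rewrite Cmod_mult.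
  eapply Rle_trans; [|apply (Split _ B1 xi H1 P1)].
  rewrite <- (Rmult_1_r (_ * _)) at 1; apply Rmult_le_compat_l.
  { apply Rmult_le_pos; apply Cmod_ge_0. }
  rewrite <- exp_0; apply exp_le, Rmult_le_pos; [lra|].
  eapply Rle_trans; [apply Cmod_ge_0|apply Bz].
- intros t Hd; split; [split|].
  + intros xi; apply Ccont_mult; [now apply symbol_continuous|].
    apply Ccont_Cexp, Ccont_plus; [apply Cw|].
    apply Ccont_mult; [apply Ccont_const|now apply symbol_continuous].
  + exists (B0 * A * exp (tau * kappa)); intros xi.
    rewrite Cexp_plus, Cmult_assoc, !Cmod_mult.
    eapply Rle_trans; [|apply (Split _ B0 xi H0 P0)].
    apply Rmult_le_compat_l; [apply Rmult_le_pos; apply Cmod_ge_0|].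
    rewrite Cmod_Cexp; eapply Rle_trans; [|apply (Bexp (t - t0) xi Hd)].
    apply exp_le; eapply Rle_trans; [apply Rle_abs|]; eapply Rle_trans; [apply re_le_Cmod|].
    rewrite Cmod_mult, Cmod_R; lra.
  + intros xi.
    replace (g xi * Cexp (w xi + RtoC (t - t0)%R * z xi) - g xi * Cexp (w xi + RtoC (t0 - t0)%R * z xi)
      - RtoC (t - t0)%R * (g xi * z xi * Cexp (w xi)))%C with
      (g xi * Cexp (w xi) * (Cexp (RtoC (t - t0)%R * z xi) - 1 - RtoC (t - t0)%R * z xi))%C.
    2:{ rewrite Rminus_diag, !Cexp_plus.
        replace (RtoC 0 * z xi)%C with (RtoC 0) by ring; rewrite Cexp_0; ring. }
    rewrite !Cmod_mult.
    eapply Rle_trans; [apply Rmult_le_compat_l; [apply Rmult_le_pos; apply Cmod_ge_0|apply Cexp_remainder]|].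
    rewrite Cmod_mult, Cmod_R, Rpow_mult_distr, pow2_abs.
    assert (S2 := Split _ B2 xi H2 P2); cbv beta in S2; rewrite !Cmod_mult in S2.
    assert (E := Bexp (t - t0) xi Hd).
    set (X := Cmod (g xi)) in *; set (Y := Cmod (Cexp (w xi))) in *; set (Z := Cmod (z xi)) in *.
    apply Rle_trans with ((X * (Z * Z) * Y * exp (tau * (Rabs xi + kappa))) * (t - t0) ^ 2).
    * replace (X * Y * ((t - t0) ^ 2 * Z ^ 2 * exp (Rabs (t - t0) * Z))) with
        ((X * (Z * Z) * Y * exp (Rabs (t - t0) * Z)) * (t - t0) ^ 2) by ring.
      apply Rmult_le_compat_r; [apply pow2_ge_0|].
      apply Rmult_le_compat_l; [|exact E].
      repeat apply Rmult_le_pos; apply Cmod_ge_0.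
    * apply Rmult_le_compat_r; [apply pow2_ge_0|exact S2].
Qed.

Lemma bounded_continuous_plus (f g : R -> C) : bounded_continuous f -> bounded_continuous g ->
  bounded_continuous (fun xi => f xi + g xi)%C.
Proof.
intros [Cf [B HB]] [Cg [B' HB']]; split; [intros; apply Ccont_plus; auto|].
exists (B + B'); intros xi; eapply Rle_trans; [apply Cmod_triangle|].
specialize (HB xi); specialize (HB' xi); lra.
Qed.

Lemma uniform_derivative_plus (F G : R -> R -> C) (t0 : R) (F' G' : R -> C) :
  uniform_derivative F t0 F' -> uniform_derivative G t0 G' ->
  uniform_derivative (fun t xi => F t xi + G t xi)%C t0 (fun xi => F' xi + G' xi)%C.
Proof.
intros (d & M & Hd & BF & HF) (d' & M' & Hd' & BG & HG).
exists (Rmin d d'), (M + M'); split; [now apply Rmin_glb_lt|].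
split; [now apply bounded_continuous_plus|].
intros t Ht; assert (Z1 := Rmin_l d d'); assert (Z2 := Rmin_r d d').
destruct (HF t ltac:(lra)) as [B1 R1]; destruct (HG t ltac:(lra)) as [B2 R2].
split; [now apply bounded_continuous_plus|].
intros xi; specialize (R1 xi); specialize (R2 xi).
replace (F t xi + G t xi - (F t0 xi + G t0 xi) - RtoC (t - t0)%R * (F' xi + G' xi))%C with
  ((F t xi - F t0 xi - RtoC (t - t0)%R * F' xi) + (G t xi - G t0 xi - RtoC (t - t0)%R * G' xi))%C by ring.
eapply Rle_trans; [apply Cmod_triangle|]; lra.
Qed.

Lemma uniform_derivative_ext (F G : R -> R -> C) (t0 : R) (F' : R -> C) :
  (forall t xi, F t xi = G t xi) -> uniform_derivative F t0 F' -> uniform_derivative G t0 F'.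
Proof.
intros E (d & M & Hd & BF & HF); exists d, M; split; [exact Hd|]; split; [exact BF|].
intros t Ht; destruct (HF t Ht) as [[C1 [B HB]] R1]; split; [split|].
- intros xi; apply continuous_ext with (F t); [apply E|apply C1].
- exists B; intros xi; rewrite <- E; apply HB.
- intros xi; rewrite <- !E; apply R1.
Qed.

(** All of the integrand that depends on the source point. *)
Definition source_amplitude (m : medium) (s : side) (a : wave) (j : axis) (y : point) (xi : R) : C :=
  (coef m s a j xi (snd y) * Cexp (Ci * RtoC (- (fst y * xi))%R))%C.

Definition source_exponent (m : medium) (b : wave) (s : side) (y : point) (xi : R) : C :=
  (- (RtoC (orientation s) * beta m b s xi * RtoC (snd y)) + Ci * RtoC (- (fst y * xi))%R)%C.

Definition exponent_slope (m : medium) (b : wave) (s : side) (i : axis) (xi : R) : C :=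
  match i with
  | One => (- (Ci * RtoC xi))%C
  | Two => (- (RtoC (orientation s) * beta m b s xi))%C
  end.

Lemma source_exponent_affine (m : medium) (b : wave) (s : side) (i : axis) (y : point) (t xi : R) :
  source_exponent m b s (set_coord i y t) xi =
  (source_exponent m b s y xi + RtoC (t - coord i y)%R * exponent_slope m b s i xi)%C.
Proof.
destruct i; unfold source_exponent; simpl;
rewrite RtoC_minus, !RtoC_opp, !RtoC_mult; ring.
Qed.

Lemma Cmod_orientation (s : side) : Cmod (RtoC (orientation s)) = 1.
Proof. rewrite Cmod_R; destruct s; simpl; [apply Rabs_R1|rewrite Rabs_left; lra]. Qed.

Lemma orientation_abs (s : side) (y : point) : half_plane s y ->
  0 < orientation s * snd y.
Proof. destruct s; simpl; lra. Qed.

Lemma symbol_exponent_slope (m : medium) (b : wave) (s : side) (i : axis) : admissible m ->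
  symbol (exponent_slope m b s i).
Proof.
intros Hm; assert (K := k_pos m b s Hm); destruct i; simpl; apply symbol_opp, symbol_mult;
auto using symbol_const, symbol_frequency, symbol_beta.
Qed.

Lemma tame_source_exponent (m : medium) (b : wave) (s : side) (y : point) (T : R) : admissible m ->
  tame (- T) T (source_exponent m b s y).
Proof.
intros Hm; assert (K := k_pos m b s Hm).
apply tame_ext with (fun xi => - (RtoC (orientation s) * beta m b s xi * RtoC (snd y)) + (- (Ci * RtoC (fst y))) * RtoC xi)%C.
{ intros xi _; unfold source_exponent; rewrite RtoC_opp, RtoC_mult; ring. }
apply tame_plus.
- apply tame_opp, tame_mult; [apply tame_mult|]; auto using tame_const, tame_beta.
- apply tame_mult; [apply tame_const|apply symbol_frequency].
Qed.

Lemma source_exponent_decay (m : medium) (b : wave) (s : side) (y : point) (xi : R) :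
  admissible m -> half_plane s y ->
  Cmod (Cexp (source_exponent m b s y xi)) <=
    exp (orientation s * snd y * k m b s) * exp (- (2 * (orientation s * snd y / 2)) * Rabs xi).
Proof.
intros Hm Hy; assert (K := k_pos m b s Hm); assert (O := orientation_abs s y Hy).
rewrite Cmod_Cexp, <- exp_plus; apply exp_le.
assert (B := Re_beta_ge m b s xi K).
replace (Re (source_exponent m b s y xi)) with (- (orientation s * snd y * Re (beta m b s xi)))
  by (unfold source_exponent; simpl; unfold Re; ring).
replace (orientation s * snd y * k m b s + - (2 * (orientation s * snd y / 2)) * Rabs xi) with
  (- (orientation s * snd y * (Rabs xi - k m b s))) by field.
apply Ropp_le_contravar, Rmult_le_compat_l; lra.
Qed.

Lemma Cmod_exponent_slope (m : medium) (b : wave) (s : side) (i : axis) (xi : R) : admissible m ->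
  Cmod (exponent_slope m b s i xi) <= Rabs xi + k m b s.
Proof.
intros Hm; assert (K := k_pos m b s Hm); destruct i; simpl; rewrite Cmod_opp, Cmod_mult.
- rewrite Cmod_Ci, Cmod_R; lra.
- rewrite Cmod_orientation, Rmult_1_l; now apply Cmod_beta_le.
Qed.

Lemma source_amplitude_derivative (m : medium) (s : side) (a : wave) (j i : axis) (y : point) :
  admissible m -> half_plane s y ->
  tame (- k m a Plus) (k m a Plus) (source_amplitude m s a j y) /\
  exists F', tame (- k m a Plus) (k m a Plus) F' /\
    uniform_derivative (fun t => source_amplitude m s a j (set_coord i y t)) (coord i y) F'.
Proof.
intros Hm Hy; destruct (coef_symbols m s a j Hm) as (gp & gs & Sp & Ss & E).
assert (ES : forall y' xi, source_amplitude m s a j y' xi =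
  (gp xi * Cexp (source_exponent m Wp s y' xi) + gs xi * Cexp (source_exponent m Ws s y' xi))%C).
{ intros y' xi; unfold source_amplitude, source_exponent; rewrite E, !Cexp_plus.
  unfold source_decay; ring. }
assert (O := orientation_abs s y Hy).
set (T := k m a Plus).
assert (Tm : forall g b, symbol g -> tame (- T) T (fun xi => g xi * Cexp (source_exponent m b s y xi))%C).
{ intros g b Hg; apply tame_mult; [apply Hg|apply tame_Cexp; now apply tame_source_exponent]. }
assert (Fam : forall g b, symbol g ->
  uniform_derivative (fun t xi => g xi * Cexp (source_exponent m b s (set_coord i y t) xi))%C (coord i y)
    (fun xi => g xi * exponent_slope m b s i xi * Cexp (source_exponent m b s y xi))%C).
{ intros g b Hg.
  apply uniform_derivative_ext with (fun t xi => g xi * Cexp (source_exponent m b s y xi + RtoC (t - coord i y) * exponent_slope m b s i xi))%C.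
  { intros t xi; now rewrite source_exponent_affine. }
  apply (exponential_family g _ _ (coord i y) (k m b s) (orientation s * snd y / 2) (exp (orientation s * snd y * k m b s))).
  - exact Hg.
  - now apply symbol_exponent_slope.
  - intros; now apply tame_source_exponent.
  - lra.
  - intros; now apply Cmod_exponent_slope.
  - intros; now apply source_exponent_decay. }
split.
- apply tame_ext with (fun xi => gp xi * Cexp (source_exponent m Wp s y xi) + gs xi * Cexp (source_exponent m Ws s y xi))%C.
  { intros; symmetry; apply ES. }
  apply tame_plus; now apply Tm.
- eexists; split; [|apply (uniform_derivative_ext _ _ _ _ (fun t xi => eq_sym (ES (set_coord i y t) xi))); apply uniform_derivative_plus; apply Fam; assumption].
  apply tame_plus; apply (Tm (fun xi => _ xi * exponent_slope m _ s i xi)%C);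
  apply symbol_mult; auto using symbol_exponent_slope.
Qed.

Lemma set_coord_id (i : axis) (y : point) : set_coord i y (coord i y) = y.
Proof. now destruct i, y. Qed.

Lemma source_amplitude_bounded (m : medium) (s : side) (a : wave) (j : axis) (y : point) :
  admissible m -> half_plane s y -> bounded_continuous (source_amplitude m s a j y).
Proof.
intros Hm Hy; destruct (source_amplitude_derivative m s a j One y Hm Hy) as [_ (F' & _ & d & M & Hd & _ & H)].
destruct (H (coord One y)) as [B _]; [rewrite Rminus_diag, Rabs_R0; exact Hd|].
now rewrite set_coord_id in B.
Qed.

Lemma coef_side (m : medium) (s : side) (a : wave) (j : axis) (xi : R) (y : point) : half_plane s y ->
  (if Rlt_dec 0 (snd y) then coefA m a j xi (snd y) else coefB m a j xi (snd y)) = coef m s a j xi (snd y).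
Proof. destruct s; simpl; intros H; destruct (Rlt_dec 0 (snd y)); trivial; lra. Qed.

Lemma integrand_eq (m : medium) (s : side) (a : wave) (j : axis) (x y : point) (xi : R) :
  half_plane s y -> 0 < snd x ->
  integrand m a j x y xi = (source_amplitude m s a j y xi * plane_wave m a x xi)%C.
Proof.
intros Hy Hx; unfold integrand, hatU, source_amplitude, plane_wave.
rewrite (coef_side m s) by exact Hy.
destruct (Rlt_dec 0 (snd x)) as [_|N]; [|lra].
replace (Ci * RtoC ((fst x - fst y) * xi)%R)%C with
  (Ci * RtoC (- (fst y * xi))%R + Ci * RtoC (fst x * xi)%R)%C
  by (rewrite RtoC_opp, !RtoC_mult, RtoC_minus; ring).
rewrite Cexp_plus; ring.
Qed.

Lemma U_radiated (m : medium) (s : side) (a : wave) (j : axis) (x y : point) :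
  half_plane s y -> 0 < snd x ->
  U m a j x y = radiated m a x (source_amplitude m s a j y).
Proof.
intros Hy Hx; unfold U, radiated; do 2 f_equal.
apply functional_extensionality; intros xi; now apply integrand_eq.
Qed.

Lemma Uinf_far_field (m : medium) (s : side) (a : wave) (j : axis) (theta : R) (y : point) :
  half_plane s y -> Uinf m a j theta y = far_field m a theta (source_amplitude m s a j y).
Proof.
intros Hy; unfold Uinf, far_field, source_amplitude.
rewrite (coef_side m s) by exact Hy.
replace (- Ci * RtoC (k m a Plus * fst y * cos theta)%R)%C with
  (Ci * RtoC (- (fst y * (k m a Plus * cos theta)))%R)%C
  by (rewrite RtoC_opp, !RtoC_mult; ring).
ring.
Qed.

Lemma half_plane_stable (s : side) (i : axis) (y : point) : half_plane s y ->
  locally (coord i y) (fun t => half_plane s (set_coord i y t)).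
Proof.
intros Hy; destruct i; simpl.
- apply filter_forall; intros t; destruct s; exact Hy.
- destruct s; [exact (open_gt 0 (snd y) Hy)|exact (open_lt 0 (snd y) Hy)].
Qed.

Lemma functional_gradient (L : (R -> C) -> C) (V : point -> C) (m : medium) (s : side) (a : wave)
  (j i : axis) (y : point) (F' : R -> C) :
  half_plane s y -> bounded_functional L ->
  (forall y', half_plane s y' -> V y' = L (source_amplitude m s a j y')) ->
  uniform_derivative (fun t => source_amplitude m s a j (set_coord i y t)) (coord i y) F' ->
  is_Cder (fun t => V (set_coord i y t)) (coord i y) (L F').
Proof.
intros Hy HL HV HF.
apply (is_derive_ext_loc (V := C_R_NormedModule) (fun t => L (source_amplitude m s a j (set_coord i y t)))).
- generalize (half_plane_stable s i y Hy); apply filter_imp; intros t Ht; symmetry; now apply HV.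
- exact (bounded_functional_derive L _ _ _ HL HF).
Qed.

Lemma grad_eq (V : point -> C) (y : point) (i : axis) (l : C) :
  is_Cder (fun t => V (set_coord i y t)) (coord i y) l -> grad V y i = l.
Proof.
intros H; apply injective_projections; simpl; apply is_derive_unique;
[exact (is_Cder_Re _ _ _ H)|exact (is_Cder_Im _ _ _ H)].
Qed.

Lemma radiated_bigO (m : medium) (a : wave) (theta : R) (f : R -> C) (V W : R -> C) :
  admissible m -> 0 < theta < PI -> bounded_continuous f ->
  tame (- k m a Plus) (k m a Plus) f ->
  (forall r, 0 < r -> V r = radiated m a (polar r theta) f) -> (forall r, W r = far_field m a theta f) ->
  bigO_infty (fun r => V r - Cexp (Ci * RtoC (k m a Plus * r)%R) / RtoC (sqrt r) * W r)%C
    (fun r => Rpower r (- (3 / 4))).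
Proof.
intros Hm Hth Bf Tf HV HW.
destruct (radiation_asymptotics m a theta f (k_pos m a Plus Hm) Hth Bf Tf) as [M H].
exists M, (Rmax 1 (/ k m a Plus)); intros r Hr.
assert (R1 := Rmax_l 1 (/ k m a Plus)).
rewrite Rabs_pos_eq by (left; apply exp_pos).
rewrite HV, HW by lra; apply H; lra.
Qed.

Theorem theorem3p2 (m : medium)
    (hmu : 0 < mu m) (hlambda : 0 < 2 * lambda m + 2 * mu m)
    (hrho : forall s : side, 0 < rho m s) (hrho_neq : rho m Plus <> rho m Minus)
    (homega : 0 < omega m)
    (a : wave) (j : axis) (y : point) (theta : R)
    (hy : half_plane Plus y \/ half_plane Minus y)
    (htheta : 0 < theta < PI) :
  (forall r : R, 0 < r ->
     ex_RInt_gen (V := C_R_NormedModule) (integrand m a j (polar r theta) y)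
       (Rbar_locally m_infty) (Rbar_locally p_infty)) /\
  bigO_infty
    (fun r => U m a j (polar r theta) y
       - Cexp (Ci * RtoC (k m a Plus * r)%R) / RtoC (sqrt r) * Uinf m a j theta y)%C
    (fun r => Rpower r (- (3 / 4))) /\
  (forall r : R, 0 < r -> has_grad (U m a j (polar r theta)) y) /\
  has_grad (Uinf m a j theta) y /\
  (forall i : axis,
     bigO_infty
       (fun r => grad (U m a j (polar r theta)) y i
          - Cexp (Ci * RtoC (k m a Plus * r)%R) / RtoC (sqrt r)
            * grad (Uinf m a j theta) y i)%C
       (fun r => Rpower r (- (3 / 4)))).
Proof.
assert (Hm : admissible m) by (repeat split; assumption).
assert (Hs : exists s, half_plane s y) by (destruct hy; eauto); destruct Hs as [s Hy].
assert (K := k_pos m a Plus Hm).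
assert (Hx : forall r, 0 < r -> 0 < snd (polar r theta)).
{ intros r Hr; assert (0 < sin theta) by (apply sin_gt_0; lra); unfold polar; simpl; nra. }
assert (BA := source_amplitude_bounded m s a j y Hm Hy).
assert (TA := proj1 (source_amplitude_derivative m s a j One y Hm Hy)).
assert (Grad : forall i, exists F', tame (- k m a Plus) (k m a Plus) F' /\ bounded_continuous F' /\
  (forall r, 0 < r -> is_Cder (fun t => U m a j (polar r theta) (set_coord i y t)) (coord i y)
     (radiated m a (polar r theta) F')) /\
  is_Cder (fun t => Uinf m a j theta (set_coord i y t)) (coord i y) (far_field m a theta F')).
{ intros i; destruct (proj2 (source_amplitude_derivative m s a j i y Hm Hy)) as (F' & TF & HF).
  exists F'; split; [exact TF|]; split; [destruct HF as (d & M & _ & BF & _); exact BF|]; split.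
  - intros r Hr; apply (functional_gradient (radiated m a (polar r theta)) _ m s a j); auto.
    + apply radiated_functional; auto.
    + intros y' Hy'; apply U_radiated; auto.
  - apply (functional_gradient (far_field m a theta) _ m s a j); auto.
    + apply far_field_functional.
    + intros y' Hy'; now apply Uinf_far_field. }
split; [|split; [|split; [|split]]].
- intros r Hr; destruct BA as [CA [B HB]].
  destruct (plane_wave_integral m a (polar r theta) _ B K (Hx r Hr) CA HB) as [l [L _]].
  exists l; revert L; apply (is_RInt_gen_ext (V := C_R_NormedModule)).
  apply filter_forall; intros ab xi _; symmetry; apply integrand_eq; auto.
- apply (radiated_bigO m a theta (source_amplitude m s a j y)); auto.
  + intros r Hr; apply U_radiated; auto.
  + intros r; now apply Uinf_far_field.
- intros r Hr i; destruct (Grad i) as (F' & _ & _ & H & _); eexists; exact (H r Hr).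
- intros i; destruct (Grad i) as (F' & _ & _ & _ & H); eexists; exact H.
- intros i; destruct (Grad i) as (F' & TF & BF & H1 & H2).
  apply (radiated_bigO m a theta F'); auto.
  + intros r Hr; apply grad_eq, H1, Hr.
  + intros r; apply grad_eq, H2.
Qed.
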